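(* There is a canonical one-to-one correspondence between the set of admissible transformations of the class of equations $\mathcal L$: $u_t=Au_{xx}+Bu_x+Cu$ and the set of admissible transformations of the class of the associated systems ${\rm DE}_1(\mathcal L)$. Namely, each point transformation $$\tilde t=T(t),\quad \tilde x=X(t,x),\quad \tilde u=U^1(t,x)u+U^0(t,x)$$ between equations $\mathcal L$ and $\tilde{\mathcal L}$ of the first class induces a point transformation between the associated systems ${\rm DE}_1(\mathcal L)$ and ${\rm DE}_1(\tilde{\mathcal L})$, given by $\tilde t=T(t)$, $\tilde x=X(t,x)$ and $$\tilde g^1=\frac{X_x}{T_t}g^1+\frac{X_t}{T_t},\qquad \tilde g^2=\frac1{T_t}g^2+\frac{U^1_x}{T_tU^1}g^1+\frac{U^1_t}{T_tU^1},$$ $$\tilde g^3=\frac{U^1}{T_t}g^3-\frac{U^0}{T_t}g^2+\frac{U^0_xU^1-U^0U^1_x}{T_tU^1}g^1+\frac{U^0_tU^1-U^0U^1_t}{T_tU^1}.$$ In both transformations the independent variables are transformed in the same way. The induced transformations exhaust the set of admissible transformations in the class of systems ${\rm DE}_1(\mathcal L)$.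
   Context: All considerations are local. The class of equations considered consists of all $\mathcal L$: $u_t-A(t,x)u_{xx}-B(t,x)u_x-C(t,x)u=0$ with analytic arbitrary elements $A,B,C$, $A\ne0$. With each $\mathcal L$ one associates the system ${\rm DE}_1(\mathcal L)$ for functions $g^i=g^i(t,x)$, $i=1,2,3$ (the determining equations for reduction operators $\partial_t+g^1\partial_x+(g^2u+g^3)\partial_u$ of $\mathcal L$): $$g^1_t-Ag^1_{xx}-Bg^1_x+\Bigl(2g^1_x-\tfrac{A_x}{A}g^1-\tfrac{A_t}{A}\Bigr)(g^1+B)+B_xg^1+2Ag^2_x+B_t=0,$$ $$g^2_t-Ag^2_{xx}-Bg^2_x+\Bigl(2g^1_x-\tfrac{A_x}{A}g^1-\tfrac{A_t}{A}\Bigr)(g^2-C)-C_xg^1-C_t=0,$$ $$g^3_t-Ag^3_{xx}-Bg^3_x+\Bigl(2g^1_x-\tfrac{A_x}{A}g^1-\tfrac{A_t}{A}\Bigr)g^3-Cg^3=0.$$ The class of these systems is obtained as $\mathcal L$ varies; $\mathcal L\mapsto{\rm DE}_1(\mathcal L)$ is one-to-one. An admissible transformation in a class is a triple consisting of an initial system, a target system of the class, and a point transformation (invertible change of all independent and dependent variables, with nonvanishing Jacobian) mapping the former to the latter. For the class of equations $\mathcal L$, it is known that a point transformation of $(t,x,u)$ connects two equations of the class iff it has the form $\tilde t=T(t)$, $\tilde x=X(t,x)$, $\tilde u=U^1(t,x)u+U^0(t,x)$ with $T_tX_xU^1\neq0$ and $U^0/U^1$ a solution of the initial equation; the arbitrary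 elements are then transformed by $$\tilde A=\frac{X_x^2}{T_t}A,\quad \tilde B=\frac{X_x}{T_t}\Bigl(B-2\frac{U^1_x}{U^1}A\Bigr)-\frac{X_t-AX_{xx}}{T_t},\quad \tilde C=-\frac{U^1}{T_t}L\frac1{U^1},$$ where $L=\partial_t-A\partial_{xx}-B\partial_x-C$. *)

(* Defs.v *)
(* MathComp-Analysis, over an arbitrary R : realType. *)
From mathcomp Require Import all_boot all_order all_algebra.
From mathcomp Require Import all_classical all_reals all_analysis.
Import Order.TTheory GRing.Theory Num.Theory.
Import numFieldNormedType.Exports.

Set Implicit Arguments.
Unset Strict Implicit.
Unset Printing Implicit Defensive.

Local Open Scope classical_set_scope.
Local Open Scope ring_scope.

(* Points (t, x), and values (g^1, g^2, g^3) of the unknowns of DE_1. *)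
Notation base R := (R * R)%type.
Notation triple R := (R * R * R)%type.

Definition pdt (R : realType) (W : normedModType R) (f : base R -> W) :
  base R -> W := fun z => 'D_((1, 0) : base R) f z.
Definition pdx (R : realType) (W : normedModType R) (f : base R -> W) :
  base R -> W := fun z => 'D_((0, 1) : base R) f z.

(* C^oo on D: all iterated directional derivatives are differentiable on D. *)
Definition smooth_on (R : realType) (V W : normedModType R)
    (D : set V) (f : V -> W) : Prop :=
  forall (s : seq V) (p : V), D p ->
    differentiable (foldr (fun v (g : V -> W) => fun q => 'D_v g q) f s) p.

(* Sum of an absolutely convergent power series in (h, k), whose terms are
   grouped by total degree. *)
Definition analytic_at (R : realType) (f : base R -> R) (p : base R) : Prop :=
  exists (c : nat -> nat -> R) (r : R), 0 < r /\
    forall h k : R, `|h| < r -> `|k| < r ->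
      cvgn (series (fun n : nat =>
              \sum_(i < n.+1) `|c i (n - i)%N * h ^+ i * k ^+ (n - i)|)) /\
      series (fun n : nat =>
              \sum_(i < n.+1) c i (n - i)%N * h ^+ i * k ^+ (n - i))
        @ \oo --> f (p.1 + h, p.2 + k).

Definition analytic_on (R : realType) (O : set (base R)) (f : base R -> R) :
  Prop := forall p, O p -> analytic_at f p.

(* A (system of) partial differential equation(s) of order at most two for a
   W-valued function of (t, x): [S f z] means that the 2-jet of f at z lies on
   the manifold that the system defines in the jet space. *)
Definition pde (R : realType) (W : normedModType R) : Type :=
  (base R -> W) -> base R -> Prop.

(* Two systems over O are the same if they define the same manifold in the
   jet space over O. *)
Definition same_pde (R : realType) (W : normedModType R) (O : set (base R))
    (S S' : pde W) : Prop :=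
  forall (f : base R -> W) (z : base R),
    smooth_on setT f -> O z -> (S f z <-> S' f z).

Record arbitrary_elements (R : realType) := ArbitraryElements {
  eA : base R -> R;
  eB : base R -> R;
  eC : base R -> R }.

Definition elements_on (R : realType) (O : set (base R))
    (L : arbitrary_elements R) : Prop :=
  [/\ analytic_on O (eA L), analytic_on O (eB L), analytic_on O (eC L)
    & forall z, O z -> eA L z != 0].

Definition parabolic (R : realType) (L : arbitrary_elements R) : pde R :=
  fun u z =>
    pdt u z - eA L z * pdx (pdx u) z - eB L z * pdx u z - eC L z * u z = 0.

Definition DE1 (R : realType) (L : arbitrary_elements R) : pde (triple R) :=
  fun g z =>
    let A := eA L in let B := eB L in let C := eC L in
    let g1 := fun y => (g y).1.1 in
    let g2 := fun y => (g y).1.2 in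
    let g3 := fun y => (g y).2 in
    let k := 2 * pdx g1 z - pdx A z / A z * g1 z - pdt A z / A z in
    [/\ pdt g1 z - A z * pdx (pdx g1) z - B z * pdx g1 z
          + k * (g1 z + B z) + pdx B z * g1 z + 2 * A z * pdx g2 z + pdt B z
        = 0,
        pdt g2 z - A z * pdx (pdx g2) z - B z * pdx g2 z
          + k * (g2 z - C z) - pdx C z * g1 z - pdt C z = 0
      & pdt g3 z - A z * pdx (pdx g3) z - B z * pdx g3 z
          + k * g3 z - C z * g3 z = 0].

Definition class_L (R : realType) (O : set (base R)) (S : pde R) : Prop :=
  exists2 L, elements_on O L & same_pde O S (parabolic L).

Definition class_DE1 (R : realType) (O : set (base R)) (S : pde (triple R)) :
  Prop := exists2 L, elements_on O L & same_pde O S (DE1 L).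

(* The nonvanishing of the Jacobian is expressed by the invertibility of the
   differential at every point. *)
Definition point_transformation (R : realType) (W : normedModType R)
    (V : set (base R * W)) (Phi : base R * W -> base R * W) : Prop :=
  [/\ smooth_on V Phi,
      forall p q, V p -> V q -> Phi p = Phi q -> p = q
    & forall p, V p -> bijective ('d Phi p)].

Definition same_2jet (R : realType) (W : normedModType R)
    (a b : base R -> W) (z : base R) : Prop :=
  [/\ a z = b z, forall v, 'D_v a z = 'D_v b z
    & forall v w, 'D_v (fun y => 'D_w a y) z = 'D_v (fun y => 'D_w b y) z].

(* The second prolongation of Phi sends the 2-jet of f at z to the 2-jet of f'
   at the image point: along the graph of f, the identity
   w~ = f'(t~, x~) holds up to second order at z. *)
Definition prolongs (R : realType) (W : normedModType R)
    (Phi : base R * W -> base R * W) (f f' : base R -> W) (z : base R) : Prop :=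
  same_2jet (fun y => (Phi (y, f y)).2) (fun y => f' (Phi (y, f y)).1) z.

(* The prolongation of Phi, wherever it is defined, maps the manifold of S to
   that of S'. The jets of f at which the prolongation is not defined are those
   for which y |-> (t~, x~)(y, f y) is degenerate at z; since the differential
   of Phi is invertible, no f' satisfies [prolongs] for them. *)
Definition maps_pde (R : realType) (W : normedModType R)
    (V : set (base R * W)) (Phi : base R * W -> base R * W) (S S' : pde W) :
  Prop :=
  forall (f f' : base R -> W) (z : base R),
    smooth_on setT f -> smooth_on setT f' -> V (z, f z) ->
    prolongs Phi f f' z -> (S f z <-> S' f' (Phi (z, f z)).1).

Record transformation (R : realType) (W : normedModType R) := Transformation {
  source : pde W;
  target : pde W;
  tmap : base R * W -> base R * W }.

(* Admissible transformations of the class cls, from a system over O to a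
   system over O'. The transformation is defined on V, which lies over the
   whole of O but may be local with respect to the dependent variables.
   Convexity of V makes the consideration local: every point has such
   neighbourhoods. *)
Definition admissible (R : realType) (W : normedModType R)
    (cls : set (base R) -> pde W -> Prop) (O O' : set (base R))
    (V : set (base R * W)) (a : transformation W) : Prop :=
  [/\ cls O (source a), cls O' (target a),
      [/\ open V, @convex_set R (base R * W)%type V,
          fst @` V = O & forall p, V p -> O' (tmap a p).1],
      point_transformation V (tmap a)
    & maps_pde V (tmap a) (source a) (target a)].

Definition restriction_of (R : realType) (W : normedModType R)
    (O O' : set (base R)) (V : set (base R * W)) (a b : transformation W) :
  Prop :=
  [/\ same_pde O (source a) (source b), same_pde O' (target a) (target b)
    & forall p, V p -> tmap a p = tmap b p].

Record functions_TXU (R : realType) := FunctionsTXU {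
  pT : R -> R;
  pX : base R -> R;
  pU1 : base R -> R;
  pU0 : base R -> R }.

Definition transfL (R : realType) (P : functions_TXU R) :
    base R * R -> base R * R :=
  fun p => let z := p.1 in let u := p.2 in
    ((pT P z.1, pX P z), pU1 P z * u + pU0 P z).

Definition transfDE1 (R : realType) (P : functions_TXU R) :
    base R * triple R -> base R * triple R :=
  fun p =>
    let z := p.1 in
    let g1 := p.2.1.1 in let g2 := p.2.1.2 in let g3 := p.2.2 in
    let Tt := derive1 (pT P) z.1 in
    let X := pX P in let U1 := pU1 P in let U0 := pU0 P in
    ((pT P z.1, X z),
     (pdx X z / Tt * g1 + pdt X z / Tt,
      g2 / Tt + pdx U1 z / (Tt * U1 z) * g1 + pdt U1 z / (Tt * U1 z),
      U1 z / Tt * g3 - U0 z / Tt * g2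
        + (pdx U0 z * U1 z - U0 z * pdx U1 z) / (Tt * U1 z) * g1
        + (pdt U0 z * U1 z - U0 z * pdt U1 z) / (Tt * U1 z))).

Definition induces (R : realType) (O O' : set (base R))
    (V : set (base R * R)) (V' : set (base R * triple R))
    (a : transformation R) (b : transformation (triple R)) : Prop :=
  exists (L L' : arbitrary_elements R) (P : functions_TXU R),
    [/\ elements_on O L /\ elements_on O' L',
        same_pde O (source a) (parabolic L) /\
          same_pde O' (target a) (parabolic L'),
        same_pde O (source b) (DE1 L) /\ same_pde O' (target b) (DE1 L'),
        forall p, V p -> tmap a p = transfL P p
      & forall p, V' p -> tmap b p = transfDE1 P p].

(* Main.v *)
(* A reduction operator of L is the same as a vector field, and point
   transformations push vector fields forward; the displayed formulas for g~^i
   are this push-forward.  Both classes consist of systems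
   f_t = A f_xx - N(t, x, f, f_x) for W-valued f, with W = R and W = R^3, so the
   shape of their point transformations can be found once for all W.

   The jets of the source system at a point form an affine space with f_tt,
   f_tx and f_xx free.  Varying f_tt forces t~ = T(t); varying f_xx gives
   A~ = A X_x^2 / T_t and x~ = X(t, x); since N is affine in f_x, replacing f_x
   by -f_x kills the second derivative of w~ along the fibre, whence
   w~ = M(t, x) w + h(t, x).  What remains is the lower-order equation
   [transport_eq] in (w, f_x).

   For W = R its coefficients are the transformation rules of B and C and the
   equation for U^0/U^1.  For W = R^3 the terms in w f_x give the first row of M,
   those in f_x alone the other entries of M, the rule for B~ and h^1, and the
   terms in w^3 and w^2 of the last component the rule for C~ and the equation
   for U^0/U^1, where U^1 := T_t M_33 and U^0 := - T_t M_32.  Conversely these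
   rules imply [transport_eq] for both systems, and they determine h because the
   terms in f_x contain it as 2 g^1_x h / T_t only. *)
Require Import Defs.
From HB Require Import structures.
From mathcomp Require Import all_boot all_order all_algebra.
From mathcomp Require Import all_classical all_reals all_analysis.
From mathcomp Require Import ring lra.
Import Order.TTheory GRing.Theory Num.Theory.
Import numFieldNormedType.Exports.
Set Implicit Arguments.
Unset Strict Implicit.
Unset Printing Implicit Defensive.
Local Open Scope classical_set_scope.
Local Open Scope ring_scope.

(** * Smooth functions and second derivatives *)

Section smooth.
Context {R : realType}.
Implicit Types U V W : normedModType R.

(** Two facts shape the argument. [maps_pde] quantifies over globally smooth functions, so every jet
    is realised by quadratic polynomials, one at the source point and one at its image; the
    hypothesis thus becomes an algebraic equivalence between jet coordinates ([jet_equiv]). And a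
    transformation lives on an open convex [V] that may be small in the fibres: T, X, M, h are
    extracted by picking a point in each fibre, and coefficients in the dependent variables are read
    off by comparing two nearby points of one fibre.

    For the converse, the coefficients of L occur differentiated in DE_1 only along the reduction
    operator, as in B_x g^1 + B_t, and the field D_t + g^1 D_x is carried to T_t times its
    transformed counterpart; this organises the chain rule. Written with 1/T_t, U^1_x/U^1, U^1_t/U^1
    and s = U^0/U^1, the first two equations are carried over identically, the third modulo the
    equation for s and its first derivatives.

    Of the inhomogeneous part h of a transformation of DE_1 only h^1 is computed; h^2 and h^3 come
    from comparison with the transformation built from the U^1 and U^0 already found. *)

Lemma near_eq_differentiable V W (f g : V -> W) p :
  (\near p, f p = g p) -> differentiable f p -> differentiable g p.
Proof.
move=> fg df; have [dfc dfE] := (diff_locallyP p f).1 df.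
have E : g \o shift p = cst (g p) + 'd f p +o_ 0 id.
  apply/eqaddoP => _/posnumP[e].
  have /eqaddoP/(_ _ [gt0 of e%:num]) := dfE.
  have : \forall x \near (0 : V), f (x + p) = g (x + p).
    by move: fg; rewrite (near_shift 0 p) subr0.
  apply: filterS2 => x /= fgx; rewrite !fctE /= fgx.
  by rewrite (nbhs_singleton fg).
have gd := diff_unique dfc E.
by apply/diff_locallyP; rewrite gd.
Qed.

Lemma D_congr V W (D : set V) (f g : V -> W) p v : open D -> D p ->
  (forall q, D q -> f q = g q) -> 'D_v f p = 'D_v g p.
Proof.
move=> oD Dp fg; apply: near_eq_derive.
by apply: filterS (open_nbhs_nbhs (conj oD Dp)) => q /fg.
Qed.

Lemma differentiable_congr V W (D : set V) (f g : V -> W) p : open D -> D p ->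
  (forall q, D q -> f q = g q) -> differentiable f p -> differentiable g p.
Proof.
move=> oD Dp fg; apply: near_eq_differentiable.
by apply: filterS (open_nbhs_nbhs (conj oD Dp)) => q /fg.
Qed.

Lemma smooth_diff V W (D : set V) (f : V -> W) p :
  smooth_on D f -> D p -> differentiable f p.
Proof. by move=> /(_ [::]); apply. Qed.

Lemma smooth_D V W (D : set V) (f : V -> W) v :
  smooth_on D f -> smooth_on D (fun q => 'D_v f q).
Proof. by move=> sf s p Dp; have := sf (rcons s v) p Dp; rewrite foldr_rcons. Qed.

(** By induction on the list of directions, each iterated derivative agrees on the open set [D] with
    some member of [F]. Smoothness is thus proved for a family closed under derivation rather than
    for a single function, and agreement on [D] alone is enough, as the product and chain rules hold
    only there. *)
Lemma smooth_ind V W (D : set V) (F : (V -> W) -> Prop) : open D ->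
  (forall f p, F f -> D p -> differentiable f p) ->
  (forall f v, F f -> exists2 g, F g & forall p, D p -> 'D_v f p = g p) ->
  forall f, F f -> smooth_on D f.
Proof.
move=> oD Fd FD f Ff s.
suff [g Fg fg] : exists2 g, F g & forall p, D p ->
    foldr (fun v (g : V -> W) => fun q => 'D_v g q) f s p = g p.
  move=> p Dp; apply: (@differentiable_congr _ _ D g) => //; last exact: Fd.
  by move=> q Dq; rewrite fg.
elim: s => [|v s [g Fg fg]] /=; first by exists f.
have [h Fh gh] := FD g v Fg; exists h => // p Dp.
by rewrite -gh//; apply: (@D_congr _ _ D).
Qed.

Lemma smooth_congr V W (D : set V) (f g : V -> W) : open D ->
  (forall q, D q -> f q = g q) -> smooth_on D f -> smooth_on D g.
Proof.
move=> oD fg sf.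
apply: (@smooth_ind _ _ D (fun h => exists2 f, smooth_on D f &
  forall q, D q -> f q = h q)) => //; last by exists f.
- by move=> h p [k sk kh] Dp; apply: (differentiable_congr oD Dp kh);
    exact: smooth_diff sk Dp.
- move=> h v [k sk kh]; exists (fun q => 'D_v k q).
    by exists (fun q => 'D_v k q) => //; exact: smooth_D.
  by move=> p Dp; apply/esym; exact: D_congr kh.
Qed.

Lemma smooth_sub V W (D E : set V) (f : V -> W) :
  D `<=` E -> smooth_on E f -> smooth_on D f.
Proof. by move=> DE sf s p /DE; exact: sf. Qed.

Lemma D_comp U V W (f : U -> V) (g : V -> W) p v :
  differentiable f p -> differentiable g (f p) ->
  'D_v (fun q => g (f q)) p = 'D_('D_v f p) g (f p).
Proof.
move=> df dg; rewrite (deriveE _ dg) (deriveE _ df).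
rewrite (deriveE _ (differentiable_comp df dg)).
by rewrite -[X in 'd X _](_ : g \o f = _)// diff_comp.
Qed.

Lemma D_lin U V W (f : U -> V) (l : {linear V -> W}) p v :
  continuous l -> differentiable f p ->
  'D_v (fun q => l (f q)) p = l ('D_v f p).
Proof.
move=> cl df; have dl := linear_differentiable (f p) cl.
by rewrite D_comp// (deriveE _ dl) diff_lin.
Qed.

Lemma differentiable_post U V W (f : U -> V) (l : {linear V -> W}) p :
  continuous l -> differentiable f p -> differentiable (fun q => l (f q)) p.
Proof.
move=> cl df; apply: (@differentiable_comp _ _ _ _ f l) => //.
exact: linear_differentiable.
Qed.

Lemma smooth_post U V W (D : set U) (f : U -> V) (l : {linear V -> W}) :
  open D -> continuous l -> smooth_on D f -> smooth_on D (fun q => l (f q)).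
Proof.
move=> oD cl sf.
apply: (@smooth_ind _ _ D (fun h => exists2 f, smooth_on D f &
  h = fun q => l (f q))) => //; last by exists f.
- move=> _ p [k sk ->] Dp; apply: differentiable_post => //.
  exact: smooth_diff Dp.
- move=> _ v [k sk ->]; exists (fun q => l ('D_v k q)).
    by exists (fun q => 'D_v k q) => //; exact: smooth_D.
  by move=> p Dp; apply: D_lin => //; exact: smooth_diff Dp.
Qed.

Lemma D_aff U V W (f : V -> W) (l : {linear U -> V}) b p v :
  continuous l -> differentiable f (l p + b) ->
  'D_v (fun q => f (l q + b)) p = 'D_(l v) f (l p + b).
Proof.
move=> cl df.
have dl : differentiable (fun q => l q + b) p.
  by apply: differentiableD => //; exact: linear_differentiable.
rewrite (D_comp _ dl df); congr ('D_ _ f _).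
have ddl := linear_differentiable p cl.
rewrite deriveD//; try exact: diff_derivable.
by rewrite derive_cst addr0 (deriveE _ ddl) diff_lin.
Qed.

Lemma smooth_pre U V W (D : set U) (E : set V) (f : V -> W)
    (l : {linear U -> V}) b : open D -> continuous l ->
  (forall p, D p -> E (l p + b)) ->
  smooth_on E f -> smooth_on D (fun q => f (l q + b)).
Proof.
move=> oD cl DE sf.
apply: (@smooth_ind _ _ D (fun h => exists2 f, smooth_on E f &
  h = fun q => f (l q + b))) => //; last by exists f.
- move=> _ p [k sk ->] Dp.
  apply: (@differentiable_comp _ _ _ _ (fun q => l q + b) k).
    by apply: differentiableD => //; exact: linear_differentiable.
  by apply: smooth_diff sk _; exact: DE.
- move=> _ v [k sk ->]; exists (fun q => 'D_(l v) k (l q + b)).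
    by exists (fun q => 'D_(l v) k q) => //; exact: smooth_D.
  by move=> p Dp; apply: D_aff => //; apply: smooth_diff sk _; exact: DE.
Qed.

Lemma smooth_cst U V (D : set U) (w : V) : open D -> smooth_on D (fun=> w).
Proof.
move=> oD; apply: (@smooth_ind _ _ D (fun h => exists w, h = fun=> w)) => //.
- by move=> _ p [k ->] _; exact: differentiable_cst.
- move=> _ v [k ->]; exists (fun=> 0); first by exists 0.
  by move=> p _; exact: derive_cst.
- by exists w.
Qed.

Lemma smooth_add U V (D : set U) (f g : U -> V) : open D ->
  smooth_on D f -> smooth_on D g -> smooth_on D (fun q => f q + g q).
Proof.
move=> oD sf sg.
apply: (@smooth_ind _ _ D (fun h => exists f g, [/\ smooth_on D f,
  smooth_on D g & h = fun q => f q + g q])) => //; last by exists f, g.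
- move=> _ p [k [l [sk sl ->]]] Dp.
  by apply: differentiableD; [exact: smooth_diff sk Dp|exact: smooth_diff sl Dp].
- move=> _ v [k [l [sk sl ->]]]; exists (fun q => 'D_v k q + 'D_v l q).
    by exists (fun q => 'D_v k q), (fun q => 'D_v l q); split => //; exact: smooth_D.
  move=> p Dp; rewrite deriveD//; apply: diff_derivable.
    exact: smooth_diff sk Dp.
  exact: smooth_diff sl Dp.
Qed.

Lemma smooth_sum U V (D : set U) (I : Type) (r : seq I) (F : I -> U -> V) :
  open D -> (forall i, smooth_on D (F i)) ->
  smooth_on D (fun q => \sum_(i <- r) F i q).
Proof.
move=> oD sF; elim: r => [|i r IH].
  rewrite (_ : (fun _ => _) = fun=> 0); first exact: smooth_cst.
  by apply/funext => q; rewrite big_nil.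
rewrite (_ : (fun _ => _) = fun q => F i q + \sum_(i <- r) F i q).
  exact: smooth_add.
by apply/funext => q; rewrite big_cons.
Qed.

Lemma smooth_pair U V W (D : set U) (f : U -> V) (g : U -> W) : open D ->
  smooth_on D f -> smooth_on D g -> smooth_on D (fun q => (f q, g q)).
Proof.
move=> oD sf sg.
apply: (@smooth_ind _ _ D (fun h => exists f g, [/\ smooth_on D f,
  smooth_on D g & h = fun q => (f q, g q)])) => //; last by exists f, g.
- move=> _ p [k [l [sk sl ->]]] Dp.
  by apply: differentiable_pair; [exact: smooth_diff sk Dp|exact: smooth_diff sl Dp].
- move=> _ v [k [l [sk sl ->]]]; exists (fun q => ('D_v k q, 'D_v l q)).
    by exists (fun q => 'D_v k q), (fun q => 'D_v l q); split => //; exact: smooth_D.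
  move=> p Dp; have dk := smooth_diff sk Dp; have dl := smooth_diff sl Dp.
  by rewrite deriveE ?diff_pair ?deriveE//; exact: differentiable_pair.
Qed.

Lemma D_pair U V W (f : U -> V) (g : U -> W) p v :
  differentiable f p -> differentiable g p ->
  'D_v (fun q => (f q, g q)) p = ('D_v f p, 'D_v g p).
Proof.
move=> dk dl.
by rewrite deriveE ?diff_pair ?deriveE//; exact: differentiable_pair.
Qed.

(* The functions generated from smooth ones by ring operations and inverses are
   stable under derivation, so that differentiability propagates to all
   orders. *)
Inductive smooth_closure U (D : set U) : (U -> R) -> Prop :=
| SmoothBase f : smooth_on D f -> smooth_closure D f
| SmoothAdd f g : smooth_closure D f -> smooth_closure D g ->
    smooth_closure D (f + g)
| SmoothMul f g : smooth_closure D f -> smooth_closure D g ->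
    smooth_closure D (f * g)
| SmoothInv f : (forall p, D p -> f p != 0) -> smooth_closure D f ->
    smooth_closure D (fun q => (f q)^-1).

Lemma smooth_closureP U (D : set U) (f : U -> R) : open D ->
  smooth_closure D f -> smooth_on D f.
Proof.
move=> oD; have Dd : forall f p, smooth_closure D f -> D p -> differentiable f p.
  move=> h p; elim=> {h}.
  - by move=> h sh; exact: smooth_diff.
  - by move=> h k _ Ih _ Ik Dp; apply: differentiableD; [exact: Ih|exact: Ik].
  - by move=> h k _ Ih _ Ik Dp; apply: differentiableM; [exact: Ih|exact: Ik].
  - move=> h h0 _ Ih Dp; apply: differentiableV; [exact: Ih|exact: h0].
apply: smooth_ind => // {}f v; elim.
- move=> h sh; exists (fun q => 'D_v h q) => //.
  by apply: SmoothBase; exact: smooth_D.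
- move=> h k sh [h' sh' hE] sk [k' sk' kE]; exists (h' + k').
    exact: SmoothAdd.
  by move=> p Dp; rewrite deriveD ?hE ?kE//; apply: diff_derivable; exact: Dd.
- move=> h k sh [h' sh' hE] sk [k' sk' kE]; exists (h * k' + k * h').
    by apply: SmoothAdd; exact: SmoothMul.
  by move=> p Dp; rewrite deriveM ?hE ?kE//; apply: diff_derivable; exact: Dd.
- move=> h h0 sh [h' sh' hE].
  exists (cst (-1) * ((fun q => (h q)^-1) * (fun q => (h q)^-1)) * h').
    apply: SmoothMul => //; apply: SmoothMul.
      by apply: SmoothBase; exact: smooth_cst.
    by apply: SmoothMul; exact: SmoothInv.
  move=> p Dp; rewrite deriveV ?h0 ?hE//; last by apply: diff_derivable; exact: Dd.
  rewrite !fctE /= -exprVn expr2 mulN1r.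
  by [].
Qed.

Lemma smooth_mul U (D : set U) (f g : U -> R) : open D ->
  smooth_on D f -> smooth_on D g -> smooth_on D (fun q => f q * g q).
Proof.
by move=> oD sf sg; apply: smooth_closureP => //; apply: SmoothMul; exact: SmoothBase.
Qed.

Lemma smooth_inv U (D : set U) (f : U -> R) : open D ->
  (forall p, D p -> f p != 0) ->
  smooth_on D f -> smooth_on D (fun q => (f q)^-1).
Proof.
move=> oD f0 sf; apply: smooth_closureP => //; apply: SmoothInv => //.
exact: SmoothBase.
Qed.

Lemma smooth_opp U V (D : set U) (f : U -> V) : open D ->
  smooth_on D f -> smooth_on D (fun q => - f q).
Proof.
move=> oD sf; apply: (@smooth_post _ _ _ D f (-%R)) => //.
exact: opp_continuous.
Qed.

End smooth.

(** * Second differences and the symmetry of second derivatives *)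

Section calc.
Context {R : realType}.
Implicit Types U V W : normedModType R.

Lemma is_derive_line V W (f : V -> W) p v (s : R) :
  differentiable f (p + s *: v) ->
  is_derive s 1 (fun s : R => f (p + s *: v)) ('D_v f (p + s *: v)).
Proof.
move=> df.
have ds : is_diff s (fun s : R => s *: v) (fun s => s *: v) by exact: is_diff_scalel.
have dl : differentiable (fun t : R => p + t *: v) s.
  by apply: differentiableD => //; exact: differentiable_cst.
have -> : 'D_v f (p + s *: v) = 'D_1 (fun s : R => f (p + s *: v)) s.
  rewrite (D_comp _ dl df); congr ('D_ _ f _).
  rewrite deriveD; [|exact: derivable_cst|exact: diff_derivable].
  by rewrite derive_cst add0r deriveE// diff_val scale1r.
by apply/derivableP/diff_derivable; exact: differentiable_comp dl df.
Qed.

Lemma openP V (D : set V) p : open D -> D p ->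
  exists2 r : R, 0 < r & forall h, `|h| < r -> D (p + h).
Proof.
move=> oD Dp; have /nbhs_ballP[r/= r0 rD] := open_nbhs_nbhs (conj oD Dp).
exists r => // h hr; apply: rD; rewrite -ball_normE /=.
by rewrite opprD addNKr normrN.
Qed.

Lemma differentiable_bound V W (g : V -> W) p : differentiable g p ->
  forall e : R, 0 < e -> exists2 r : R, 0 < r &
    forall h, `|h| < r -> `|g (p + h) - g p - 'D_h g p| <= e * `|h|.
Proof.
move=> dg e e0; have [_ /eqaddoP/(_ e e0)] := (diff_locallyP p g).1 dg.
move=> /nbhs_ballP[r/= r0 rP]; exists r => // h hr.
have := rP h; rewrite -ball_normE /= sub0r normrN => /(_ hr).
by rewrite !fctE /= (deriveE _ dg) (addrC h) opprD addrA.
Qed.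

(** Exchanging [u] and [v] only permutes the terms; this is the source of the symmetry of second
    derivatives. *)
Definition second_difference V (f : V -> R) p u v (s : R) :=
  f (p + s *: u + s *: v) - f (p + s *: u) - f (p + s *: v) + f p.

(** The first-order expansions of D_v f at the displacements s u + t v and t v share the term t C,
    which cancels in the difference and leaves s A up to the two remainders. *)
Lemma second_difference_estimate (g1 g0 g A C s t e K x y : R) :
  0 < e -> 0 < K ->
  `|g1 - g - (s * A + t * C)| <= e / (K + K) * x -> x <= s * K ->
  `|g0 - g - (0 * A + t * C)| <= e / (K + K) * y -> y <= s * K ->
  `|g1 - g0 - s * A| <= e * s.
Proof.
move=> e0 K0 b1 xs b0 ys.
rewrite (_ : g1 - g0 - s * A =
  g1 - g - (s * A + t * C) - (g0 - g - (0 * A + t * C))); last by ring.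
apply: le_trans (ler_normB _ _) _; apply: le_trans (lerD b1 b0) _.
rewrite -mulrDr mulrAC ler_pdivrMr ?addr_gt0// -(mulrA e) ler_wpM2l ?(ltW e0)//.
by rewrite mulrDr lerD.
Qed.

(** The mean value theorem in the direction [v], applied to the increment of [f] in the direction
    [u], turns the second difference into [s] times an increment of D_v f; differentiability of D_v
    f at [p] estimates that increment. *)
Lemma second_difference_approx V (D : set V) (f : V -> R) p u v :
  open D -> D p -> (forall q, D q -> differentiable f q) ->
  differentiable (fun q => 'D_v f q) p ->
  forall e, 0 < e -> exists2 r, 0 < r & forall s, 0 < s < r ->
  `|second_difference f p u v s - s ^+ 2 * 'D_u (fun q => 'D_v f q) p|
    <= e * s ^+ 2.
Proof.
move=> oD Dp df dg e e0.
(* All displacements a u + b v with a, b in [0, s] have norm at most s K; the summand 1 makes [K]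
   positive. *)
set K := `|u| + `|v| + 1.
have K0 : 0 < K by rewrite ltr_wpDl// addr_ge0.
have [r r0 rD] := openP oD Dp.
have e'0 : 0 < e / (K + K) by rewrite divr_gt0// addr_gt0.
have [r' r'0 rg] := differentiable_bound dg e'0.
exists (Num.min r r' / K); first by rewrite divr_gt0// lt_min r0.
move=> s /andP[s0]; rewrite ltr_pdivlMr// lt_min => /andP[sr sr'].
have small a b : 0 <= a <= s -> 0 <= b <= s -> `|a *: u + b *: v| <= s * K.
  move=> /andP[a0 sa] /andP[b0 sb]; apply: (le_trans (ler_normD _ _)).
  rewrite !normrZ !ger0_norm// /K !mulrDr -[leLHS]addr0 lerD//; last first.
    by rewrite mulr1 ltW.
  by apply: lerD; exact: ler_wpM2r.
have inD a b : 0 <= a <= s -> 0 <= b <= s -> D (p + a *: u + b *: v).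
  by move=> ha hb; rewrite -addrA; apply: rD; exact: le_lt_trans (small a b ha hb) sr.
have ss : 0 <= s <= s by rewrite lexx ltW.
have s00 : 0 <= (0 : R) <= s by rewrite lexx ltW.
(* The term [0 *: u] is kept so that both summands have one shape and the same estimates serve for
   both. *)
pose phi (t : R) := f (p + s *: u + t *: v) - f (p + 0 *: u + t *: v).
pose dphi (t : R) := 'D_v f (p + s *: u + t *: v) - 'D_v f (p + 0 *: u + t *: v).
have dphiP t : 0 <= t <= s -> is_derive t 1 phi (dphi t).
  by move=> ht; apply: is_deriveB; apply: is_derive_line; apply: df; exact: inD.
have [||t] := @MVT R phi dphi 0 s s0.
- by move=> t; rewrite in_itv/= => /andP[/ltW t0 /ltW ts]; apply: dphiP; rewrite t0.
- apply: derivable_within_continuous => t; rewrite in_itv/= => /dphiP ht.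
  exact: ex_derive.
rewrite in_itv/= subr0 => /andP[t0 ts] E.
have ht : 0 <= t <= s by rewrite !ltW.
have -> : second_difference f p u v s = dphi t * s.
  rewrite -E /phi /second_difference !scale0r !addr0 opprB.
  by rewrite -!addrA; congr (_ + _); rewrite addrCA addrC -addrA addrC; ring.
rewrite /dphi -(addrA _ (s *: u)) -(addrA _ (0 *: u)).
have b1 := rg _ (le_lt_trans (small s t ss ht) sr').
have b0 := rg _ (le_lt_trans (small 0 t s00 ht) sr').
move: b1 b0; set g1 := 'D_v f (p + (s *: u + t *: v)).
set g0 := 'D_v f (p + (0 *: u + t *: v)); set gp := 'D_v f p => b1 b0.
have DE a : 'D_(a *: u + t *: v) (fun q => 'D_v f q) p =
   a * 'D_u (fun q => 'D_v f q) p + t * 'D_v (fun q => 'D_v f q) p.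
  by rewrite !deriveE// linearD !linearZ.
rewrite !DE in b1 b0.
have {b1 b0}b := second_difference_estimate e0 K0 b1 (small s t ss ht) b0 (small 0 t s00 ht).
move: b; set A := 'D_u _ p; move: g1 g0 A => g1 g0 A b.
rewrite (_ : _ - _ = (g1 - g0 - s * A) * s); last by ring.
by rewrite normrM (gtr0_norm s0) expr2 (mulrA e) ler_wpM2r// ltW.
Qed.

(** One and the same second difference approximates s^2 D_u D_v f and s^2 D_v D_u f within e s^2 / 2
    each; division by s^2 leaves an arbitrarily small bound. *)
Lemma schwarz_real V (D : set V) (f : V -> R) p u v : open D -> D p ->
  smooth_on D f ->
  'D_u (fun q => 'D_v f q) p = 'D_v (fun q => 'D_u f q) p.
Proof.
move=> oD Dp sf.
have df q : D q -> differentiable f q by exact: smooth_diff.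
have dg w : differentiable (fun q => 'D_w f q) p.
  exact: smooth_diff (smooth_D w sf) Dp.
apply/eqP; rewrite -subr_eq0 -normr_le0; apply/ler_addgt0Pl => e e0; rewrite addr0.
have e20 : 0 < e / 2 by rewrite divr_gt0.
have [r r0 rP] := second_difference_approx u oD Dp df (dg v) e20.
have [r' r'0 r'P] := second_difference_approx v oD Dp df (dg u) e20.
have m0 : 0 < Num.min r r' by rewrite lt_min r0.
have mr : Num.min r r' <= r by rewrite ge_min lexx.
have mr' : Num.min r r' <= r' by rewrite ge_min lexx orbT.
move: (Num.min r r') m0 mr mr' => m m0 mr mr'.
pose s := m / 2.
have s0 : 0 < s by rewrite divr_gt0.
have sr : s < r by rewrite /s; lra.
have sr' : s < r' by rewrite /s; lra.
have := rP s; rewrite s0 sr => /(_ isT) b.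
have := r'P s; rewrite s0 sr' => /(_ isT) b'.
have E : second_difference f p v u s = second_difference f p u v s.
  by rewrite /second_difference [p + _ + _]addrAC; ring.
rewrite E distrC in b'.
move: b b'; set d := second_difference f p u v s.
set a := 'D_u _ p; set c := 'D_v _ p => b b'.
have s2 : 0 < s ^+ 2 by rewrite exprn_gt0.
rewrite -(ler_pM2r s2) -[X in _ * X](gtr0_norm s2) -normrM.
rewrite (_ : (a - c) * _ = (d - s ^+ 2 * c) - (d - s ^+ 2 * a)); last by ring.
apply: le_trans (ler_normB _ _) _; rewrite -normrN opprB in b'.
apply: le_trans (lerD b' b) _.
by rewrite -mulrDl -splitr.
Qed.
End calc.

(** * Finite coordinate frames and the second-order chain rule *)

Section frame.
Context {R : realType}.
Implicit Types U V W : normedModType R.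

(** A finite family of vectors with continuous linear coefficients. It reduces vector-valued
    statements to real ones over an arbitrary space, so that W = R and W = R^3 are treated
    together. *)
Record frame V := Frame {
  fr_index : finType;
  fr_vec : fr_index -> V;
  fr_coord : fr_index -> {linear V -> R};
  fr_coord_continuous : forall i, continuous (fr_coord i);
  frP : forall v, v = \sum_i fr_coord i v *: fr_vec i }.

Definition frame_real : frame R.
Proof.
refine (@Frame R unit (fun=> 1) (fun=> idfun) _ _).
- by move=> _ x.
- by move=> v; rewrite big_const card_unit /= addr0 [_ *: _]mulr1.
Defined.

Definition fst_lin V W : {linear (V * W)%type -> V} := fst.
Definition snd_lin V W : {linear (V * W)%type -> W} := snd.
Lemma scalel_is_linear V (e : V) : linear (fun x : R => x *: e).
Proof. by move=> a u v; rewrite scalerDl scalerA. Qed.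

Definition scalel_lin V (e : V) : {linear R -> V} :=
  HB.pack (fun x : R => x *: e)
    (GRing.isLinear.Build _ _ _ _ _ (scalel_is_linear e)).

Definition frame_prod V W (fv : frame V) (fw : frame W) : frame (V * W)%type.
Proof.
refine (@Frame (V * W)%type (fr_index fv + fr_index fw)%type
  (fun i => match i with inl i => (fr_vec i, 0) | inr i => (0, fr_vec i) end)
  (fun i => match i with inl i => fr_coord i \o fst | inr i => fr_coord i \o snd end)
  _ _).
- case=> i x; apply: continuous_comp; try exact: fr_coord_continuous.
    exact: cvg_fst.
  exact: cvg_snd.
- move=> [v w]; rewrite big_sumType /=.
  rewrite [X in (X, _)](frP fv) [X in (_, X)](frP fw).
  apply/pair_equal_spec; split.
    transitivity ((fst_lin V W) (\sum_i fr_coord i v *: (fr_vec (f:=fv) i, 0 : W)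
        + \sum_i fr_coord i w *: (0 : V, fr_vec (f:=fw) i))) => //.
    rewrite linearD !linear_sum /= [X in _ + X]big1 ?addr0// => j _.
    by rewrite scaler0.
  transitivity ((snd_lin V W) (\sum_i fr_coord i v *: (fr_vec (f:=fv) i, 0 : W)
      + \sum_i fr_coord i w *: (0 : V, fr_vec (f:=fw) i))) => //.
  rewrite linearD !linear_sum /= [X in X + _]big1 ?add0r// => j _.
  by rewrite scaler0.
Defined.

Lemma fr_eq V (fv : frame V) (v w : V) :
  (forall i, fr_coord (f:=fv) i v = fr_coord i w) -> v = w.
Proof.
by move=> vw; rewrite (frP fv v) (frP fv w); apply: eq_bigr => i _; rewrite vw.
Qed.

Lemma smooth_coord V W (fw : frame W) (D : set V) (f : V -> W) : open D ->
  (forall i, smooth_on D (fun q => fr_coord (f:=fw) i (f q))) -> smooth_on D f.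
Proof.
move=> oD sf.
rewrite (_ : f = fun q => \sum_i fr_coord i (f q) *: fr_vec (f:=fw) i); last first.
  by apply/funext => q; exact: frP.
apply: smooth_sum => // i.
apply: (@smooth_post _ _ _ _ D (fun q => fr_coord (f:=fw) i (f q))
  (scalel_lin (fr_vec (f:=fw) i))) => //.
exact: scalel_continuous.
Qed.

Lemma differentiable_coord V W (fw : frame W) (f : V -> W) p :
  (forall i, differentiable (fun q => fr_coord (f:=fw) i (f q)) p) ->
  differentiable f p.
Proof.
move=> df.
rewrite (_ : f = fun q => \sum_i fr_coord i (f q) *: fr_vec (f:=fw) i); last first.
  by apply/funext => q; exact: frP.
elim: (index_enum _) => [|i r IH].
  rewrite (_ : (fun _ => _) = cst 0); first exact: differentiable_cst.
  by apply/funext => q; rewrite big_nil.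
rewrite (_ : (fun _ => _) = (fun q => fr_coord i (f q) *: fr_vec (f:=fw) i) +
    fun q => \sum_(i <- r) fr_coord i (f q) *: fr_vec (f:=fw) i); last first.
  by apply/funext => q; rewrite big_cons.
by apply: differentiableD => //; exact: differentiableZl.
Qed.

Lemma D_coord V W (fw : frame W) (f : V -> W) p v i : differentiable f p ->
  fr_coord (f:=fw) i ('D_v f p) = 'D_v (fun q => fr_coord i (f q)) p.
Proof. by move=> df; rewrite D_lin//; exact: fr_coord_continuous. Qed.

Lemma smooth_fr V W (fw : frame W) (D : set V) (f : V -> W) i : open D ->
  smooth_on D f -> smooth_on D (fun q => fr_coord (f:=fw) i (f q)).
Proof.
move=> oD; apply: (@smooth_post _ _ _ _ D f (fr_coord (f:=fw) i)) => //.
exact: fr_coord_continuous.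
Qed.

Lemma differentiable_fr V W (fw : frame W) (f : V -> W) i p :
  differentiable f p -> differentiable (fun q => fr_coord (f:=fw) i (f q)) p.
Proof.
apply: (@differentiable_post _ _ _ _ f (fr_coord (f:=fw) i)).
exact: fr_coord_continuous.
Qed.

Lemma schwarz V W (fw : frame W) (D : set V) (f : V -> W) p u v :
  open D -> D p -> smooth_on D f ->
  'D_u (fun q => 'D_v f q) p = 'D_v (fun q => 'D_u f q) p.
Proof.
move=> oD Dp sf; apply: (fr_eq (fv := fw)) => i.
have E w w' : fr_coord i ('D_w (fun q => 'D_w' f q) p) =
    'D_w (fun q => 'D_w' (fun q => fr_coord i (f q)) q) p.
  rewrite D_coord; last exact: smooth_diff (smooth_D _ sf) Dp.
  apply: (D_congr w oD Dp) => q Dq; rewrite D_coord//.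
  exact: smooth_diff sf Dq.
rewrite !E; apply: (schwarz_real _ _ oD Dp); exact: smooth_fr.
Qed.

Lemma D_cst_segment_real V (f : V -> R) p v c :
  (forall s, 0 <= s <= 1 -> differentiable f (p + s *: v)) ->
  (forall s, 0 <= s <= 1 -> 'D_v f (p + s *: v) = c) -> f (p + v) = f p + c.
Proof.
move=> df dc.
have dP (s : R) : 0 <= s <= 1 -> is_derive s 1 (fun s : R => f (p + s *: v)) c.
  by move=> hs; rewrite -(dc s hs); apply: is_derive_line; exact: df.
have [|| x _] := @MVT R (fun s : R => f (p + s *: v)) (fun=> c) 0 1 ltr01.
- by move=> s; rewrite in_itv/= => /andP[/ltW s0 /ltW s1]; apply: dP; rewrite s0.
- apply: derivable_within_continuous => s; rewrite in_itv/= => /dP hs.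
  exact: ex_derive.
by rewrite scale0r scale1r addr0 subr0 mulr1 => <-; rewrite addrCA subrr addr0.
Qed.

(** Coordinatewise, because the mean value theorem is a statement about real values. *)
Lemma D_cst_segment V W (fw : frame W) (f : V -> W) p v c :
  (forall s, 0 <= s <= 1 -> differentiable f (p + s *: v)) ->
  (forall s, 0 <= s <= 1 -> 'D_v f (p + s *: v) = c) -> f (p + v) = f p + c.
Proof.
move=> df dc; apply: (fr_eq (fv := fw)) => i; rewrite linearD.
apply: (D_cst_segment_real (f := fun q => fr_coord i (f q))) => s hs.
  by apply: differentiable_fr; exact: df.
by rewrite -D_coord ?dc//; exact: df.
Qed.

Lemma D_frame V W (fv : frame V) (f : V -> W) p v : differentiable f p ->
  'D_v f p = \sum_i fr_coord (f:=fv) i v *: 'D_(fr_vec i) f p.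
Proof.
move=> df; rewrite [in LHS](frP fv v) deriveE// linear_sum.
by apply: eq_bigr => i _; rewrite linearZ deriveE.
Qed.

Lemma D_sumM V (I : Type) (r : seq I) (k F : I -> V -> R) p v :
  (forall i, differentiable (k i) p) -> (forall i, differentiable (F i) p) ->
  differentiable (fun q => \sum_(i <- r) k i q * F i q) p /\
  'D_v (fun q => \sum_(i <- r) k i q * F i q) p =
  \sum_(i <- r) ('D_v (k i) p * F i p + k i p * 'D_v (F i) p).
Proof.
move=> dk dF; elim: r => [|i r [dr IH]].
  rewrite big_nil (_ : (fun _ => _) = cst 0); last first.
    by apply/funext => q; rewrite big_nil.
  by split; [exact: differentiable_cst|exact: derive_cst].
rewrite (_ : (fun _ => _) = (k i * F i) +
    fun q => \sum_(i <- r) k i q * F i q); last first.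
  by apply/funext => q; rewrite big_cons.
have dM : differentiable (k i * F i) p by exact: differentiableM.
split; first exact: differentiableD.
rewrite big_cons -IH deriveD; try exact: diff_derivable.
rewrite deriveM; try exact: diff_derivable.
by congr (_ + _); rewrite addrC; congr (_ + _); rewrite mulrC.
Qed.

(** The regularity that the second-order chain rule at [z] asks of the inner map. *)
Definition C2_at U V (E : set U) (f : U -> V) z :=
  (forall y, E y -> differentiable f y) /\
  forall v, differentiable (fun y => 'D_v f y) z.

Lemma smooth_C2 U V (E : set U) (f : U -> V) z :
  smooth_on E f -> E z -> C2_at E f z.
Proof.
move=> sf Ez; split; first by move=> y; exact: smooth_diff.
by move=> v; apply: smooth_diff (smooth_D v sf) Ez.
Qed.

Section comp2.
Variables (U V W : normedModType R) (fv : frame V) (fw : frame W).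
Variables (E : set U) (D : set V) (F : V -> W) (f : U -> V) (z : U).
Hypotheses (oE : open E) (Ez : E z) (oD : open D) (sF : smooth_on D F).
Hypotheses (ED : forall y, E y -> D (f y)) (C2f : C2_at E f z).

Let dF y : E y -> differentiable F (f y).
Proof. by move=> Ey; apply: smooth_diff sF _; exact: ED. Qed.

Lemma C2_comp_D y v : E y ->
  'D_v (fun q => F (f q)) y = 'D_('D_v f y) F (f y).
Proof. by move=> Ey; rewrite D_comp//; [exact: C2f.1|exact: dF]. Qed.

(** Along the frame of [V] the first derivative of the composite is a finite sum of products
    [k j y * G j (f y)] of differentiable real functions. The product rule gives the two summands:
    differentiating [k j] yields the term with the second derivative of [f], differentiating [G j]
    the Hessian of [F]. *)
Let main v u i :
  differentiable (fun y => fr_coord (f:=fw) i ('D_v (fun q => F (f q)) y)) z /\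
  'D_u (fun y => fr_coord (f:=fw) i ('D_v (fun q => F (f q)) y)) z =
  fr_coord i ('D_('D_u (fun y => 'D_v f y) z) F (f z) +
  'D_('D_u f z) (fun q => 'D_('D_v f z) F q) (f z)).
Proof.
pose k j y := fr_coord (f:=fv) j ('D_v f y).
pose G j q := fr_coord i ('D_(fr_vec (f:=fv) j) F q).
have sG j : smooth_on D (G j).
  by apply: smooth_fr => //; exact: smooth_D.
have EE y : E y -> fr_coord i ('D_v (fun q => F (f q)) y) =
    \sum_j k j y * G j (f y).
  move=> Ey; rewrite C2_comp_D// (D_frame fv)//; last exact: dF.
  by rewrite linear_sum; apply: eq_bigr => j _; rewrite linearZ.
have dk j : differentiable (k j) z.
  by apply: differentiable_fr; exact: C2f.2.
have df := C2f.1 z Ez.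
have dG j : differentiable (G j) (f z) by apply: smooth_diff (sG j) _; exact: ED.
have dGf j : differentiable (fun y => G j (f y)) z.
  exact: differentiable_comp.
have [dS DS] := D_sumM (index_enum _) u dk dGf.
split.
  by apply: (differentiable_congr oE Ez) dS => y Ey; rewrite EE.
rewrite (D_congr u oE Ez EE) DS big_split linearD; congr (_ + _).
  rewrite (D_frame fv _ (dF Ez)) linear_sum; apply: eq_bigr => j _.
  rewrite linearZ /k D_coord//; exact: C2f.2.
rewrite D_coord; last by apply: smooth_diff (smooth_D _ sF) _; exact: ED.
have EG q : D q -> fr_coord i ('D_('D_v f z) F q) = \sum_j k j z * G j q.
  move=> Dq; rewrite (D_frame fv)//; last exact: smooth_diff Dq.
  by rewrite linear_sum; apply: eq_bigr => j _; rewrite linearZ.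
rewrite (D_congr _ oD (ED Ez) EG).
have dc j : differentiable (fun=> k j z : R) (f z) by exact: differentiable_cst.
rewrite (D_sumM (index_enum _) _ dc dG).2; apply: eq_bigr => j _.
by rewrite derive_cst mul0r add0r (D_comp _ df (dG j)).
Qed.

Lemma C2_comp : C2_at E (fun q => F (f q)) z.
Proof.
split.
  by move=> y Ey; apply: differentiable_comp; [exact: C2f.1|exact: dF].
by move=> v; apply: (differentiable_coord (fw := fw)) => i; have [] := main v 0 i.
Qed.

Lemma D2_comp u v : 'D_u (fun y => 'D_v (fun q => F (f q)) y) z =
  'D_('D_u (fun y => 'D_v f y) z) F (f z) +
  'D_('D_u f z) (fun q => 'D_('D_v f z) F q) (f z).
Proof.
apply: (fr_eq (fv := fw)) => i; have [dm Dm] := main v u i.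
by rewrite D_coord ?Dm//; exact: C2_comp.2.
Qed.

End comp2.
End frame.

(** * Differentiability of analytic functions *)

Section analytic.
Context {R : realType}.

(** A homogeneous term of degree n at (h, k) is at most (m / rho)^n times the sum of absolute values
    at (rho, rho), and (m / rho)^n is at most (m / rho)^2 for n at least 2; so everything beyond the
    affine part is quadratically small. *)
Lemma analytic_approx (c : nat -> nat -> R) (F rho : R) (h k m : R) : 0 < rho ->
  cvgn (series (fun n : nat =>
    \sum_(i < n.+1) `|c i (n - i)%N * rho ^+ i * rho ^+ (n - i)|)) ->
  `|h| <= m -> `|k| <= m -> m <= rho ->
  series (fun n : nat => \sum_(i < n.+1) c i (n - i)%N * h ^+ i * k ^+ (n - i))
    @ \oo --> F ->
  `|F - (c 0 0 + (c 1 0 * h + c 0 1 * k))|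
    <= (m / rho) ^+ 2 * limn (series (fun n : nat =>
    \sum_(i < n.+1) `|c i (n - i)%N * rho ^+ i * rho ^+ (n - i)|)).
Proof.
set a := fun n : nat => \sum_(i < n.+1) _; set t := fun n : nat => _.
move=> rho0 ca hm km mrho tF.
have m0 : 0 <= m by exact: le_trans hm.
have a0 n : 0 <= a n by apply: sumr_ge0 => i _.
have aK N : series a N <= limn (series a).
  apply: nondecreasing_cvgn_le => // x y xy; exact: nondecreasing_series.
have ta n : (1 < n)%N -> `|t n| <= (m / rho) ^+ 2 * a n.
  move=> n1; rewrite /t /a mulr_sumr; apply: (le_trans (ler_norm_sum _ _ _)).
  apply: ler_sum => i _; have ir := leq_ord i.
  rewrite !normrM !normrX (gtr0_norm rho0) -!(mulrA `|c _ _|) [leRHS]mulrCA.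
  rewrite ler_wpM2l// -exprD subnKC//.
  apply: (@le_trans _ _ (m ^+ n)).
    rewrite -[in leRHS](subnKC ir) exprD ler_pM ?exprn_ge0//.
      by rewrite lerXn2r ?nnegrE.
    by rewrite lerXn2r ?nnegrE.
  rewrite -(subnKC n1) !exprD expr_div_n mulrA divfK ?expf_neq0 ?gt_eqF//.
  by rewrite ler_wpM2l ?exprn_ge0// lerXn2r ?nnegrE// ltW.
(* Two terms are split off the partial sum: degrees 0 and 1 make up the affine part, and the bound
   [ta] covers the tail. *)
have bN N : `|series t N.+2 - (c 0 0 + (c 1 0 * h + c 0 1 * k))|
    <= (m / rho) ^+ 2 * limn (series a).
  rewrite /series /= big_nat_recl// big_nat_recl// /t /=.
  rewrite !big_ord_recl !big_ord0 /= !expr0 !expr1 !mulr1 !addr0.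
  rewrite [c 0 _ * _ + _]addrC !addrA addrAC.
  have -> : bump 0 0 = 1%N by [].
  rewrite !subn0 subnn (_ : _ - _ = \sum_(0 <= i < N) t i.+2); last by rewrite /t; ring.
  apply: (@le_trans _ _ ((m / rho) ^+ 2 * series a N.+2)); last first.
    by rewrite ler_wpM2l ?sqr_ge0.
  rewrite /series /= big_nat_recl// big_nat_recl// !mulrDr addrA ler_wpDl//.
    by rewrite addr_ge0// mulr_ge0 ?sqr_ge0.
  rewrite mulr_sumr; apply: (le_trans (ler_norm_sum _ _ _)).
  by apply: ler_sum => i _; exact: ta.
rewrite -[leRHS]addr0; apply/ler_addgt0Pl => e e0.
have /cvgrPdist_le/(_ e e0)[N _ /(_ N.+2)] := tF.
rewrite /= => /(_ (leq_trans (leqnSn _) (leqnSn _))) bF.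
rewrite -(subrKA (series t N.+2)) addr0; apply: le_trans (ler_normD _ _) _.
exact: lerD.
Qed.

Lemma differentiable_approx (V W : normedModType R) (f : V -> W)
    (L : {linear V -> W}) p : continuous L ->
  (forall e : R, 0 < e -> exists2 d : R, 0 < d &
    forall x, `|x| < d -> `|f (x + p) - (f p + L x)| <= e * `|x|) ->
  differentiable f p.
Proof.
move=> cL fL.
have E : f \o shift p = cst (f p) + L +o_ 0 id.
  apply/eqaddoP => e /fL[d d0 dP]; apply/nbhs_ballP; exists d => // x.
  by rewrite -ball_normE /= sub0r normrN => /dP; rewrite !fctE.
have dL := diff_unique cL E.
by apply/diff_locallyP; rewrite dL.
Qed.

(** The remainder after the affine part of the series is quadratic by [analytic_approx], at the
    radius [r / 2] inside the domain of absolute convergence. The chain rule for target coefficients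
    composed with a transformation rests on this. *)
Lemma analytic_differentiable (f : base R -> R) p :
  analytic_at f p -> differentiable f p.
Proof.
move=> [c [r [r0 cf]]].
pose rho := r / 2.
have rho0 : 0 < rho by rewrite divr_gt0.
have rr : `|rho| < r by rewrite gtr0_norm// /rho; lra.
have [ca _] := cf rho rho rr rr.
set K := limn (series (fun n : nat =>
    \sum_(i < n.+1) `|c i (n - i)%N * rho ^+ i * rho ^+ (n - i)|)).
have b x : `|x| <= rho ->
    `|f (x + p) - (c 0 0 + (c 1 0 * x.1 + c 0 1 * x.2))| <= (`|x| / rho) ^+ 2 * K.
  move=> xr; have x1 : `|x.1| <= `|x| by rewrite prod_normE le_max lexx.
  have x2 : `|x.2| <= `|x| by rewrite prod_normE le_max lexx orbT.
  have xr' : `|x| < r by rewrite (le_lt_trans xr)// -(gtr0_norm rho0).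
  have [_] := cf x.1 x.2 (le_lt_trans x1 xr') (le_lt_trans x2 xr').
  rewrite (addrC x p).
  exact: analytic_approx.
have fp : f p = c 0 0.
  have := b 0; rewrite normr0 => /(_ (ltW rho0)).
  rewrite mul0r expr0n mul0r add0r !mulr0 !addr0.
  by rewrite normr_le0 subr_eq0 => /eqP.
have K0 : 0 <= K.
  apply: le_trans (nondecreasing_cvgn_le _ ca 0%N).
    by rewrite /series /= big_geq.
  by move=> x y xy; apply: nondecreasing_series => // n _ _; exact: sumr_ge0.
pose l (x : base R) := c 1 0 * x.1 + c 0 1 * x.2.
have ll : linear l.
  move=> s u v; transitivity (c 1 0 * (s * u.1 + v.1) + c 0 1 * (s * u.2 + v.2)) => //.
  by transitivity (s * (c 1 0 * u.1 + c 0 1 * u.2) + (c 1 0 * v.1 + c 0 1 * v.2)) => //; ring.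
pose L : {linear base R -> R} := HB.pack l (GRing.isLinear.Build _ _ _ _ _ ll).
have cL : continuous L.
  move=> x; apply: cvgD; (apply: cvgMl_tmp || apply: cvgMr_tmp).
    exact: cvg_fst.
  exact: cvg_snd.
apply: (differentiable_approx cL) => e e0.
(* Within this radius the quadratic bound (|x| / rho)^2 K is at most e |x|; [K + 1] replaces [K],
   which may vanish. *)
have d0 : 0 < Num.min rho (e * rho ^+ 2 / (K + 1)).
  by rewrite lt_min rho0 divr_gt0 ?mulr_gt0 ?exprn_gt0// ltr_wpDl.
exists (Num.min rho (e * rho ^+ 2 / (K + 1))) => // x.
rewrite lt_min => /andP[xr]; rewrite ltr_pdivlMr ?ltr_wpDl// => xe.
rewrite fp; apply: le_trans (b x (ltW xr)) _.
rewrite expr_div_n mulrAC ler_pdivrMr ?exprn_gt0//.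
rewrite (mulrAC e) (_ : _ * K = `|x| * K * `|x|); last by ring.
rewrite ler_wpM2r// (le_trans _ (ltW xe))//.
by rewrite ler_wpM2l// lerDl.
Qed.
End analytic.

(** * Segments in convex sets and quadratic polynomials with prescribed 2-jets *)

Section quad.
Context {R : realType}.
Implicit Types U V W : normedModType R.

Lemma convex_segment V (D : set V) p v (s : R) :
  @convex_set R V D -> D p -> D (p + v) -> 0 <= s <= 1 -> D (p + s *: v).
Proof.
move=> cD Dp Dv; rewrite le_eqVlt => /andP[/predU1P[<- _|s0]].
  by rewrite scale0r addr0.
rewrite le_eqVlt => /predU1P[->|s1]; first by rewrite scale1r.
have := cD (p + v) p (Itv01 (ltW s0) (ltW s1)).
rewrite !inE => /(_ Dv Dp); congr D.
have -> : p + s *: v = s *: (p + v) + (1 - s) *: p.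
  by rewrite scalerDr addrAC -scalerDl subrKC scale1r.
by [].
Qed.

(** The coordinates of a frame already separate points. Identities in the module [W] are thereby
    turned into identities in [R], within reach of [ring] and [field]. *)
Lemma fr_ext W (fw : frame W) (v w : W) :
  (forall l : {linear W -> R}, l v = l w) -> v = w.
Proof. by move=> vw; apply: (fr_eq (fv := fw)). Qed.

Lemma scaleE (a b : R) : a *: b = a * b. Proof. by []. Qed.

Lemma linZ W (l : {linear W -> R}) a v : l (a *: v) = a * l v.
Proof. exact: linearZ. Qed.

Lemma linD W (l : {linear W -> R}) u v : l (u + v) = l u + l v.
Proof. exact: linearD. Qed.

Lemma lin0 W (l : {linear W -> R}) : l 0 = 0.
Proof. exact: linear0. Qed.

Lemma linN W (l : {linear W -> R}) u : l (- u) = - l u.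
Proof. exact: linearN. Qed.

(** The Taylor polynomial at [z] with f = [w], f_t = [p], f_x = [q], f_tt = [a], f_tx = [b], f_xx =
    [c]: a globally smooth function with an arbitrary 2-jet, as instances of [maps_pde] require. *)
Definition quad W (z : base R) (w p q a b c : W) (y : base R) : W :=
  w + (y.1 - z.1) *: p + (y.2 - z.2) *: q +
  ((y.1 - z.1) * (y.1 - z.1)) *: (2^-1 *: a) + ((y.1 - z.1) * (y.2 - z.2)) *: b +
  ((y.2 - z.2) * (y.2 - z.2)) *: (2^-1 *: c).

Lemma DZl U V (k : U -> R) (e : V) p v : differentiable k p ->
  'D_v (fun q => k q *: e) p = 'D_v k p *: e.
Proof.
move=> dk; have := @D_lin R _ _ _ k (scalel_lin e) p v.
by apply => //; exact: scalel_continuous.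
Qed.

Lemma differentiable_fst V W (p : V * W) : differentiable (fst : V * W -> V) p.
Proof.
by apply: (@linear_differentiable _ _ _ (fst_lin V W)) => x; exact: cvg_fst.
Qed.

Lemma differentiable_snd V W (p : V * W) : differentiable (snd : V * W -> W) p.
Proof.
by apply: (@linear_differentiable _ _ _ (snd_lin V W)) => x; exact: cvg_snd.
Qed.

Lemma D_fst U V W (f : U -> V * W) p v : differentiable f p ->
  'D_v (fun q => (f q).1) p = ('D_v f p).1.
Proof.
by move=> df; apply: (@D_lin _ _ _ _ f (fst_lin V W)) => // x; exact: cvg_fst.
Qed.

Lemma D_snd U V W (f : U -> V * W) p v : differentiable f p ->
  'D_v (fun q => (f q).2) p = ('D_v f p).2.
Proof.
by move=> df; apply: (@D_lin _ _ _ _ f (snd_lin V W)) => // x; exact: cvg_snd.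
Qed.

Lemma is_derive_fst_sub (y v : base R) (c : R) :
  differentiable (fun y : base R => y.1 - c) y /\
  'D_v (fun y : base R => y.1 - c) y = v.1.
Proof.
have d : differentiable (fst : base R -> R) y by exact: differentiable_fst.
split; first by apply: differentiableB => //; exact: differentiable_cst.
rewrite deriveB; [|exact: diff_derivable|exact: derivable_cst].
by rewrite derive_cst subr0 (D_fst v (f := id))// derive_id.
Qed.

Lemma is_derive_snd_sub (y v : base R) (c : R) :
  differentiable (fun y : base R => y.2 - c) y /\
  'D_v (fun y : base R => y.2 - c) y = v.2.
Proof.
have d : differentiable (snd : base R -> R) y by exact: differentiable_snd.
split; first by apply: differentiableB => //; exact: differentiable_cst.
rewrite deriveB; [|exact: diff_derivable|exact: derivable_cst].
by rewrite derive_cst subr0 (D_snd v (f := id))// derive_id.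
Qed.

Lemma quad_arith (k1 k2 v1 v2 p q a b c : R) :
  0 + v1 * p + v2 * q + (v1 * k1 + v1 * k1) * (2^-1 * a) +
    (v2 * k1 + v1 * k2) * b + (v2 * k2 + v2 * k2) * (2^-1 * c) =
  v1 * p + v2 * q + k1 * (v1 * a + v2 * b) + k2 * (v1 * b + v2 * c) +
    k1 * k1 * (2^-1 * 0) + k1 * k2 * 0 + k2 * k2 * (2^-1 * 0).
Proof. by field. Qed.

(** The derivative is again a [quad], with vanishing second-order part; so the family is closed
    under derivation and [smooth_ind] applies. *)
Lemma D_quad W (fw : frame W) z (w p q a b c : W) (y v : base R) :
  differentiable (quad z w p q a b c) y /\
  'D_v (quad z w p q a b c) y = quad z (v.1 *: p + v.2 *: q)
    (v.1 *: a + v.2 *: b) (v.1 *: b + v.2 *: c) 0 0 0 y.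
Proof.
have [d1 D1] := is_derive_fst_sub y v z.1.
have [d2 D2] := is_derive_snd_sub y v z.2.
pose k1 (y : base R) := y.1 - z.1; pose k2 (y : base R) := y.2 - z.2.
have d11 : differentiable (fun y => k1 y * k1 y) y by exact: differentiableM.
have d22 : differentiable (fun y => k2 y * k2 y) y by exact: differentiableM.
have d12 : differentiable (fun y => k1 y * k2 y) y by exact: differentiableM.
have E11 : 'D_v (fun y => k1 y * k1 y) y = v.1 * k1 y + v.1 * k1 y.
  rewrite deriveM; try exact: diff_derivable.
  by rewrite D1 !scaleE; ring.
have E22 : 'D_v (fun y => k2 y * k2 y) y = v.2 * k2 y + v.2 * k2 y.
  rewrite deriveM; try exact: diff_derivable.
  by rewrite D2 !scaleE; ring.
have E12 : 'D_v (fun y => k1 y * k2 y) y = v.2 * k1 y + v.1 * k2 y.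
  rewrite deriveM; try exact: diff_derivable.
  by rewrite D1 D2 !scaleE; ring.
have dZ (k : base R -> R) (e : W) : differentiable k y ->
  differentiable (fun y => k y *: e) y by exact: differentiableZl.
have dq1 := differentiableD (differentiable_cst w y) (dZ _ p d1).
have dq2 := differentiableD dq1 (dZ _ q d2).
have dq3 := differentiableD dq2 (dZ _ (2^-1 *: a) d11).
have dq4 := differentiableD dq3 (dZ _ b d12).
have dq5 := differentiableD dq4 (dZ _ (2^-1 *: c) d22).
split => //.
rewrite (_ : quad _ _ _ _ _ _ _ = cst w + (fun y => k1 y *: p)
  + (fun y => k2 y *: q) + (fun y => (k1 y * k1 y) *: (2^-1 *: a))
  + (fun y => (k1 y * k2 y) *: b) + (fun y => (k2 y * k2 y) *: (2^-1 *: c))) //.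
rewrite !deriveD; do ?exact: diff_derivable; try by apply: diff_derivable; exact: dZ.
rewrite derive_cst !DZl// E11 E22 E12 D1 D2 /quad /k1 /k2.
apply: (fr_ext fw) => l; rewrite !(linD l, linZ l) !(lin0 l).
exact: quad_arith.
Qed.

Lemma smooth_quad W (fw : frame W) z (w p q a b c : W) D : open D ->
  smooth_on D (quad z w p q a b c).
Proof.
move=> oD; apply: (@smooth_ind _ _ _ D (fun f => exists w p q a b c,
  f = quad z w p q a b c)) => //; last by exists w, p, q, a, b, c.
- by move=> _ y [? [? [? [? [? [? ->]]]]]] _; exact: (D_quad fw _ _ _ _ _ _ _ _ 0).1.
- move=> _ v [w' [p' [q' [a' [b' [c' ->]]]]]]; eexists; last first.
    by move=> y _; exact: (D_quad fw _ _ _ _ _ _ _ _ v).2.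
  by do 6 eexists; reflexivity.
Qed.

Lemma quad0 W (fw : frame W) z (w p q a b c : W) : quad z w p q a b c z = w.
Proof. by apply: (fr_ext fw) => l; rewrite /quad !(linD l, linZ l); ring. Qed.

Lemma D_quad0 W (fw : frame W) z (w p q a b c : W) (v : base R) :
  'D_v (quad z w p q a b c) z = v.1 *: p + v.2 *: q.
Proof. by rewrite (D_quad fw _ _ _ _ _ _ _ _ v).2 (quad0 fw). Qed.

Lemma D2_quad W (fw : frame W) z (w p q a b c : W) (u v : base R) :
  'D_u (fun y => 'D_v (quad z w p q a b c) y) z =
  u.1 *: (v.1 *: a + v.2 *: b) + u.2 *: (v.1 *: b + v.2 *: c).
Proof.
rewrite (_ : (fun y => _) = quad z (v.1 *: p + v.2 *: q)
    (v.1 *: a + v.2 *: b) (v.1 *: b + v.2 *: c) 0 0 0); last first.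
  by apply/funext => y; rewrite (D_quad fw _ _ _ _ _ _ _ _ v).2.
by rewrite (D_quad0 fw).
Qed.
End quad.

(* A sealed copy of the directional derivative: unification would otherwise
   unfold limits whenever two derivatives fail to match syntactically. *)
HB.lock Definition dd (R : realType) (V W : normedModType R) (f : V -> W)
  (v p : V) : W := 'D_v f p.
Arguments dd {R V W} f v p.

Section dd.
Context {R : realType}.
Implicit Types U V W : normedModType R.

Lemma ddE V W (f : V -> W) v p : 'D_v f p = dd f v p.
Proof. by rewrite dd.unlock. Qed.

Lemma ddfE V W (f : V -> W) v : (fun p => 'D_v f p) = dd f v.
Proof. by rewrite dd.unlock. Qed.

Lemma pdtE W (f : base R -> W) : pdt f = dd f (1, 0).
Proof. by rewrite dd.unlock. Qed.

Lemma pdxE W (f : base R -> W) : pdx f = dd f (0, 1).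
Proof. by rewrite dd.unlock. Qed.

Lemma smooth_dd V W (D : set V) (f : V -> W) v : smooth_on D f ->
  smooth_on D (dd f v).
Proof. by move=> sf; rewrite -ddfE; exact: smooth_D. Qed.

Lemma dd_congr V W (D : set V) (f g : V -> W) p v : open D -> D p ->
  (forall q, D q -> f q = g q) -> dd f v p = dd g v p.
Proof. by rewrite dd.unlock; exact: D_congr. Qed.

Lemma dd_cst V W (w : W) v (p : V) : dd (fun=> w) v p = 0.
Proof. by rewrite dd.unlock; exact: derive_cst. Qed.

(** The decomposition of the direction is a separate premise because explicit pairs such as
    [((1, 0), p)] are seldom literally of the form of a linear combination. *)
Lemma dd_linear2 V W (f : V -> W) p s t w u v :
  differentiable f p -> w = s *: u + t *: v ->
  dd f w p = s *: dd f u p + t *: dd f v p.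
Proof.
by move=> df ->; rewrite dd.unlock !(deriveE _ df) linearD !linearZ.
Qed.

Lemma ddD V W (f : V -> W) p w u v : differentiable f p -> w = u + v ->
  dd f w p = dd f u p + dd f v p.
Proof.
by move=> df ->; rewrite dd.unlock !(deriveE _ df) linearD.
Qed.

Lemma ddZ V W (f : V -> W) p s w u : differentiable f p -> w = s *: u ->
  dd f w p = s *: dd f u p.
Proof.
by move=> df ->; rewrite dd.unlock !(deriveE _ df) linearZ.
Qed.

Lemma dd_add V W (f g : V -> W) v p : differentiable f p -> differentiable g p ->
  dd (fun q => f q + g q) v p = dd f v p + dd g v p.
Proof.
by move=> df dg; rewrite dd.unlock deriveD//; exact: diff_derivable.
Qed.

Lemma dd_scale V W (f : V -> W) s v p : differentiable f p ->
  dd (fun q => s *: f q) v p = s *: dd f v p.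
Proof.
by move=> df; rewrite dd.unlock deriveZ//; exact: diff_derivable.
Qed.

Lemma dd2_scale V W (D : set V) (f : V -> W) p s k l :
  open D -> D p -> smooth_on D f -> l = s *: k ->
  dd (dd f l) l p = (s * s) *: dd (dd f k) k p.
Proof.
move=> oD Dp sf lE; have dfl := smooth_diff (smooth_dd l sf) Dp.
rewrite (ddZ dfl lE) -scalerA; congr (_ *: _).
have E y : D y -> dd f l y = s *: dd f k y.
  by move=> Dy; apply: ddZ => //; exact: smooth_diff sf Dy.
rewrite (dd_congr k oD Dp E) dd_scale//.
exact: smooth_diff (smooth_dd k sf) Dp.
Qed.

Lemma dd_opp V W (f : V -> W) v p : differentiable f p ->
  dd (fun q => - f q) v p = - dd f v p.
Proof.
by move=> df; rewrite dd.unlock deriveN//; exact: diff_derivable.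
Qed.

Lemma dd_mul V (f g : V -> R) v p : differentiable f p -> differentiable g p ->
  dd (fun q => f q * g q) v p = dd f v p * g p + f p * dd g v p.
Proof.
move=> df dg; rewrite dd.unlock deriveM; try exact: diff_derivable.
by rewrite !scaleE addrC mulrC.
Qed.

Lemma dd_comp U V W (f : U -> V) (g : V -> W) p v :
  differentiable f p -> differentiable g (f p) ->
  dd (fun q => g (f q)) v p = dd g (dd f v p) (f p).
Proof. by rewrite dd.unlock; exact: D_comp. Qed.

Lemma dd_pair U V W (f : U -> V) (g : U -> W) p v :
  differentiable f p -> differentiable g p ->
  dd (fun q => (f q, g q)) v p = (dd f v p, dd g v p).
Proof. by rewrite dd.unlock; exact: D_pair. Qed.

Lemma dd_fst U V W (f : U -> V * W) p v : differentiable f p ->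
  dd (fun q => (f q).1) v p = (dd f v p).1.
Proof. by rewrite dd.unlock; exact: D_fst. Qed.

Lemma dd_snd U V W (f : U -> V * W) p v : differentiable f p ->
  dd (fun q => (f q).2) v p = (dd f v p).2.
Proof. by rewrite dd.unlock; exact: D_snd. Qed.

Lemma dd_schwarz V W (fw : frame W) (D : set V) (f : V -> W) p u v :
  open D -> D p -> smooth_on D f -> dd (dd f v) u p = dd (dd f u) v p.
Proof. by rewrite dd.unlock; exact: schwarz. Qed.

Lemma dd_cst_segment V W (fw : frame W) (f : V -> W) p v c :
  (forall s, 0 <= s <= 1 -> differentiable f (p + s *: v)) ->
  (forall s, 0 <= s <= 1 -> dd f v (p + s *: v) = c) -> f (p + v) = f p + c.
Proof. by rewrite dd.unlock; exact: D_cst_segment. Qed.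

Lemma C2_dd V W (E : set V) (f : V -> W) z v : C2_at E f z ->
  differentiable (dd f v) z.
Proof. by move=> [_ /(_ v)]; rewrite -ddfE. Qed.

Lemma dd2_linear2 V W (E : set V) (a : V -> W) z s t
    (u w v v' : V) : open E -> E z -> C2_at E a z -> w = s *: v + t *: v' ->
  dd (dd a w) u z = s *: dd (dd a v) u z + t *: dd (dd a v') u z.
Proof.
move=> oE Ez Ca wE.
have EE y : E y -> dd a w y = s *: dd a v y + t *: dd a v' y.
  by move=> Ey; apply: dd_linear2 => //; exact: Ca.1.
have dD w' : differentiable (dd a w') z by exact: C2_dd Ca.
by rewrite (dd_congr u oE Ez EE) dd_add ?dd_scale//; exact: differentiableZ.
Qed.

Section comp2.
Variables (U V W : normedModType R) (fv : frame V) (fw : frame W).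
Variables (E : set U) (D : set V) (F : V -> W) (f : U -> V) (z : U).
Hypotheses (oE : open E) (Ez : E z) (oD : open D) (sF : smooth_on D F).
Hypotheses (ED : forall y, E y -> D (f y)) (C2f : C2_at E f z).

Lemma dd_comp_C2 y v : E y -> dd (fun q => F (f q)) v y = dd F (dd f v y) (f y).
Proof. by rewrite dd.unlock; move=> Ey; exact: (C2_comp_D sF ED C2f). Qed.

Lemma dd2_comp u v : dd (dd (fun q => F (f q)) v) u z =
  dd F (dd (dd f v) u z) (f z) + dd (dd F (dd f v z)) (dd f u z) (f z).
Proof. by rewrite dd.unlock; exact: (D2_comp fv fw oE Ez oD sF ED C2f). Qed.
End comp2.

Lemma dd_quad0 W (fw : frame W) z (w p q a b c : W) (v : base R) :
  dd (quad z w p q a b c) v z = v.1 *: p + v.2 *: q.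
Proof. by rewrite dd.unlock (D_quad0 fw). Qed.

Lemma dd2_quad W (fw : frame W) z (w p q a b c : W) (u v : base R) :
  dd (dd (quad z w p q a b c) v) u z =
  u.1 *: (v.1 *: a + v.2 *: b) + u.2 *: (v.1 *: b + v.2 *: c).
Proof. by rewrite dd.unlock (D2_quad fw). Qed.

Lemma same_2jetP W (a b : base R -> W) z : same_2jet a b z <->
  [/\ a z = b z, forall v, dd a v z = dd b v z
    & forall v w, dd (dd a w) v z = dd (dd b w) v z].
Proof. by rewrite dd.unlock. Qed.

End dd.

(** * Factoring a 2-jet through a change of independent variables *)

Section jets.
Context {R : realType}.
Implicit Types W : normedModType R.

Definition fr_base : frame (base R) :=
  frame_prod (@frame_real R) (@frame_real R).

Lemma hess_basis W (E : set (base R)) (b : base R -> W) z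
    (u v xi eta p q : base R) : open E -> E z -> C2_at E b z ->
  u = p.1 *: eta + p.2 *: xi -> v = q.1 *: eta + q.2 *: xi ->
  dd (dd b v) u z =
  p.1 *: (q.1 *: dd (dd b eta) eta z + q.2 *: dd (dd b xi) eta z) +
  p.2 *: (q.1 *: dd (dd b eta) xi z + q.2 *: dd (dd b xi) xi z).
Proof.
move=> oE Ez Cb uE vE.
rewrite (dd_linear2 (C2_dd v Cb) uE) (dd2_linear2 eta oE Ez Cb vE).
by rewrite (dd2_linear2 xi oE Ez Cb vE).
Qed.

(** If [a] is f' composed with [phi], the chain rule gives the Hessian of [a] as the Hessian of f'
    on the images of [u], [v] plus the first derivative of f' on the Hessian of [phi]. With [alpha],
    [beta] the two partial derivatives of f', this is the former summand. *)
Definition pull_hess W (a : base R -> W) (phi : base R -> base R) z (alpha beta : W)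
    (u v : base R) : W :=
  dd (dd a v) u z - (dd (dd phi v) u z).1 *: alpha - (dd (dd phi v) u z).2 *: beta.

Lemma jet_factor_arith (u1 u2 v1 v2 al be ee ex xe xx p1 p2 p2' p3 q1 q2 q2' q3 : R) :
  ex = xe -> p2 = p2' -> q2 = q2' ->
  u1 * (v1 * ee + v2 * ex) + u2 * (v1 * xe + v2 * xx) =
  (u1 * (v1 * p1 + v2 * p2) + u2 * (v1 * p2' + v2 * p3)) * al +
  (u1 * (v1 * q1 + v2 * q2) + u2 * (v1 * q2' + v2 * q3)) * be +
  (u1 * (v1 * (ee - p1 * al - q1 * be) + v2 * (ex - p2 * al - q2 * be)) +
   u2 * (v1 * (ex - p2 * al - q2 * be) + v2 * (xx - p3 * al - q3 * be))).
Proof. by move=> -> -> ->; ring. Qed.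

(** The premise on [eta] and [xi] says that they are the columns of the inverse of the differential
    of [phi]. The jet of the outer function is then forced by the chain rule, and a [quad] realises
    it; symmetry of both Hessians enters because [quad] stores a single mixed coefficient. *)
Lemma jet_factor W (fw : frame W) (E : set (base R)) (a : base R -> W)
    (phi : base R -> base R) z (xi eta : base R) :
  open E -> E z -> C2_at E a z -> C2_at E phi z ->
  (forall u v, dd (dd a u) v z = dd (dd a v) u z) ->
  (forall u v, dd (dd phi u) v z = dd (dd phi v) u z) ->
  (forall v, v = (dd phi v z).1 *: eta + (dd phi v z).2 *: xi) ->
  let H := pull_hess a phi z (dd a eta z) (dd a xi z) in
  same_2jet a (fun y => quad (phi z) (a z) (dd a eta z) (dd a xi z)
    (H eta eta) (H eta xi) (H xi xi) (phi y)) z.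
Proof.
move=> oE Ez Ca Cphi sa sphi Dv H.
set f' := quad _ _ _ _ _ _ _.
have sf' : smooth_on setT f' by exact: smooth_quad openT.
have da := Ca.1 z Ez.
apply/same_2jetP; split.
- by rewrite /f' (quad0 fw).
- move=> v; rewrite (dd_comp_C2 sf' _ Cphi)//.
  by rewrite /f' (dd_quad0 fw); exact: dd_linear2 da (Dv v).
- move=> u v; rewrite (dd2_comp fr_base fw oE Ez openT sf' _ Cphi)//.
  rewrite /f' (dd_quad0 fw) (dd2_quad fw).
  rewrite [LHS](hess_basis oE Ez Ca (Dv u) (Dv v)).
  rewrite {1 2}(hess_basis oE Ez Cphi (Dv u) (Dv v)).
  apply: (fr_ext fw) => l; rewrite /H /pull_hess.
  rewrite !(linD l, linZ l, linN l).
  apply: jet_factor_arith.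
  + by rewrite sa.
  + by rewrite sphi.
  + by rewrite sphi.
Qed.

End jets.

Lemma smooth_linear (R : realType) (V W : normedModType R) (D : set V)
  (l : {linear V -> W}) : open D -> continuous l -> smooth_on D l.
Proof.
move=> oD cl; apply: (@smooth_ind _ _ _ D
  (fun f => f = l \/ exists w, f = fun=> w)) => //; last by left.
- move=> _ p [->|[w ->]] _; first exact: linear_differentiable.
  exact: differentiable_cst.
- move=> _ v [->|[w ->]].
    exists (fun=> l v); first by right; exists (l v).
    by move=> p _; rewrite deriveE ?diff_lin//; exact: linear_differentiable.
  exists (fun=> 0); first by right; exists 0.
  by move=> p _; exact: derive_cst.
Qed.

Lemma smooth_id (R : realType) (V : normedModType R) (D : set V) :
  open D -> smooth_on D id.
Proof. by move=> oD; apply: (@smooth_linear _ _ _ D idfun) => // x. Qed.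

(** * Jets and evolution systems *)

Section graph.
Context {R : realType}.
Variables (W : normedModType R) (fw : frame W).
Let fbW := frame_prod (@fr_base R) fw.

Definition evol (A : base R -> R) (N : base R -> W -> W -> W) : pde W :=
  fun f z => pdt f z - A z *: pdx (pdx f) z + N z (f z) (pdx f z) = 0.

Lemma evolE A N f z : evol A N f z <->
  dd f (1, 0) z - A z *: dd (dd f (0, 1)) (0, 1) z + N z (f z) (dd f (0, 1) z) = 0.
Proof. by rewrite /evol pdtE !pdxE. Qed.

Section lift.
Variables (V : set (base R * W)) (f : base R -> W) (z : base R).
Hypotheses (oV : open V) (sf : smooth_on setT f) (Vz : V (z, f z)).

Let psi y := (y, f y).

Lemma smooth_graph : smooth_on setT psi.
Proof.
by apply: smooth_pair => //; [exact: openT|exact: smooth_id openT].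
Qed.

Lemma open_graph : open [set y | V (y, f y)].
Proof.
apply: (@open_comp _ _ psi) => // y _.
exact/differentiable_continuous/(smooth_diff smooth_graph).
Qed.

Lemma C2_graph : C2_at [set y | V (y, f y)] psi z.
Proof. by apply: smooth_C2 => //; apply: smooth_sub smooth_graph. Qed.

Lemma dd_graph v y : dd psi v y = (v, dd f v y).
Proof.
rewrite dd_pair//; last exact: smooth_diff sf _.
by rewrite -ddE derive_id.
Qed.

Lemma dd2_graph u v : dd (dd psi v) u z = (0, dd (dd f v) u z).
Proof.
rewrite (_ : dd psi v = fun y => (v, dd f v y)); last first.
  by apply/funext => y; exact: dd_graph.
rewrite dd_pair; first by rewrite dd_cst.
  exact: differentiable_cst.
exact: smooth_diff (smooth_dd v sf) _.
Qed.

Variables (X : normedModType R) (fX : frame X) (F : base R * W -> X).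
Hypothesis sF : smooth_on V F.

Lemma C2_along : C2_at [set y | V (y, f y)] (fun y => F (y, f y)) z.
Proof. exact: (C2_comp fbW fX open_graph Vz oV sF _ C2_graph). Qed.

Lemma dd_along v : dd (fun y => F (y, f y)) v z = dd F (v, dd f v z) (z, f z).
Proof.
rewrite (dd_comp_C2 (f := psi) sF _ C2_graph)//.
by rewrite dd_graph.
Qed.

Lemma dd2_along u v : dd (dd (fun y => F (y, f y)) v) u z =
  dd F (0, dd (dd f v) u z) (z, f z) +
  dd (dd F (v, dd f v z)) (u, dd f u z) (z, f z).
Proof.
rewrite (dd2_comp fbW fX (f := psi) open_graph Vz oV sF _ C2_graph)//.
by rewrite dd2_graph !dd_graph.
Qed.

Lemma dd2_along_sym u v : dd (dd (fun y => F (y, f y)) v) u z =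
  dd (dd (fun y => F (y, f y)) u) v z.
Proof.
rewrite !dd2_along (dd_schwarz fw v u openT)//.
by rewrite (dd_schwarz fX _ _ oV Vz).
Qed.

End lift.

Section equivalence.
Variables (V : set (base R * W)) (Phi : base R * W -> base R * W).
Variables (A A' : base R -> R) (N N' : base R -> W -> W -> W).
Hypotheses (oV : open V) (sPhi : smooth_on V Phi).
Hypothesis maps : maps_pde V Phi (evol A N) (evol A' N').

Let Phi1 p := (Phi p).1.
Let G p := (Phi p).2.

Lemma smooth_Phi1 : smooth_on V Phi1.
Proof.
apply: (@smooth_post _ _ _ _ V Phi (fst_lin (base R) W)) => // x.
exact: cvg_fst.
Qed.

Lemma smooth_G : smooth_on V G.
Proof.
apply: (@smooth_post _ _ _ _ V Phi (snd_lin (base R) W)) => // x.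
exact: cvg_snd.
Qed.

(** The source function is the [quad] with the given jet, the target function the [quad] from
    [jet_factor]. Here [hat v] is tangent to the graph, [eta] and [xi] give the total derivatives by
    t~ and x~, [al] and [be] are f'_t~ and f'_x~, and the bracket after [A'] is f'_x~x~. The
    second-order parameters of the source jet enter the target equation only through [mu], the
    second derivative of f along [xi]. *)
Lemma jet_equiv (z xi eta : base R) (w p q a b c : W) : V (z, w) ->
  let hat (v : base R) := (v, v.1 *: p + v.2 *: q) in
  (forall v, v = (dd Phi1 (hat v) (z, w)).1 *: eta +
                 (dd Phi1 (hat v) (z, w)).2 *: xi) ->
  let mu := xi.1 *: (xi.1 *: a + xi.2 *: b) + xi.2 *: (xi.1 *: b + xi.2 *: c) in
  let al := dd G (hat eta) (z, w) in
  let be := dd G (hat xi) (z, w) in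
  let S := dd Phi1 (0, mu) (z, w) + dd (dd Phi1 (hat xi)) (hat xi) (z, w) in
  p - A z *: c + N z w q = 0 <->
  al - A' (Phi1 (z, w)) *: (dd G (0, mu) (z, w)
     + dd (dd G (hat xi)) (hat xi) (z, w) - S.1 *: al - S.2 *: be)
     + N' (Phi1 (z, w)) (G (z, w)) be = 0.
Proof.
move=> Vz hat dual mu al be S.
pose f := quad z w p q a b c.
have fz : f z = w by exact: quad0.
have Vf : V (z, f z) by rewrite fz.
have sf : smooth_on setT f by exact: smooth_quad openT.
have df v : dd f v z = v.1 *: p + v.2 *: q by exact: dd_quad0.
have d1 v : dd (fun y => Phi1 (y, f y)) v z = dd Phi1 (hat v) (z, w).
  by rewrite (dd_along sf Vf smooth_Phi1) df fz.
have dG v : dd (fun y => G (y, f y)) v z = dd G (hat v) (z, w).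
  by rewrite (dd_along sf Vf smooth_G) df fz.
have dual' v : v = (dd (fun y => Phi1 (y, f y)) v z).1 *: eta +
    (dd (fun y => Phi1 (y, f y)) v z).2 *: xi by rewrite d1.
have := jet_factor fw (open_graph oV sf) Vf
  (C2_along oV sf Vf fw smooth_G) (C2_along oV sf Vf fr_base smooth_Phi1)
  (fun u v => dd2_along_sym oV sf Vf fw smooth_G v u)
  (fun u v => dd2_along_sym oV sf Vf fr_base smooth_Phi1 v u) dual'.
rewrite {1}/pull_hess /=.
set f' := quad _ _ _ _ _ _ _ => jets.
have sf' : smooth_on setT f' by exact: smooth_quad openT.
have f'0 : f' (Phi1 (z, f z)) = G (z, f z) by exact: quad0.
have f'1 v : dd f' v (Phi1 (z, f z)) = v.1 *: al + v.2 *: be.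
  by rewrite /f' (dd_quad0 fw) !dG.
have E2 X (fX : frame X) (F : base R * W -> X) : smooth_on V F ->
    dd (dd (fun y => F (y, f y)) xi) xi z =
    dd F (0, mu) (z, w) + dd (dd F (hat xi)) (hat xi) (z, w).
  by move=> sF; rewrite (dd2_along oV sf Vf fX sF) (dd2_quad fw) !df fz.
have f'2 : dd (dd f' (0, 1)) (0, 1) (Phi1 (z, f z)) =
    dd G (0, mu) (z, w) + dd (dd G (hat xi)) (hat xi) (z, w)
    - S.1 *: al - S.2 *: be.
  rewrite /f' (dd2_quad fw) !scale0r !scale1r !add0r !dG.
  by rewrite (E2 _ fw _ smooth_G) (E2 _ fr_base _ smooth_Phi1).
have f2 : dd (dd f (0, 1)) (0, 1) z = c.
  by rewrite (dd2_quad fw) !scale0r !scale1r !add0r.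
have := maps sf sf' Vf jets; rewrite !evolE -/(Phi1 _) f'0 f'2 f2 !f'1 !df !fz.
by rewrite !scale0r !scale1r !add0r !addr0.
Qed.
End equivalence.
End graph.

(** * Derivatives along slices with constant dependent variable *)

Section slice.
Context {R : realType}.
Variables (W X : normedModType R) (fw : frame W).
Variables (V : set (base R * W)) (F : base R * W -> X) (f : base R -> X) (w : W).
Hypotheses (oV : open V) (sF : smooth_on V F).
Hypothesis fF : forall y, V (y, w) -> f y = F (y, w).

Let cw : base R -> W := fun=> w.
Let scw : smooth_on setT cw. Proof. exact: smooth_cst openT. Qed.

Lemma open_slice : open [set y | V (y, w)].
Proof. exact: (open_graph oV scw). Qed.

Lemma dd_slice v z : V (z, w) -> dd f v z = dd F (v, 0) (z, w).
Proof.
move=> Vz; rewrite (dd_congr v open_slice Vz fF).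
by rewrite (dd_along (f := cw) scw Vz sF) dd_cst.
Qed.

Lemma inl_is_linear : linear (fun y : base R => (y, 0 : W)).
Proof.
by move=> a u v; apply/pair_equal_spec; split => //=; rewrite scaler0 addr0.
Qed.

Lemma smooth_slice : smooth_on [set y | V (y, w)] f.
Proof.
pose l : {linear base R -> (base R * W)%type} :=
  HB.pack (fun y : base R => (y, 0 : W)) (GRing.isLinear.Build _ _ _ _ _ inl_is_linear).
have lE y : l y + (0, w) = (y, w).
  by apply/pair_equal_spec; split => //=; rewrite ?addr0 ?add0r.
have cl : continuous l.
  move=> y; apply: differentiable_continuous.
  by apply: differentiable_pair => //; exact: differentiable_cst.
apply: (@smooth_congr _ _ _ _ (fun y => F (l y + (0, w))) _ open_slice).
  by move=> y Vy; rewrite lE fF.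
by apply: (@smooth_pre _ _ _ _ _ V F l (0, w) open_slice cl _ sF) => y; rewrite lE.
Qed.
End slice.

(* The general form of a point transformation between evolution systems:
   t~ = T(t), x~ = X(t,x), w~ = M(t,x) w + h(t,x). *)
Record fibred (R : realType) (W : normedModType R) (O : set (base R))
    (T : R -> R) (X : base R -> R) (M : base R -> W -> W) (h : base R -> W) :
  Prop := Fibred {
  fibred_T : smooth_on O (fun z => T z.1);
  fibred_X : smooth_on O X;
  fibred_M : forall w, smooth_on O (fun z => M z w);
  fibred_h : smooth_on O h;
  fibred_lin : forall z s t u v, O z -> M z (s *: u + t *: v) = s *: M z u + t *: M z v;
  fibred_Tt : forall z, O z -> dd (fun y => T y.1) (1, 0) z != 0;
  fibred_Xx : forall z, O z -> dd X (0, 1) z != 0 }.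

(** The target equation for the source jet with f = [w], f_x = [q], f_xx = 0 and f_t = - N(z, w, q);
    [be] is f'_x~. This one choice of f_xx is representative, since the rule for A~ makes the terms
    with f_xx cancel. *)
Definition transport_eq (R : realType) (W : normedModType R)
    (A' : base R -> R) (N N' : base R -> W -> W -> W)
    (T : R -> R) (X : base R -> R) (M : base R -> W -> W) (h : base R -> W)
    (z : base R) (w q : W) : Prop :=
  let Tt := dd (fun y : base R => T y.1) (1, 0) z in
  let Xx := dd X (0, 1) z in
  let g := fun y => M y w + h y in
  let be := Xx^-1 *: (dd g (0, 1) z + M z q) in
  Tt^-1 *: (dd g (1, 0) z - M z (N z w q) - dd X (1, 0) z *: be)
  - A' (T z.1, X z) *: ((Xx^-1 * Xx^-1) *: (dd (dd g (0, 1)) (0, 1) z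
      + 2 *: dd (fun y => M y q) (0, 1) z - dd (dd X (0, 1)) (0, 1) z *: be))
  + N' (T z.1, X z) (M z w + h z) be = 0.

(** * Point transformations between evolution systems *)

Section structure.
Context {R : realType}.
Variables (W : normedModType R) (fw : frame W) (w0 : W).
Variables (V : set (base R * W)) (Phi : base R * W -> base R * W).
Variables (A A' : base R -> R) (N N' : base R -> W -> W -> W).
Hypotheses (w00 : w0 != 0) (oV : open V) (sPhi : smooth_on V Phi).
Hypothesis bijPhi : forall p, V p -> bijective ('d Phi p).
Hypothesis maps : maps_pde V Phi (evol A N) (evol A' N').
Hypothesis A0 : forall p, V p -> A p.1 != 0.
Hypothesis A'0 : forall p, V p -> A' (Phi p).1 != 0.

Let Phi1 p := (Phi p).1.
Let G p := (Phi p).2.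
Let sPhi1 := smooth_Phi1 oV sPhi : smooth_on V Phi1.
Let sG := smooth_G oV sPhi : smooth_on V G.

Lemma jacobian_arith1 (T1 X1 T2 X2 : R) : T1 * X2 - T2 * X1 != 0 ->
  X2 / (T1 * X2 - T2 * X1) * T1 + - X1 / (T1 * X2 - T2 * X1) * T2 = 1.
Proof. by move=> ?; field. Qed.

Lemma jacobian_arith2 (T X J : R) : - T / J * X + X / J * T = 0.
Proof. by ring. Qed.

Lemma jacobian_arith3 (T1 X1 T2 X2 : R) : T1 * X2 - T2 * X1 != 0 ->
  - T2 / (T1 * X2 - T2 * X1) * X1 + T1 / (T1 * X2 - T2 * X1) * X2 = 1.
Proof. by move=> ?; field. Qed.

Lemma jacobian_arith4 (T1 X1 T2 X2 v1 v2 : R) : T1 * X2 - T2 * X1 != 0 ->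
  v1 = (v1 * T1 + v2 * T2) * (X2 / (T1 * X2 - T2 * X1)) +
    (v1 * X1 + v2 * X2) * (- T2 / (T1 * X2 - T2 * X1)).
Proof. by move=> ?; field. Qed.

Lemma jacobian_arith5 (T1 X1 T2 X2 v1 v2 : R) : T1 * X2 - T2 * X1 != 0 ->
  v2 = (v1 * T1 + v2 * T2) * (- X1 / (T1 * X2 - T2 * X1)) +
    (v1 * X1 + v2 * X2) * (T1 / (T1 * X2 - T2 * X1)).
Proof. by move=> ?; field. Qed.

Lemma l_arith (s t a b c d X T : R) :
  (s * a + t * b) * X - T * (s * c + t * d) =
  s * (a * X - T * c) + t * (b * X - T * d).
Proof. by ring. Qed.

Lemma hess_difference_arith (al be g g' K n s s' x x' k1 k2 a' : R) : a' != 0 ->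
  al + - (a' * (g + K + - ((s + k1) * al) + - ((x + k2) * be))) + n = 0 ->
  al + - (a' * (g' + g + K + - ((s' + s + k1) * al) + - ((x' + x + k2) * be))) + n = 0 ->
  g' = s' * al + x' * be.
Proof.
move=> a0 h1 h2; have : a' * (g' - (s' * al + x' * be)) = 0.
  by rewrite -[RHS](subrr 0) -{1}h1 -h2; ring.
by move/eqP; rewrite mulf_eq0 (negbTE a0) /= subr_eq0 => /eqP.
Qed.

Lemma unit_arith1 (a b : R) : a = a * 1 + b * 0.
Proof. by rewrite mulr1 mulr0 addr0. Qed.

Lemma unit_arith2 (a b : R) : b = a * 0 + b * 1.
Proof. by rewrite mulr1 mulr0 add0r. Qed.

Lemma reduced_arith (g1 g2 gc K n u v t x1 X s a' : R) : t != 0 -> X != 0 ->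
  t^-1 * (g1 + - (x1 * (X^-1 * g2))) + - (a' * (s * (gc + K +
    - ((u + v) * (X^-1 * g2))))) + n =
  t^-1 * g1 + - x1 / (t * X) * g2 + - (a' * (s * gc + s * K +
    - (0 * (t^-1 * g1 + - x1 / (t * X) * g2))
    + - (s * (u + v) * (X^-1 * g2)))) + n.
Proof. by move=> ? ?; field; apply/andP. Qed.

Lemma A_formula_arith (g1 g0 be K n u1 u0 v t a a' s : R) :
  t^-1 * (1 * g1 + a * g0 + - ((1 * u1 + a * u0) * be)) +
    - (a' * (s * (g0 + K + - ((u0 + v) * be)))) + n = 0 ->
  t^-1 * (g1 + - (u1 * be)) + - (a' * (s * (0 + K + - ((0 + v) * be)))) + n = 0 ->
  (t^-1 * a - a' * s) * (g0 + - (u0 * be)) = 0.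
Proof. by move=> h1 h0; rewrite -[RHS](subrr 0) -{1}h1 -h0; ring. Qed.

Lemma A_vanishes (c a : R) : c = a * (1^-1 * 1^-1) -> c = a * (2^-1 * 2^-1) ->
  a == 0.
Proof.
move=> -> h; apply/eqP; have : a * 3 = 0 by move: h; lra.
by lra.
Qed.

Lemma d2G_vert_arith (g0 n0 n1 n2 be r H Hq Hq' Q K0 K1 K2 t x k a s : R) :
  a * s != 0 -> Hq + Hq' = 2 * (H + Q) -> n1 + n2 = 2 * n0 -> K1 + K2 = 2 * K0 ->
  t * (g0 + - n0 + - (x * be)) + - (a * (s * (H + - (k * be)))) + K0 = 0 ->
  t * (g0 + - n1 + - (x * (be + r))) + - (a * (s * (Hq + - (k * (be + r))))) + K1 = 0 ->
  t * (g0 + - n2 + - (x * (be + - r))) + - (a * (s * (Hq' + - (k * (be + - r))))) + K2 = 0 ->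
  Q = 0.
Proof.
move=> as0 /(canRL (addrK _)) -> /(canRL (addrK _)) -> /(canRL (addrK _)) -> e0 e1 e2.
have : 2 * (a * s) * Q = 0.
  by rewrite -[RHS](mulr0 2) -{1}e0 -[LHS]addr0 -[in LHS]e1 -[LHS]addr0 -[in LHS]e2; ring.
by move/eqP; rewrite !mulf_eq0 -mulf_eq0 (negbTE as0) orbF pnatr_eq0 /= => /eqP.
Qed.

Lemma triangular_arith1 (T X Y : R) : T != 0 -> Y != 0 ->
  T^-1 * X + - X / (T * Y) * Y = 0.
Proof. by move=> ? ?; field; apply/andP. Qed.

Lemma triangular_arith2 (T X Y u v : R) : T != 0 -> Y != 0 ->
  v = (u * T + v * 0) * (- X / (T * Y)) + (u * X + v * Y) * Y^-1.
Proof. by move=> ? ?; field; apply/andP. Qed.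

Lemma base_pair_eq (k l : base R * W) :
  k.1.1 = l.1.1 -> k.1.2 = l.1.2 -> k.2 = l.2 -> k = l.
Proof. by move: k l => [[? ?] ?] [[? ?] ?] /= -> -> ->. Qed.

Lemma base_eq (k l : base R) : k.1 = l.1 -> k.2 = l.2 -> k = l.
Proof. by move: k l => [? ?] [? ?] /= -> ->. Qed.

Section point.
Variables (z : base R) (w : W).
Hypothesis Vzw : V (z, w).

Local Notation D1 k := (dd Phi1 k (z, w)).
Local Notation DG k := (dd G k (z, w)).

Let dPhi1 : differentiable Phi1 (z, w). Proof. exact: smooth_diff sPhi1 Vzw. Qed.
Let dG : differentiable G (z, w). Proof. exact: smooth_diff sG Vzw. Qed.

Let D1_lin s t k u v : k = s *: u + t *: v -> D1 k = s *: D1 u + t *: D1 v.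
Proof. exact: dd_linear2. Qed.
Let DG_lin s t k u v : k = s *: u + t *: v -> DG k = s *: DG u + t *: DG v.
Proof. exact: dd_linear2. Qed.

Let dPhiE k : 'd Phi (z, w) k = (D1 k, DG k).
Proof.
have dPhi : differentiable Phi (z, w) by exact: smooth_diff sPhi Vzw.
rewrite -deriveE// ddE (dd_fst k dPhi) (dd_snd k dPhi).
by case: (dd _ _ _).
Qed.

Lemma dPhi_surj b m : exists k, D1 k = b /\ DG k = m.
Proof.
have [g gK Kg] := bijPhi Vzw; exists (g (b, m)).
by have := Kg (b, m); rewrite dPhiE => -[-> ->].
Qed.

Lemma dPhi_inj k : D1 k = 0 -> DG k = 0 -> k = 0.
Proof.
move=> k1 k2; apply: (bij_inj (bijPhi Vzw)).
by rewrite dPhiE k1 k2 linear0.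
Qed.

(** The lift of a base vector to the tangent plane of a graph with f_t = [p] and f_x = [q]. *)
Definition hat (p q : W) (v : base R) : base R * W := (v, v.1 *: p + v.2 *: q).

Let hatE p q v : hat p q v = v.1 *: ((1, 0), p) + v.2 *: ((0, 1), q).
Proof.
apply: base_pair_eq => //.
- by transitivity (v.1 * 1 + v.2 * 0) => //; ring.
- by transitivity (v.1 * 0 + v.2 * 1) => //; ring.
Qed.

Let D1_hat p q v : D1 (hat p q v) = v.1 *: D1 ((1, 0), p) + v.2 *: D1 ((0, 1), q).
Proof. exact: D1_lin (hatE p q v). Qed.
Lemma hess_injective p q xi eta m :
  D1 (hat p q eta) = (1, 0) -> D1 (hat p q xi) = (0, 1) ->
  DG (0, m) = (D1 (0, m)).1 *: DG (hat p q eta) + (D1 (0, m)).2 *: DG (hat p q xi) ->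
  m = 0.
Proof.
move=> Deta Dxi Dm; set t := (D1 (0, m)).1; set x := (D1 (0, m)).2.
pose v := t *: eta + x *: xi.
have hatv : hat p q v = t *: hat p q eta + x *: hat p q xi.
  apply: base_pair_eq => //; rewrite /hat /v /=.
  by rewrite !scalerDl !scalerDr !scalerA addrACA.
pose k := (0 : base R, m) - hat p q v.
have kE : k = 1 *: (0 : base R, m) + (-1) *: hat p q v.
  by rewrite scale1r scaleN1r.
have k0 : k = 0.
  apply: dPhi_inj.
    rewrite (D1_lin kE) (D1_lin hatv) Deta Dxi scale1r scaleN1r.
    apply: base_eq.
      transitivity (t - (t * 1 + x * 0)) => //; ring.
    transitivity (x - (t * 0 + x * 1)) => //; ring.
  by rewrite (DG_lin kE) (DG_lin hatv) Dm scale1r scaleN1r subrr.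
have hv : hat p q v = (0, m) by apply/esym/eqP; rewrite -subr_eq0; exact/eqP.
have v0 : v = 0 by have := congr1 fst hv.
by have := congr1 snd hv; rewrite /hat v0 /= !scale0r addr0 => <-.
Qed.

(** [eta] and [xi] are the columns of the inverse of the total Jacobi matrix of (t~, x~), by
    Cramer's rule. *)
Lemma dual_of_jacobian p q : let T1 := (D1 ((1, 0), p)).1 in
  let X1 := (D1 ((1, 0), p)).2 in let T2 := (D1 ((0, 1), q)).1 in
  let X2 := (D1 ((0, 1), q)).2 in let J := T1 * X2 - T2 * X1 in
  let eta := (X2 / J, - X1 / J) in let xi := (- T2 / J, T1 / J) in
  J != 0 ->
  [/\ D1 (hat p q eta) = (1, 0), D1 (hat p q xi) = (0, 1) &
    forall v, v = (D1 (hat p q v)).1 *: eta + (D1 (hat p q v)).2 *: xi].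
Proof.
move=> T1 X1 T2 X2 J eta xi J0.
split; last move=> v; rewrite D1_hat; apply: base_eq.
- by transitivity (X2 / J * T1 + - X1 / J * T2) => //; exact: jacobian_arith1.
- by transitivity (X2 / J * X1 + - X1 / J * X2) => //; rewrite addrC; exact: jacobian_arith2.
- by transitivity (- T2 / J * T1 + T1 / J * T2) => //; exact: jacobian_arith2.
- by transitivity (- T2 / J * X1 + T1 / J * X2) => //; exact: jacobian_arith3.
- transitivity ((v.1 * T1 + v.2 * T2) * (X2 / J) +
    (v.1 * X1 + v.2 * X2) * (- T2 / J)) => //; exact: jacobian_arith4.
- transitivity ((v.1 * T1 + v.2 * T2) * (- X1 / J) +
    (v.1 * X1 + v.2 * X2) * (T1 / J)) => //; exact: jacobian_arith5.
Qed.

Lemma reduced_module (g1 g2 gc K n : W) (u v : base R) (t x1 X s a' : R) :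
  t != 0 -> X != 0 -> u.1 = 0 -> v.1 = 0 ->
  t^-1 *: g1 + (- x1 / (t * X)) *: g2 - a' *: (s *: gc + s *: K -
    ((s *: u).1 + (s *: v).1) *: (t^-1 *: g1 + (- x1 / (t * X)) *: g2)
    - ((s *: u).2 + (s *: v).2) *: (X^-1 *: g2)) + n = 0 ->
  t^-1 *: (g1 - x1 *: (X^-1 *: g2)) - a' *: (s *: (gc + K -
    (u.2 + v.2) *: (X^-1 *: g2))) + n = 0.
Proof.
move=> t0 X0 u1 v1 <-.
have -> : (s *: u).1 + (s *: v).1 = 0.
  by transitivity (s * u.1 + s * v.1) => //; rewrite u1 v1 !mulr0 addr0.
have -> : (s *: u).2 + (s *: v).2 = s * (u.2 + v.2) by rewrite mulrDr.
apply: (fr_ext fw) => l; rewrite !(linD l, linZ l, linN l).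
exact: reduced_arith.
Qed.

Lemma A_formula_module (g1 g0 be K n : W) (u1 u0 v : base R) (t a a' s : R) :
  t^-1 *: (1 *: g1 + a *: g0 - (1 *: u1 + a *: u0).2 *: be) -
    a' *: (s *: (g0 + K - (u0.2 + v.2) *: be)) + n = 0 ->
  t^-1 *: (g1 - u1.2 *: be) - a' *: (s *: (0 + K - ((0 : base R).2 + v.2) *: be)) + n = 0 ->
  (t^-1 * a - a' * s) *: (g0 - u0.2 *: be) = 0.
Proof.
have -> : (1 *: u1 + a *: u0).2 = 1 * u1.2 + a * u0.2 by [].
move=> h1 h0; apply: (fr_ext fw) => l.
move: (congr1 l h1) (congr1 l h0).
rewrite !(linD l, linZ l, linN l) !(lin0 l) => {}h1 {}h0.
exact: (A_formula_arith h1 h0).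
Qed.

Lemma d2G_vert_module (g0 n0 n1 n2 be r H Hq Hq' Q K0 K1 K2 : W) (t x k a s : R) :
  a * s != 0 -> Hq + Hq' = 2 *: (H + Q) -> n1 + n2 = 2 *: n0 ->
  K1 + K2 = 2 *: K0 ->
  t *: (g0 - n0 - x *: be) - a *: (s *: (H - k *: be)) + K0 = 0 ->
  t *: (g0 - n1 - x *: (be + r)) - a *: (s *: (Hq - k *: (be + r))) + K1 = 0 ->
  t *: (g0 - n2 - x *: (be - r)) - a *: (s *: (Hq' - k *: (be - r))) + K2 = 0 ->
  Q = 0.
Proof.
move=> as0 e1 e2 e3 e4 e5 e6; apply: (fr_ext fw) => l.
move: (congr1 l e1) (congr1 l e2) (congr1 l e3) (congr1 l e4) (congr1 l e5) (congr1 l e6).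
rewrite !(linD l, linZ l, linN l) !(lin0 l).
exact: d2G_vert_arith.
Qed.

Lemma jet_equiv_point p q xi eta :
  (forall v, v = (D1 (hat p q v)).1 *: eta + (D1 (hat p q v)).2 *: xi) ->
  let al := DG (hat p q eta) in let be := DG (hat p q xi) in
  let K := dd (dd G (hat p q xi)) (hat p q xi) (z, w) in
  let K1 := dd (dd Phi1 (hat p q xi)) (hat p q xi) (z, w) in
  forall a b c mu,
  mu = xi.1 *: (xi.1 *: a + xi.2 *: b) + xi.2 *: (xi.1 *: b + xi.2 *: c) ->
  p - A z *: c + N z w q = 0 <->
  al - A' (Phi1 (z, w)) *: (DG (0, mu) + K - ((D1 (0, mu)).1 + K1.1) *: al
    - ((D1 (0, mu)).2 + K1.2) *: be) + N' (Phi1 (z, w)) (G (z, w)) be = 0.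
Proof.
move=> dual al be K K1 a b c _ ->.
exact: (jet_equiv fw oV sPhi maps a b c Vzw dual).
Qed.

Lemma hess_difference (al be g g' K n : W) (u u' : base R) (a' : R) (K1 : base R) :
  a' != 0 ->
  al - a' *: (g + K - (u.1 + K1.1) *: al - (u.2 + K1.2) *: be) + n = 0 ->
  al - a' *: (g' + g + K - ((u' + u).1 + K1.1) *: al
    - ((u' + u).2 + K1.2) *: be) + n = 0 ->
  g' = u'.1 *: al + u'.2 *: be.
Proof.
move=> a0 h1 h2; apply: (fr_ext fw) => l.
move: (congr1 l h1) (congr1 l h2).
rewrite !(linD l, linZ l, linN l) !(lin0 l) => {}h1 {}h2.
exact: (hess_difference_arith a0 h1 h2).
Qed.

(* Varying f_tt alone stays on the manifold of the source equation, whereas it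
   moves f'_xx by a multiple of (D_x T)^2. *)
Lemma dT_hat q : (D1 ((0, 1), q)).1 = 0.
Proof.
apply/eqP/negP => /negP T20.
set T2 := (D1 ((0, 1), q)).1 in T20 *; set X2 := (D1 ((0, 1), q)).2.
pose l k := (D1 k).1 * X2 - T2 * (D1 k).2.
have l_lin s t k u v : k = s *: u + t *: v -> l k = s * l u + t * l v.
  move=> kE; rewrite /l (D1_lin kE).
  transitivity ((s * (D1 u).1 + t * (D1 v).1) * X2 -
    T2 * (s * (D1 u).2 + t * (D1 v).2)) => //.
  exact: l_arith.
(* A value of f_t with nonzero total Jacobian. Otherwise the functional [l] would vanish on all
   vectors, whereas surjectivity of ['d Phi] provides [k] with [D1 k = (0, 1)], for which
   [l k = - T2]. *)
have [p Jp] : exists p, l ((1, 0), p) != 0.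
  apply/not_existsP => l0.
  have l1 p : l ((1, 0), p) = 0 by apply/eqP/negPn/negP; exact: l0.
  have l2 : l ((0, 1), q) = 0 by rewrite /l mulrC subrr.
  have lm m : l (0, m) = 0.
    rewrite (@l_lin 1 (-1) _ ((1, 0), m) ((1, 0), 0)) ?l1 ?mulr0 ?addr0//.
    rewrite scale1r scaleN1r; apply: base_pair_eq => /=.
    - by rewrite subrr.
    - by rewrite subrr.
    - by rewrite subr0.
  have lk k : l k = 0.
    rewrite (@l_lin 1 k.1.2 _ (k.1.1 *: ((1, 0), 0) + 1 *: (0, k.2 - k.1.2 *: q)) ((0, 1), q)).
      rewrite (l_lin _ _ _ _ _ erefl) l1 l2 lm !mulr0 !addr0; exact: mulr0.
    apply: base_pair_eq.
    - by transitivity (1 * (k.1.1 * 1 + 1 * 0) + k.1.2 * 0) => //; ring.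
    - by transitivity (1 * (k.1.1 * 0 + 1 * 0) + k.1.2 * 1) => //; ring.
    - transitivity (1 *: (k.1.1 *: 0 + 1 *: (k.2 - k.1.2 *: q)) + k.1.2 *: q) => //.
      by rewrite !scale1r scaler0 add0r subrK.
  have [k [k1 _]] := dPhi_surj (0, 1) 0.
  have := lk k; rewrite /l k1 mul0r add0r mulr1 => /eqP.
  by rewrite oppr_eq0 => /eqP T2E; rewrite T2E eqxx in T20.
have [Deta Dxi dual] := dual_of_jacobian Jp.
set eta := (X2 / _, _) in Deta Dxi dual; set xi := (_, _) in Dxi dual.
pose c := (A z)^-1 *: (p + N z w q).
have lhs : p - A z *: c + N z w q = 0.
  rewrite /c scalerA divff ?(A0 Vzw)// scale1r.
  by rewrite opprD addrA subrr sub0r addNr.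
(* [c] is the value of f_xx solved from the source equation, shared by the jets f_tt = 0 and f_tt =
   [w0] with f_tx = 0; [mu] and [m + mu] are their second derivatives along [xi]. *)
pose m := (xi.1 * xi.1) *: w0; pose mu := (xi.2 * xi.2) *: c.
have e1 : mu = xi.1 *: (xi.1 *: (0 : W) + xi.2 *: 0) + xi.2 *: (xi.1 *: 0 + xi.2 *: c).
  by rewrite !scaler0 !add0r scaler0 add0r scalerA.
have e2 : m + mu = xi.1 *: (xi.1 *: w0 + xi.2 *: 0) + xi.2 *: (xi.1 *: 0 + xi.2 *: c).
  by rewrite /m /mu !scaler0 add0r addr0 !scalerA.
have E1 := (jet_equiv_point dual e1).1 lhs.
have := (jet_equiv_point dual e2).1 lhs.
have mmu : (0, m + mu) = 1 *: (0 : base R, m) + 1 *: (0 : base R, mu).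
  by rewrite !scale1r; apply: base_pair_eq => //=; rewrite addr0.
rewrite (D1_lin mmu) (DG_lin mmu) !scale1r.
move/(hess_difference (A'0 Vzw) E1)/(hess_injective Deta Dxi)/eqP.
rewrite scaler_eq0 (negbTE w00) orbF mulf_eq0 orbb mulf_eq0 oppr_eq0 (negbTE T20) /=.
by rewrite invr_eq0 => /eqP J0; rewrite /l J0 eqxx in Jp.
Qed.

(** The vectors ((0, 1), q), on which [dT_hat] annihilates the time component, span all directions
    without time component: their differences are the vertical vectors. *)
Lemma dT_vert (k : base R * W) : (D1 k).1 = k.1.1 * (D1 ((1, 0), 0)).1.
Proof.
have k1 : k = k.1.1 *: ((1, 0) : base R, 0 : W) + 1 *: ((0, k.1.2), k.2).
  apply: base_pair_eq.
  - by transitivity (k.1.1 * 1 + 1 * 0) => //; rewrite mulr1 mulr0 addr0.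
  - by transitivity (k.1.1 * 0 + 1 * k.1.2) => //; rewrite mulr0 add0r mul1r.
  - by transitivity (k.1.1 *: 0 + 1 *: k.2) => //; rewrite scaler0 add0r scale1r.
have k2 : ((0, k.1.2), k.2) = (k.1.2 - 1) *: ((0, 1) : base R, 0 : W) + 1 *: ((0, 1), k.2).
  apply: base_pair_eq.
  - by transitivity ((k.1.2 - 1) * 0 + 1 * 0) => //; rewrite !mulr0 addr0.
  - by transitivity ((k.1.2 - 1) * 1 + 1 * 1) => //; rewrite !mulr1 subrK.
  - by transitivity ((k.1.2 - 1) *: 0 + 1 *: k.2) => //; rewrite scaler0 add0r scale1r.
rewrite {1}(D1_lin k1) (D1_lin k2).
transitivity (k.1.1 * (D1 ((1, 0), 0)).1 + 1 * ((k.1.2 - 1) *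
  (D1 ((0, 1), 0)).1 + 1 * (D1 ((0, 1), k.2)).1)) => //.
by rewrite !dT_hat !mulr0 addr0 mulr0 addr0.
Qed.

Lemma Tt_neq0 : (D1 ((1, 0), 0)).1 != 0.
Proof.
have [k [k1 _]] := dPhi_surj (1, 0) 0.
have := dT_vert k; rewrite k1 /= => /eqP; apply: contraTneq => ->.
by rewrite mulr0 oner_neq0.
Qed.

Lemma dual_triangular p q : let X2 := (D1 ((0, 1), q)).2 in
  let Tt := (D1 ((1, 0), 0)).1 in let X1 := (D1 ((1, 0), p)).2 in
  let eta := (Tt^-1, - X1 / (Tt * X2)) in let xi := (0, X2^-1) in
  X2 != 0 ->
  [/\ D1 (hat p q eta) = (1, 0), D1 (hat p q xi) = (0, 1) &
    forall v, v = (D1 (hat p q v)).1 *: eta + (D1 (hat p q v)).2 *: xi].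
Proof.
move=> X2 Tt X1 eta xi X20; have Tt0 := Tt_neq0.
have T1 : (D1 ((1, 0), p)).1 = Tt by rewrite dT_vert mul1r.
split; last move=> v; rewrite D1_hat; apply: base_eq.
- transitivity (Tt^-1 * (D1 ((1, 0), p)).1 + - X1 / (Tt * X2) * (D1 ((0, 1), q)).1) => //.
  by rewrite dT_hat T1 mulr0 addr0 mulVf.
- transitivity (Tt^-1 * X1 + - X1 / (Tt * X2) * X2) => //.
  exact: triangular_arith1.
- transitivity (0 * (D1 ((1, 0), p)).1 + X2^-1 * (D1 ((0, 1), q)).1) => //.
  by rewrite dT_hat mul0r mulr0 addr0.
- transitivity (0 * X1 + X2^-1 * X2) => //.
  by rewrite mul0r add0r mulVf.
- transitivity ((v.1 * (D1 ((1, 0), p)).1 + v.2 * (D1 ((0, 1), q)).1) * Tt^-1 +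
    (v.1 * X1 + v.2 * X2) * 0) => //.
  by rewrite dT_hat T1 mulr0 mulr0 !addr0 mulfK.
- transitivity ((v.1 * (D1 ((1, 0), p)).1 + v.2 * (D1 ((0, 1), q)).1) * (- X1 / (Tt * X2)) +
    (v.1 * X1 + v.2 * X2) * X2^-1) => //.
  by rewrite dT_hat T1; exact: triangular_arith2.
Qed.
End point.

Section point2.
Variables (z : base R) (w : W).
Hypothesis Vzw : V (z, w).

Local Notation D1 k := (dd Phi1 k (z, w)).
Local Notation DG k := (dd G k (z, w)).
Local Notation Tt := (D1 ((1, 0), 0)).1.

Let dPhi1 : differentiable Phi1 (z, w). Proof. exact: smooth_diff sPhi1 Vzw. Qed.
Let dG : differentiable G (z, w). Proof. exact: smooth_diff sG Vzw. Qed.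

Lemma d2T_zero (k l : base R * W) : k.1.1 = 0 -> (dd (dd Phi1 k) l (z, w)).1 = 0.
Proof.
move=> k0; have dk := smooth_diff (smooth_dd k sPhi1) Vzw.
rewrite -(dd_fst l dk).
have E y : V y -> (dd Phi1 k y).1 = 0.
  by case: y => y1 y2 Vy; rewrite (dT_vert Vy) k0 mul0r.
by rewrite (dd_congr l oV Vzw E) dd_cst.
Qed.

(** The source jet with f_x = [q], f_xx = [c], f_tt = f_tx = 0 and f_t solved from the source
    equation. Since t~ depends on t alone, the total derivative by x~ is [X2^-1] times that by x,
    which removes all terms with the time component of [Phi1]. *)
Lemma reduced_equation q c : let X2 := (D1 ((0, 1), q)).2 in
  let p := A z *: c - N z w q in let be := X2^-1 *: DG ((0, 1), q) in
  X2 != 0 ->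
  Tt^-1 *: (DG ((1, 0), p) - (D1 ((1, 0), p)).2 *: be) -
    A' (Phi1 (z, w)) *: ((X2^-1 * X2^-1) *: (DG (0, c)
      + dd (dd G ((0, 1), q)) ((0, 1), q) (z, w) - ((D1 (0, c)).2 +
       (dd (dd Phi1 ((0, 1), q)) ((0, 1), q) (z, w)).2) *: be))
    + N' (Phi1 (z, w)) (G (z, w)) be = 0.
Proof.
move=> X2 p be X20.
have [Deta Dxi dual] := dual_triangular Vzw p X20.
set X1 := (D1 ((1, 0), p)).2 in Deta dual *.
set eta := (_, _) in Deta dual.
set xi := (0, X2^-1) in Dxi dual.
have hxi : hat p q xi = X2^-1 *: ((0, 1) : base R, q).
  apply: base_pair_eq.
  - by apply/esym; exact: mulr0.
  - by apply/esym; exact: mulr1.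
  - by rewrite /= scale0r add0r.
have heta : hat p q eta = Tt^-1 *: ((1, 0) : base R, p) + (- X1 / (Tt * X2)) *: ((0, 1) : base R, q).
  apply: base_pair_eq => //.
  - by transitivity (Tt^-1 * 1 + (- X1 / (Tt * X2)) * 0) => //; exact: unit_arith1.
  - by transitivity (Tt^-1 * 0 + (- X1 / (Tt * X2)) * 1) => //; exact: unit_arith2.
have lhs : p - A z *: c + N z w q = 0.
  by rewrite /p addrAC subrK subrr.
have mE : (X2^-1 * X2^-1) *: c =
    xi.1 *: (xi.1 *: (0 : W) + xi.2 *: 0) + xi.2 *: (xi.1 *: 0 + xi.2 *: c).
  by rewrite /xi /= !scaler0 !add0r scaler0 add0r scalerA.
have := (jet_equiv_point Vzw dual mE).1 lhs.
have mE' : (0, (X2^-1 * X2^-1) *: c) = (X2^-1 * X2^-1) *: (0 : base R, c).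
  by apply: base_pair_eq => //; apply/esym; exact: mulr0.
rewrite (dd2_scale oV Vzw sG hxi) (dd2_scale oV Vzw sPhi1 hxi) (ddZ dPhi1 mE') (ddZ dG mE').
rewrite (ddZ dG hxi) -/be (dd_linear2 dG heta).
have u0 : (D1 (0, c)).1 = 0 by rewrite (dT_vert Vzw) mul0r.
have v0 : (dd (dd Phi1 ((0, 1), q)) ((0, 1), q) (z, w)).1 = 0 by exact: d2T_zero.
exact: reduced_module (Tt_neq0 Vzw) X20 u0 v0.
Qed.

(** The equations for f_xx = [w0] and f_xx = 0 differ by a scalar multiple of one vector [M], the
    scalar being the difference of the two sides; [hess_injective] shows that [M] is nonzero. *)
Lemma A_formula q : let X2 := (D1 ((0, 1), q)).2 in X2 != 0 ->
  A z / Tt = A' (Phi1 (z, w)) * (X2^-1 * X2^-1).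
Proof.
move=> X2 X20; set be := X2^-1 *: DG ((0, 1), q).
have Tt0 := Tt_neq0 Vzw.
pose M := DG (0, w0) - (D1 (0, w0)).2 *: be.
have M0 : M != 0.
  apply/eqP => /eqP; rewrite subr_eq0 => /eqP M0.
  have [Deta Dxi _] := dual_triangular Vzw 0 X20.
  have hxi : hat 0 q (0, X2^-1) = X2^-1 *: ((0, 1) : base R, q).
    apply: base_pair_eq.
    - by apply/esym; exact: mulr0.
    - by apply/esym; exact: mulr1.
    - by rewrite /= scaler0 add0r.
  have := hess_injective Vzw Deta Dxi (m := w0).
  rewrite (dT_vert Vzw) mul0r scale0r add0r (ddZ dG hxi) => /(_ M0) w0E.
  by have := w00; rewrite w0E eqxx.
have e1 := reduced_equation w0 X20; have e0 := reduced_equation 0 X20.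
have pE : ((1, 0), A z *: w0 - N z w q) =
    1 *: ((1, 0) : base R, A z *: 0 - N z w q) + A z *: (0 : base R, w0).
  apply: base_pair_eq.
  - by transitivity (1 * 1 + A z * 0) => //; rewrite mulr0 addr0 mulr1.
  - by transitivity (1 * 0 + A z * 0) => //; rewrite !mulr0 addr0.
  - transitivity (1 *: (A z *: 0 - N z w q) + A z *: w0) => //.
    by rewrite scale1r scaler0 add0r addrC.
have z0 : (0 : base R, 0 : W) = 0 *: (0, w0).
  by rewrite scale0r.
rewrite z0 !(ddZ dG (erefl (0 *: (0, w0)))) !(ddZ dPhi1 (erefl (0 *: (0, w0)))) in e0.
rewrite !scale0r in e0.
rewrite (dd_linear2 dG pE) (dd_linear2 dPhi1 pE) in e1.
have := A_formula_module e1 e0.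
rewrite -/M => /eqP; rewrite scaler_eq0 (negbTE M0) orbF subr_eq0 => /eqP <-.
by rewrite mulrC.
Qed.

(** If x~ varied along the fibre, the total derivative D_x x~ could be given any value by the choice
    of f_x, while [A_formula] makes A' / (D_x x~)^2 independent of it. The values 1 and 2 then
    contradict A' being nonzero. *)
Lemma dX_vert m : (D1 (0, m)).2 = 0.
Proof.
apply/eqP/negPn/negP => c0; set c := (D1 (0, m)).2 in c0.
pose x0 := (D1 ((0, 1), 0)).2.
(* The slope f_x along [m] for which D_x x~ takes the prescribed value [s]. *)
have X2 s : (D1 ((0, 1), ((s - x0) / c) *: m)).2 = s.
  have kE : ((0, 1), ((s - x0) / c) *: m) =
     1 *: ((0, 1) : base R, 0 : W) + ((s - x0) / c) *: (0 : base R, m).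
    apply: base_pair_eq.
    - by transitivity (1 * 0 + ((s - x0) / c) * 0) => //; rewrite !mulr0 addr0.
    - by transitivity (1 * 1 + ((s - x0) / c) * 0) => //; rewrite mulr0 mulr1 addr0.
    - transitivity (1 *: (0 : W) + ((s - x0) / c) *: m) => //.
      by rewrite scale1r add0r.
  rewrite (dd_linear2 dPhi1 kE).
  transitivity (1 * x0 + (s - x0) / c * c) => //.
  by rewrite mul1r divfK// subrKC.
have F s : s != 0 -> A z / Tt = A' (Phi1 (z, w)) * (s^-1 * s^-1).
  by move=> s0; have := @A_formula (((s - x0) / c) *: m); rewrite X2; exact.
have h1 := F 1 (oner_neq0 R); have h2 := F 2 (lt0r_neq0 (ltr0Sn R 1)).
have := A'0 Vzw; rewrite -/(Phi1 _); apply/negP; rewrite negbK.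
exact: A_vanishes h1 h2.
Qed.

Lemma dX_hat q : (D1 ((0, 1), q)).2 = (D1 ((0, 1), 0)).2.
Proof.
have kE : ((0, 1), q) = ((0, 1) : base R, 0 : W) + (0 : base R, q).
  by apply: base_pair_eq => /=; rewrite ?addr0 ?add0r.
rewrite (ddD dPhi1 kE).
by transitivity ((D1 ((0, 1), 0)).2 + (D1 (0, q)).2) => //; rewrite dX_vert addr0.
Qed.

Lemma Xx_neq0 : (D1 ((0, 1), 0)).2 != 0.
Proof.
have [k [k1 _]] := dPhi_surj Vzw (0, 1) 0.
have := dT_vert Vzw k; rewrite k1 /= => /esym/eqP.
rewrite mulf_eq0 (negbTE (Tt_neq0 Vzw)) orbF => /eqP k0.
have kE : k = k.1.2 *: ((0, 1) : base R, 0 : W) + 1 *: (0 : base R, k.2).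
  apply: base_pair_eq.
  - by transitivity (k.1.2 * 0 + 1 * 0) => //; rewrite k0 !mulr0 addr0.
  - by transitivity (k.1.2 * 1 + 1 * 0) => //; rewrite mulr0 mulr1 addr0.
  - by transitivity (k.1.2 *: (0 : W) + 1 *: k.2) => //; rewrite scaler0 scale1r add0r.
have := congr1 snd (dd_linear2 dPhi1 kE); rewrite k1.
move=> E; have {E}: 1 = k.1.2 * (D1 ((0, 1), 0)).2 + 1 * (D1 (0, k.2)).2 by [].
rewrite dX_vert mulr0 addr0 => E; apply/eqP => X0.
by move: E; rewrite X0 mulr0 => /eqP; rewrite oner_eq0.
Qed.
End point2.

Section point3.
Variables (z : base R) (w : W).
Hypothesis Vzw : V (z, w).

Local Notation D1 k := (dd Phi1 k (z, w)).
Local Notation DG k := (dd G k (z, w)).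
Local Notation DD F k l := (dd (dd F k) l (z, w)).
Local Notation Tt := (D1 ((1, 0), 0)).1.
Local Notation Xx := (D1 ((0, 1), 0)).2.
Local Notation Xt := (D1 ((1, 0), 0)).2.
Local Notation Xxx := (DD Phi1 ((0, 1), 0) ((0, 1), 0)).2.

Let dPhi1 : differentiable Phi1 (z, w). Proof. exact: smooth_diff sPhi1 Vzw. Qed.
Let dG : differentiable G (z, w). Proof. exact: smooth_diff sG Vzw. Qed.

Lemma exE q : ((0, 1), q) = ((0, 1) : base R, 0 : W) + (0 : base R, q).
Proof. by apply: base_pair_eq => /=; rewrite ?addr0 ?add0r. Qed.

Lemma etE q : ((1, 0), q) = ((1, 0) : base R, 0 : W) + (0 : base R, q).
Proof. by apply: base_pair_eq => /=; rewrite ?addr0 ?add0r. Qed.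

Lemma dPhi1_vert m y : V y -> dd Phi1 (0, m) y = 0.
Proof.
case: y => y1 y2 Vy; apply: base_eq.
  by rewrite (dT_vert Vy) mul0r.
by rewrite (dX_vert Vy).
Qed.

Lemma d2Phi1_hat q : DD Phi1 ((0, 1), q) ((0, 1), q) = DD Phi1 ((0, 1), 0) ((0, 1), 0).
Proof.
have E y : V y -> dd Phi1 ((0, 1), q) y = dd Phi1 ((0, 1), 0) y.
  move=> Vy; rewrite (ddD (smooth_diff sPhi1 Vy) (exE q)).
  by rewrite dPhi1_vert// addr0.
have dk k := smooth_diff (smooth_dd k sPhi1) Vzw.
rewrite (dd_congr _ oV Vzw E) (ddD (dk _) (exE q)).
rewrite [X in _ + X](dd_schwarz fr_base _ _ oV Vzw sPhi1).
rewrite [X in _ + X](dd_congr _ oV Vzw (@dPhi1_vert q)).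
by rewrite dd_cst addr0.
Qed.

Definition lower_order q be : W := Tt^-1 *: (DG ((1, 0), 0) - DG (0, N z w q) - Xt *: be) -
  A' (Phi1 (z, w)) *: ((Xx^-1 * Xx^-1) *: (DD G ((0, 1), q) ((0, 1), q) - Xxx *: be))
  + N' (Phi1 (z, w)) (G (z, w)) be.

Lemma lower_order_eq0 q : lower_order q (Xx^-1 *: DG ((0, 1), q)) = 0.
Proof.
have X0 : (D1 ((0, 1), q)).2 != 0 by rewrite (dX_hat Vzw) (Xx_neq0 Vzw).
have := reduced_equation Vzw 0 X0.
rewrite scaler0 sub0r d2Phi1_hat (dX_hat Vzw).
rewrite (ddD dG (etE (- N z w q))) (ddD dPhi1 (etE (- N z w q))) !(dPhi1_vert _ Vzw) addr0.
have z0 : (0 : base R, 0 : W) = 0 *: (0, w0) by rewrite scale0r.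
have m1 : (0 : base R, - N z w q) = (-1) *: (0 : base R, N z w q).
  by rewrite scaleN1r; apply: base_pair_eq => //=; rewrite oppr0.
rewrite (ddZ dG z0) (ddZ dG m1) scale0r add0r scaleN1r.
by rewrite (_ : (0 : base R).2 = 0)// add0r.
Qed.

(** Affine dependence on f_x, in the midpoint form that suits the reflection of f_x. *)
Hypothesis midN : forall z w b v, N z w (b + v) + N z w (b - v) = 2 *: N z w b.
Hypothesis midN' : forall z w b v, N' z w (b + v) + N' z w (b - v) = 2 *: N' z w b.

Lemma dd2_sum (X : normedModType R) (F : base R * W -> X) k u v :
  smooth_on V F -> k = u + v ->
  DD F k k = DD F u u + DD F v u + (DD F u v + DD F v v).
Proof.
move=> sF kE.
have E y : V y -> dd F k y = dd F u y + dd F v y.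
  by move=> Vy; apply: ddD => //; exact: smooth_diff sF Vy.
have dk l := smooth_diff (smooth_dd l sF) Vzw.
rewrite (ddD (dk k) kE) (dd_congr u oV Vzw E) (dd_congr v oV Vzw E).
by rewrite !dd_add.
Qed.

Lemma parallelogram (X : normedModType R) (F : base R * W -> X) k k' u v :
  smooth_on V F -> k = u + v -> k' = u + (-1) *: v ->
  DD F k k + DD F k' k' = 2 *: (DD F u u + DD F v v).
Proof.
move=> sF kE k'E; rewrite (dd2_sum sF kE) (dd2_sum sF k'E).
have dk l := smooth_diff (smooth_dd l sF) Vzw.
rewrite (dd2_scale oV Vzw sF (erefl ((-1) *: v))) (ddZ (dk u) (erefl ((-1) *: v))).
have E y : V y -> dd F ((-1) *: v) y = (-1) *: dd F v y.
  by move=> Vy; apply: ddZ => //; exact: smooth_diff sF Vy.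
rewrite (dd_congr u oV Vzw E) dd_scale// mulN1r opprK scale1r !scaleN1r.
rewrite scalerDr !scaler_nat !mulr2n.
rewrite addrACA; congr (_ + _).
  by rewrite addrACA subrr addr0.
by rewrite addrACA subrr add0r.
Qed.

(** In the sum of the equations at [q] and [- q] minus twice the one at 0, all terms affine in f_x
    cancel; what remains is - 2 A' / X_x^2 times the vertical second derivative of [G]. *)
Lemma d2G_vert q : DD G (0, q) (0, q) = 0.
Proof.
have Eq := lower_order_eq0 q; have Eq' := lower_order_eq0 (- q).
have E0 := lower_order_eq0 0.
have m1 (m : W) : (0 : base R, - m) = (-1) *: (0 : base R, m).
  by rewrite scaleN1r; apply: base_pair_eq => //=; rewrite oppr0.
have exN : ((0, 1), - q) = ((0, 1) : base R, 0 : W) + (-1) *: (0 : base R, q).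
  by rewrite exE m1.
pose r := Xx^-1 *: DG (0, q); pose b0 := Xx^-1 *: DG ((0, 1), 0).
have bq : Xx^-1 *: DG ((0, 1), q) = b0 + r by rewrite (ddD dG (exE q)) scalerDr.
have bq' : Xx^-1 *: DG ((0, 1), - q) = b0 - r.
  by rewrite (ddD dG exN) (ddZ dG (erefl (_ *: _))) scaleN1r scalerBr.
rewrite /lower_order bq in Eq; rewrite /lower_order bq' in Eq'.
rewrite /lower_order -/b0 in E0.
have P := parallelogram sG (exE q) exN.
have PN : DG (0, N z w q) + DG (0, N z w (- q)) = 2 *: DG (0, N z w 0).
  have := midN z w 0 q; rewrite add0r sub0r => NE.
  have kE : (0 : base R, 2 *: N z w 0) = (0, N z w q) + (0, N z w (- q)).
    by apply: base_pair_eq => /=; rewrite ?addr0.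
  rewrite -(ddD dG kE); apply: ddZ => //.
  by apply: base_pair_eq => //; apply/esym; exact: mulr0.
have s0 : A' (Phi1 (z, w)) * (Xx^-1 * Xx^-1) != 0.
  by rewrite !mulf_neq0 ?invr_eq0 ?(Xx_neq0 Vzw)// (A'0 Vzw).
have M' := midN' (Phi1 (z, w)) (G (z, w)) b0 r.
exact: (d2G_vert_module s0 P PN M' E0 Eq Eq').
Qed.

(** Polarisation of [d2G_vert]. *)
Lemma d2G_vert_sym u v : DD G (0, u) (0, v) = 0.
Proof.
have kE : (0 : base R, u + v) = (0, u) + (0, v).
  by apply: base_pair_eq => /=; rewrite ?addr0.
have := dd2_sum sG kE; rewrite !d2G_vert add0r addr0.
rewrite (dd_schwarz fw _ _ oV Vzw sG) -mulr2n => /esym/eqP.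
rewrite -scaler_nat scaler_eq0 pnatr_eq0 /= => /eqP E.
exact: E.
Qed.

Lemma d2G_hat q : DD G ((0, 1), q) ((0, 1), q) =
  DD G ((0, 1), 0) ((0, 1), 0) + 2 *: DD G (0, q) ((0, 1), 0).
Proof.
rewrite (dd2_sum sG (exE q)) d2G_vert addr0 -addrA; congr (_ + _).
by rewrite (dd_schwarz fw _ _ oV Vzw sG) -mulr2n scaler_nat.
Qed.

End point3.

Hypothesis midN : forall z w b v, N z w (b + v) + N z w (b - v) = 2 *: N z w b.
Hypothesis midN' : forall z w b v, N' z w (b + v) + N' z w (b - v) = 2 *: N' z w b.
Hypothesis cV : @convex_set R (base R * W)%type V.

Let segment p q : V p -> V q -> forall s : R, 0 <= s <= 1 -> V (p + s *: (q - p)).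
Proof. by move=> Vp Vq s; apply: convex_segment => //; rewrite subrKC. Qed.

Lemma segment_cst (X : normedModType R) (fX : frame X) (F : base R * W -> X) p q :
  smooth_on V F -> V p -> V q -> (forall r, V r -> dd F (q - p) r = 0) ->
  F q = F p.
Proof.
move=> sF Vp Vq F0; rewrite -{1}(subrKC p q) (dd_cst_segment fX (c := 0)) ?addr0//.
  by move=> s hs; exact: smooth_diff sF (segment Vp Vq hs).
by move=> s hs; exact: F0 (segment Vp Vq hs).
Qed.

(** Convexity of [V] joins points with equal t inside [V] even when x and w differ, and the joining
    direction has no time component. Hence t~ is a single function of t on the whole of [V]. *)
Lemma Phi1_time p q : V p -> V q -> p.1.1 = q.1.1 -> (Phi1 p).1 = (Phi1 q).1.
Proof.
move=> Vp Vq pq; apply: (segment_cst (@frame_real R) (F := fun r => (Phi1 r).1)) => //.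
  apply: (@smooth_post _ _ _ _ V Phi1 (fst_lin R R)) => // x; exact: cvg_fst.
case=> z w Vr; rewrite (dd_fst _ (smooth_diff sPhi1 Vr)) (dT_vert Vr).
by rewrite (_ : (p - q).1.1 = p.1.1 - q.1.1)// pq subrr mul0r.
Qed.

Lemma vert_sub (z : base R) (w w' : W) : (z, w') - (z, w) = (0, w' - w).
Proof.
apply: base_pair_eq => //.
- by transitivity (z.1 - z.1) => //; rewrite subrr.
- by transitivity (z.2 - z.2) => //; rewrite subrr.
Qed.

Lemma Phi1_fibre z w w' : V (z, w) -> V (z, w') -> Phi1 (z, w') = Phi1 (z, w).
Proof.
move=> Vw Vw'; apply: (segment_cst fr_base (F := Phi1)) => // r Vr.
by rewrite (vert_sub z w w'); exact: dPhi1_vert.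
Qed.

Lemma dG_fibre z w w' m : V (z, w) -> V (z, w') ->
  dd G (0, m) (z, w') = dd G (0, m) (z, w).
Proof.
move=> Vw Vw'; apply: (segment_cst fw (F := dd G (0, m))) => //.
  exact: smooth_dd.
by case=> y v Vr; rewrite (vert_sub z w w'); exact: d2G_vert_sym.
Qed.

Lemma G_affine z w w' : V (z, w) -> V (z, w') ->
  G (z, w') = G (z, w) + dd G (0, w' - w) (z, w).
Proof.
move=> Vw Vw'; rewrite -{1}(subrKC (z, w) (z, w')) (vert_sub z w w').
apply: (dd_cst_segment fw) => s hs; rewrite -(vert_sub z w w').
  by apply: smooth_diff sG _; exact: segment.
rewrite (vert_sub z w w').
have sE : (z, w) + s *: (0, w' - w) = (z, w + s *: (w' - w)).
  apply: base_pair_eq => //.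
  - by transitivity (z.1 + s * 0) => //; rewrite mulr0 addr0.
  - by transitivity (z.2 + s * 0) => //; rewrite mulr0 addr0.
have := segment Vw Vw' hs; rewrite (vert_sub z w w') sE => Vs.
exact: dG_fibre.
Qed.

Variable O : set (base R).
Hypotheses (oO : open O) (OV : fst @` V = O).

(** An arbitrary choice, without regularity in [z]. The functions extracted with it do not depend on
    it, and this is what makes them smooth. *)
Let sec z : W := get [set w | V (z, w)].

Let Vsec z : O z -> V (z, sec z).
Proof.
rewrite -OV => -[[y w] Vy /= <-].
by apply: (@getPex _ [set w | V (y, w)]); exists w.
Qed.

Let OofV z w : V (z, w) -> O z.
Proof. by rewrite -OV => Vz; exists (z, w). Qed.

(** At times that do not occur in [V] the value comes from the default of [get]; only times of
    points of [V] matter. *)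
Definition fib_T (s : R) : R := (Phi1 (get [set p | V p /\ p.1.1 = s])).1.
Definition fib_X (z : base R) : R := (Phi1 (z, sec z)).2.
Definition fib_M (z : base R) (m : W) : W := dd G (0, m) (z, sec z).
Definition fib_h (z : base R) : W := G (z, sec z) - fib_M z (sec z).

Lemma fib_TE z w : V (z, w) -> fib_T z.1 = (Phi1 (z, w)).1.
Proof.
move=> Vz; rewrite /fib_T.
have [Vg gE] : [set p | V p /\ p.1.1 = z.1] (get [set p | V p /\ p.1.1 = z.1]).
  by apply: (@getPex _ [set p | V p /\ p.1.1 = z.1]); exists (z, w).
exact: Phi1_time.
Qed.

Lemma fib_XE z w : V (z, w) -> fib_X z = (Phi1 (z, w)).2.
Proof.
by move=> Vz; rewrite /fib_X (Phi1_fibre Vz (Vsec (OofV Vz))).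
Qed.

Lemma fib_ME z w m : V (z, w) -> fib_M z m = dd G (0, m) (z, w).
Proof. by move=> Vz; rewrite /fib_M (dG_fibre _ Vz (Vsec (OofV Vz))). Qed.

Lemma fib_lin z s t u v : O z -> fib_M z (s *: u + t *: v) = s *: fib_M z u + t *: fib_M z v.
Proof.
move=> Oz; apply: dd_linear2; first exact: smooth_diff sG (Vsec Oz).
apply: base_pair_eq => //.
- by transitivity (s * 0 + t * 0) => //; rewrite !mulr0 addr0.
- by transitivity (s * 0 + t * 0) => //; rewrite !mulr0 addr0.
Qed.

Lemma fib_GE z w : V (z, w) -> fib_M z w + fib_h z = G (z, w).
Proof.
move=> Vz; have Vs := Vsec (OofV Vz).
rewrite (G_affine Vs Vz) -(fib_ME _ Vs) /fib_h.
have -> : w - sec z = 1 *: w + (-1) *: sec z by rewrite scale1r scaleN1r.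
rewrite (fib_lin _ _ _ _ (OofV Vz)) scale1r scaleN1r.
by rewrite addrCA.
Qed.

(** Smoothness is a local property, and the open slices of [V] with constant w cover [O]. *)
Let local (X : normedModType R) (f : base R -> X) :
  (forall w, smooth_on [set y | V (y, w)] f) -> smooth_on O f.
Proof. by move=> sf s p Op; apply: (sf (sec p)); exact: Vsec. Qed.

Let sT : smooth_on V (fun r => (Phi1 r).1).
Proof. apply: (@smooth_post _ _ _ _ V Phi1 (fst_lin R R)) => // x; exact: cvg_fst. Qed.

Let sX : smooth_on V (fun r => (Phi1 r).2).
Proof. apply: (@smooth_post _ _ _ _ V Phi1 (snd_lin R R)) => // x; exact: cvg_snd. Qed.

Let sM m : smooth_on O (fun z => fib_M z m).
Proof.
apply: local => w; apply: (smooth_slice oV (smooth_dd (0, m) sG)) => y Vy.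
exact: fib_ME.
Qed.

Let sMh w : smooth_on [set y | V (y, w)] (fun y => fib_M y w + fib_h y).
Proof. by apply: (smooth_slice oV sG) => y; exact: fib_GE. Qed.

Let sh : smooth_on O fib_h.
Proof.
apply: local => w; have oU : open [set y | V (y, w)] by exact: open_slice.
apply: (@smooth_congr _ _ _ _ (fun y => (fib_M y w + fib_h y) + - fib_M y w)) => //.
  by move=> y _; rewrite addrAC subrr add0r.
apply: smooth_add => //; apply: smooth_opp => //.
by apply: smooth_sub (sM w) => y; exact: OofV.
Qed.

Lemma fib_Tt z w : V (z, w) ->
  dd (fun y => fib_T y.1) (1, 0) z = (dd Phi1 ((1, 0), 0) (z, w)).1.
Proof.
move=> Vz; rewrite (dd_slice oV sT (fun y (Vy : V (y, w)) => fib_TE Vy) _ Vz).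
exact: dd_fst (smooth_diff sPhi1 Vz).
Qed.

Lemma fib_Xd v z w : V (z, w) ->
  dd fib_X v z = (dd Phi1 (v, 0) (z, w)).2.
Proof.
move=> Vz; rewrite (dd_slice oV sX (fun y (Vy : V (y, w)) => fib_XE Vy) _ Vz).
exact: dd_snd (smooth_diff sPhi1 Vz).
Qed.

Lemma fib_Xdd u v z w : V (z, w) ->
  dd (dd fib_X v) u z = (dd (dd Phi1 (v, 0)) (u, 0) (z, w)).2.
Proof.
move=> Vz; have sXv : smooth_on V (fun r => (dd Phi1 (v, 0) r).2).
  apply: (@smooth_post _ _ _ _ V (dd Phi1 (v, 0)) (snd_lin R R)) => //.
    by move=> x; exact: cvg_snd.
  exact: smooth_dd.
rewrite (dd_slice oV sXv (fun y (Vy : V (y, w)) => fib_Xd v Vy) _ Vz).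
exact: dd_snd (smooth_diff (smooth_dd _ sPhi1) Vz).
Qed.

(** Derivatives of [Phi] at (z, w) are derivatives along the slice through w, hence derivatives of
    [T], [X] and M w + h; the lower-order equation thereby becomes [transport_eq]. Injectivity of
    [M] is that of the differential on vertical vectors. *)
Theorem fibre_form : exists (T : R -> R) X M h,
  [/\ fibred O T X M h,
      forall z w, V (z, w) -> Phi (z, w) = ((T z.1, X z), M z w + h z),
      forall z m, O z -> M z m = 0 -> m = 0,
      forall z, O z -> A z / dd (fun y : base R => T y.1) (1, 0) z =
        A' (T z.1, X z) * ((dd X (0, 1) z)^-1 * (dd X (0, 1) z)^-1)
    & forall z w q, V (z, w) -> transport_eq A' N N' T X M h z w q].
Proof.
exists fib_T, fib_X, fib_M, fib_h.
have PhiE z w : V (z, w) -> (fib_T z.1, fib_X z) = Phi1 (z, w).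
  by move=> Vz; rewrite (fib_TE Vz) (fib_XE Vz); case: (Phi1 _).
split.
- split => //.
  + by apply: local => w; apply: (smooth_slice oV sT) => y; exact: fib_TE.
  + by apply: local => w; apply: (smooth_slice oV sX) => y; exact: fib_XE.
  + by move=> *; exact: fib_lin.
  + by move=> z /Vsec Vz; rewrite (fib_Tt Vz) Tt_neq0.
  + by move=> z /Vsec Vz; rewrite (fib_Xd _ Vz) Xx_neq0.
- move=> z w Vz; rewrite (PhiE _ _ Vz) (fib_GE Vz) /Phi1 /G.
  by case: (Phi _).
- move=> z m /Vsec Vz; rewrite (fib_ME _ Vz) => m0.
  have [] := dPhi_inj Vz (dPhi1_vert m Vz) m0.
  by [].
- move=> z /Vsec Vz; rewrite (fib_Tt Vz) (PhiE _ _ Vz) (fib_Xd _ Vz).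
  exact: A_formula (Xx_neq0 Vz).
- move=> z w q Vz; have := lower_order_eq0 Vz q.
  rewrite /transport_eq /lower_order.
  rewrite (fib_Tt Vz) (PhiE _ _ Vz) !(fib_Xd _ Vz) (fib_Xdd _ _ Vz) (fib_GE Vz).
  have gE y : V (y, w) -> fib_M y w + fib_h y = G (y, w) by exact: fib_GE.
  have dgE v y : V (y, w) -> dd (fun y => fib_M y w + fib_h y) v y = dd G (v, 0) (y, w).
    exact: dd_slice.
  rewrite !(dgE _ _ Vz) (dd_slice oV (smooth_dd _ sG) (dgE _) _ Vz).
  have mE y : V (y, w) -> fib_M y q = dd G (0, q) (y, w) by exact: fib_ME.
  rewrite (dd_slice oV (smooth_dd _ sG) mE _ Vz) !(fib_ME _ Vz).
  by rewrite (d2G_hat Vz)// (ddD (smooth_diff sG Vz) (exE q)).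
Qed.
End structure.

Section affine_line.
Context {R : realType}.
Implicit Types V W : normedModType R.

Lemma dd_affine_line V W (F : V -> W) p v c :
  (forall s : R, F (s *: v + p) = F p + s *: c) -> dd F v p = c.
Proof.
move=> FE; rewrite -ddE /derive; apply: cvg_lim => //.
apply: (@cvg_trans _ (cst c @ (0 : R)^')); last exact: cvg_cst.
apply: near_eq_cvg; near=> s.
have s0 : s != 0 by near: s; exact: nbhs_dnbhs_neq.
rewrite /= FE.
by rewrite addrAC subrr add0r scalerA mulVf// scale1r.
Unshelve. all: by end_near. Qed.

Lemma dd_time (T : R -> R) (v z : base R) : v.1 = 0 ->
  dd (fun y : base R => T y.1) v z = 0.
Proof.
move=> v0; apply: dd_affine_line => s; rewrite scaler0 addr0; congr T.
by transitivity (s * v.1 + z.1) => //; rewrite v0 mulr0 add0r.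
Qed.

Lemma dd_time1 (T : R -> R) (z : base R) :
  dd (fun y : base R => T y.1) (1, 0) z = derive1 T z.1.
Proof.
rewrite -ddE /derive /derive1.
set f := fun s : R => _; set g := fun s : R => _.
suff -> : f = g by [].
apply/funext => s; rewrite /f /g /=; congr (_ *: (T _ - _)).
by transitivity (s * 1 + z.1) => //; rewrite mulr1.
Qed.

Lemma rolle_segment (V : normedModType R) (f : V -> R) p v :
  (forall s, 0 <= s <= 1 -> differentiable f (p + s *: v)) ->
  f (p + v) = f p -> exists2 s, 0 <= s <= 1 & dd f v (p + s *: v) = 0.
Proof.
move=> df fpv.
have dP (s : R) : 0 <= s <= 1 ->
    is_derive s 1 (fun s : R => f (p + s *: v)) (dd f v (p + s *: v)).
  by move=> hs; rewrite -ddE; apply: is_derive_line; exact: df.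
have [||x] := @MVT R (fun s : R => f (p + s *: v)) (fun s => dd f v (p + s *: v)) 0 1 ltr01.
- by move=> s; rewrite in_itv/= => /andP[/ltW s0 /ltW s1]; apply: dP; rewrite s0.
- apply: derivable_within_continuous => s; rewrite in_itv/= => /dP hs.
  exact: ex_derive.
rewrite in_itv/= scale0r scale1r addr0 subr0 mulr1 fpv subrr => /andP[x0 x1] E.
by exists x => //; rewrite !ltW.
Qed.

End affine_line.

(** * Fibred maps as point transformations between evolution systems *)

Section transport.
Context {R : realType}.
Variables (W : normedModType R) (fw : frame W) (O : set (base R)).
Variables (T : R -> R) (X : base R -> R) (M : base R -> W -> W) (h : base R -> W).
Hypotheses (oO : open O) (F : fibred O T X M h).
Hypothesis bijM : forall z, O z -> bijective (M z).

Definition fibred_map (p : base R * W) : base R * W :=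
  ((T p.1.1, X p.1), M p.1 p.2 + h p.1).

Let V : set (base R * W) := O `*` setT.
Let phi (y : base R) : base R := (T y.1, X y).
Let G (p : base R * W) := M p.1 p.2 + h p.1.

Lemma open_cylinder : open V.
Proof.
rewrite (_ : V = fst @^-1` O); first by apply: open_comp => // x _; exact: cvg_fst.
by apply/seteqP; split => [p []|p Op].
Qed.

Lemma smooth_base (Y : normedModType R) (f : base R -> Y) :
  smooth_on O f -> smooth_on V (fun p => f p.1).
Proof.
move=> sf.
apply: (@smooth_congr _ _ _ _ (fun p => f (fst_lin (base R) W p + 0)) _ open_cylinder).
  by move=> q _; rewrite addr0.
apply: (@smooth_pre _ _ _ _ _ O f (fst_lin (base R) W) 0 open_cylinder) => //.
  by move=> x; exact: cvg_fst.
by move=> p [Op _]; rewrite addr0.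
Qed.

Let smooth_phi : smooth_on O phi.
Proof. apply: smooth_pair => //; [exact: fibred_T F|exact: fibred_X F]. Qed.

Lemma fibred_linear z : O z -> exists L : {linear W -> W}, M z = L.
Proof.
move=> Oz; have Ml : linear (M z).
  by move=> a u v; have := fibred_lin F a 1 u v Oz; rewrite !scale1r.
pose L : {linear W -> W} := HB.pack (M z) (GRing.isLinear.Build _ _ _ _ _ Ml).
by exists L.
Qed.

Lemma M_frame z w : O z -> M z w = \sum_i fr_coord (f:=fw) i w *: M z (fr_vec i).
Proof.
move=> /fibred_linear[L ->]; rewrite [in LHS](frP fw w) linear_sum.
by apply: eq_bigr => i _; rewrite linearZ.
Qed.

(** Joint smoothness follows from smoothness of M z w in z for fixed w, because M is linear in w and
    a finite frame writes it as a sum of products of coordinates of w and smooth functions of z. *)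
Let smooth_G' : smooth_on V G.
Proof.
have oV := open_cylinder.
apply: smooth_add => //; last exact: smooth_base (fibred_h F).
apply: (smooth_coord (fw := fw)) => // j.
apply: (@smooth_congr _ _ _ _ (fun p => \sum_i fr_coord (f:=fw) i p.2 *
    fr_coord (f:=fw) j (M p.1 (fr_vec i))) _ oV).
  move=> p [Op _]; rewrite (M_frame _ Op) linear_sum.
  by apply: eq_bigr => i _; rewrite linearZ.
apply: smooth_sum => // i; apply: smooth_mul => //.
  apply: (@smooth_fr _ _ _ fw V snd i) => //.
  apply: (@smooth_linear _ _ _ V (snd_lin (base R) W)) => // x.
  exact: cvg_snd.
apply: smooth_fr => //; apply: (smooth_base (f := fun z => M z (fr_vec i))).
exact: fibred_M F _.
Qed.

Lemma smooth_fibred_map : smooth_on V fibred_map.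
Proof.
apply: smooth_pair => //; first exact: open_cylinder.
exact: (smooth_base (f := phi)).
Qed.

Let OV z w : O z -> V (z, w). Proof. by []. Qed.

Lemma dd_G_base v z w : O z ->
  dd G (v, 0) (z, w) = dd (fun y => M y w + h y) v z.
Proof.
move=> Oz; apply/esym.
by apply: (dd_slice open_cylinder smooth_G' (w := w)) => //; exact: OV.
Qed.

Lemma dd_G_vert m z w : O z -> dd G (0, m) (z, w) = M z m.
Proof.
move=> Oz; apply: dd_affine_line => s.
have -> : s *: (0, m) + (z, w) = (z, s *: m + 1 *: w).
  by apply: base_pair_eq => /=; rewrite ?scaler0 ?add0r ?scale1r.
rewrite /G /= (fibred_lin F)// scale1r.
by rewrite -addrA addrC.
Qed.

Lemma dd2_G_base u v z w : O z ->
  dd (dd G (v, 0)) (u, 0) (z, w) = dd (dd (fun y => M y w + h y) v) u z.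
Proof.
move=> Oz; apply/esym.
apply: (dd_slice open_cylinder (smooth_dd (v, 0) smooth_G') (w := w)) => //.
by move=> y [Oy _]; rewrite dd_G_base.
Qed.

Lemma dd2_G_mixed u m z w : O z ->
  dd (dd G (0, m)) (u, 0) (z, w) = dd (fun y => M y m) u z.
Proof.
move=> Oz; apply/esym.
apply: (dd_slice open_cylinder (smooth_dd (0, m) smooth_G') (w := w)) => //.
by move=> y [Oy _]; rewrite dd_G_vert.
Qed.

Lemma dd2_G_vert m n z w : O z -> dd (dd G (0, m)) (0, n) (z, w) = 0.
Proof.
move=> Oz; apply: dd_affine_line => s; rewrite scaler0 addr0.
have -> : s *: (0, n) + (z, w) = (z, s *: n + w).
  by apply: base_pair_eq => /=; rewrite ?scaler0 ?add0r.
by rewrite !dd_G_vert.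
Qed.

Lemma dd_phi v z : O z -> dd phi v z = (dd (fun y : base R => T y.1) v z, dd X v z).
Proof.
move=> Oz; apply: dd_pair; first exact: smooth_diff (fibred_T F) Oz.
exact: smooth_diff (fibred_X F) Oz.
Qed.

Lemma dd2_phi z : O z -> dd (dd phi (0, 1)) (0, 1) z = (0, dd (dd X (0, 1)) (0, 1) z).
Proof.
move=> Oz; have E y : O y -> dd phi (0, 1) y = (0, dd X (0, 1) y).
  by move=> Oy; rewrite dd_phi// dd_time.
rewrite (dd_congr _ oO Oz E) dd_pair; first by rewrite dd_cst.
  exact: differentiable_cst.
exact: smooth_diff (smooth_dd _ (fibred_X F)) Oz.
Qed.

(** Rolle's theorem on the segment in [O]: equal values of T with different t would give a zero of
    T_t; then the segment is parallel to the x-axis, and equal values of X with different x would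
    give a zero of X_x. *)
Lemma injective_phi : @convex_set R (base R) O ->
  forall z z', O z -> O z' -> phi z = phi z' -> z = z'.
Proof.
move=> cO z z' Oz Oz' [Tz Xz].
have seg s : 0 <= s <= 1 -> O (z + s *: (z' - z)).
  by apply: convex_segment => //; rewrite subrKC.
have t0 : z'.1 = z.1.
  apply/eqP; rewrite -subr_eq0; apply/negPn/negP => t0.
  have Te : T (z + (z' - z)).1 = T z.1 by rewrite subrKC.
  have [s hs] := @rolle_segment R _ (fun y : base R => T y.1) z (z' - z)
    (fun s hs => smooth_diff (fibred_T F) (seg s hs)) Te.
  have vE : z' - z = (z'.1 - z.1) *: ((1, 0) : base R) + 1 *: (0, z'.2 - z.2).
    apply: base_eq.
    - by transitivity ((z'.1 - z.1) * 1 + 1 * 0) => //; rewrite mulr0 mulr1 addr0.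
    - transitivity ((z'.1 - z.1) * 0 + 1 * (z'.2 - z.2)) => //.
      by rewrite mulr0 mul1r add0r.
  rewrite (dd_linear2 (smooth_diff (fibred_T F) (seg s hs)) vE).
  rewrite [X in _ + _ *: X]dd_time// scaler0 addr0 => /eqP.
  by rewrite mulf_eq0 (negbTE t0) (negbTE (fibred_Tt F (seg s hs))).
apply/esym/base_eq => //; apply/eqP; rewrite -subr_eq0; apply/negPn/negP => x0.
have Xe : X (z + (z' - z)) = X z by rewrite subrKC.
have [s hs] := @rolle_segment R _ X z (z' - z)
  (fun s hs => smooth_diff (fibred_X F) (seg s hs)) Xe.
have vE : z' - z = (z'.2 - z.2) *: ((0, 1) : base R).
  apply: base_eq.
  - transitivity (z'.1 - z.1) => //; rewrite t0 subrr.
    by apply/esym; exact: mulr0.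
  - by transitivity ((z'.2 - z.2) * 1) => //; rewrite mulr1.
rewrite (ddZ (smooth_diff (fibred_X F) (seg s hs)) vE) => /eqP.
by rewrite mulf_eq0 (negbTE x0) (negbTE (fibred_Xx F (seg s hs))).
Qed.

Lemma transport_arith (t x xx gt gxx mt mxx mN mqx n Tt Xt Xx Xxx A A' : R) :
  Tt != 0 -> Xx != 0 -> A / Tt = A' * (Xx^-1 * Xx^-1) ->
  gt + mt = Tt * t + Xt * x ->
  gxx + 2 * mqx + mxx = Xxx * x + (Xx * Xx) * xx ->
  Tt^-1 * (gt + - mN + - (Xt * x)) +
    - (A' * ((Xx^-1 * Xx^-1) * (gxx + 2 * mqx + - (Xxx * x)))) + n = 0 ->
  t + - (A' * xx) + n = Tt^-1 * (mt + - (A * mxx) + mN).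
Proof.
move=> Tt0 Xx0 AE ht hxx tr.
have -> : t = Tt^-1 * (gt + mt - Xt * x) by rewrite ht; field.
have -> : xx = (Xx^-1 * Xx^-1) * (gxx + 2 * mqx + mxx - Xxx * x) by rewrite hxx; field.
have -> : Tt^-1 * (mt + - (A * mxx) + mN) = Tt^-1 * mt - (A / Tt) * mxx + Tt^-1 * mN
  by ring.
by rewrite AE -[RHS]addr0 -[X in _ = _ + X]tr; ring.
Qed.

Lemma transport_module (t x xx gt gxx mt mxx mN mqx n : W)
    (Tt Xt Xx Xxx A A' : R) :
  Tt != 0 -> Xx != 0 -> A / Tt = A' * (Xx^-1 * Xx^-1) ->
  gt + mt = Tt *: t + Xt *: x ->
  gxx + 2 *: mqx + mxx = Xxx *: x + (Xx * Xx) *: xx ->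
  Tt^-1 *: (gt - mN - Xt *: x) -
    A' *: ((Xx^-1 * Xx^-1) *: (gxx + 2 *: mqx - Xxx *: x)) + n = 0 ->
  t - A' *: xx + n = Tt^-1 *: (mt - A *: mxx + mN).
Proof.
move=> Tt0 Xx0 AE ht hxx tr; apply: (fr_ext fw) => l.
move: (congr1 l ht) (congr1 l hxx) (congr1 l tr).
rewrite !(linD l, linZ l, linN l) !(lin0 l); exact: transport_arith.
Qed.

(** Matching of 2-jets expresses f'_t~, f'_x~ and f'_x~x~ through the jet of f. Subtraction of
    [transport_eq] then leaves the target expression equal to T_t^-1 times [M z] applied to the
    source expression, and [M z] is injective. *)
Lemma maps_fibred A A' N N' :
  (forall z, O z -> A z / dd (fun y : base R => T y.1) (1, 0) z =
        A' (T z.1, X z) * ((dd X (0, 1) z)^-1 * (dd X (0, 1) z)^-1)) ->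
  (forall z w q, O z -> transport_eq A' N N' T X M h z w q) ->
  maps_pde V fibred_map (evol A N) (evol A' N').
Proof.
move=> AE tr f f' z sf sf' [Oz _] /same_2jetP[jet0 jet1 jet2].
change (O z) in Oz.
have Vz : V (z, f z) by [].
have oV := open_cylinder.
have df v : dd (fun y => G (y, f y)) v z = dd (fun y => M y (f z) + h y) v z + M z (dd f v z).
  rewrite (dd_along sf Vz smooth_G').
  have kE : (v, dd f v z) = (v, 0) + (0, dd f v z).
    by apply: base_pair_eq => /=; rewrite ?addr0 ?add0r.
  rewrite (ddD (smooth_diff smooth_G' Vz) kE) dd_G_base// dd_G_vert//.
have Cphi : C2_at O phi z by exact: smooth_C2.
have dphi v : dd (fun y => f' (phi y)) v z = dd f' (dd phi v z) (phi z).
  exact: (dd_comp_C2 sf' (fun _ _ => I) Cphi).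
have Tt0 := fibred_Tt F Oz; have Xx0 := fibred_Xx F Oz.
have df' := smooth_diff sf' (I : setT (phi z)).
have jx : dd (fun y => M y (f z) + h y) (0, 1) z + M z (dd f (0, 1) z) =
    dd X (0, 1) z *: dd f' (0, 1) (phi z).
  rewrite -df jet1 dphi dd_phi// dd_time//; apply: ddZ => //.
  by apply: base_eq; apply/esym; [exact: mulr0|exact: mulr1].
have jt : dd (fun y => M y (f z) + h y) (1, 0) z + M z (dd f (1, 0) z) =
    dd (fun y : base R => T y.1) (1, 0) z *: dd f' (1, 0) (phi z) +
    dd X (1, 0) z *: dd f' (0, 1) (phi z).
  rewrite -df jet1 dphi dd_phi//; apply: dd_linear2 => //.
  by apply: base_eq; [exact: unit_arith1|exact: unit_arith2].
have jxx : dd (dd (fun y => M y (f z) + h y) (0, 1)) (0, 1) z +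
    2 *: dd (fun y => M y (dd f (0, 1) z)) (0, 1) z + M z (dd (dd f (0, 1)) (0, 1) z) =
    dd (dd X (0, 1)) (0, 1) z *: dd f' (0, 1) (phi z) +
    (dd X (0, 1) z * dd X (0, 1) z) *: dd (dd f' (0, 1)) (0, 1) (phi z).
  have := jet2 (0, 1) (0, 1).
  rewrite (dd2_along fw oV sf Vz fw smooth_G').
  rewrite (dd2_comp fr_base fw oO Oz openT sf' (fun _ _ => I) Cphi).
  rewrite (dd2_sum oV Vz smooth_G' (exE (dd f (0, 1) z))).
  rewrite [X in _ + (_ + (X + _))](dd_schwarz fw _ _ oV Vz smooth_G').
  rewrite dd2_G_vert// dd2_G_mixed// dd2_G_base// dd_G_vert// addr0.
  have e1 : (0, dd (dd X (0, 1)) (0, 1) z) = dd (dd X (0, 1)) (0, 1) z *: ((0, 1) : base R).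
    by apply: base_eq; apply/esym; [exact: mulr0|exact: mulr1].
  have e2 : dd phi (0, 1) z = dd X (0, 1) z *: ((0, 1) : base R).
    rewrite dd_phi// dd_time//.
    by apply: base_eq; apply/esym; [exact: mulr0|exact: mulr1].
  rewrite dd2_phi// (ddZ df' e1) (dd2_scale openT _ sf' e2)// => <-.
  by rewrite addrC -addrA scaler_nat mulr2n.
have xE : dd f' (0, 1) (phi z) = (dd X (0, 1) z)^-1 *:
    (dd (fun y => M y (f z) + h y) (0, 1) z + M z (dd f (0, 1) z)).
  by rewrite jx scalerA mulVf// scale1r.
have := tr z (f z) (dd f (0, 1) z) Oz; rewrite /transport_eq -xE => trz.
have E := transport_module Tt0 Xx0 (AE z Oz) jt jxx trz.
rewrite !evolE -/(phi z).
have -> : f' (phi z) = M z (f z) + h z by rewrite [LHS](esym jet0).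
rewrite [X in _ <-> X = 0]E.
have [L LE] := fibred_linear Oz.
rewrite LE -linearZ -linearB -linearD; split => [->|/eqP].
  by rewrite linear0 scaler0.
rewrite scaler_eq0 invr_eq0 (negbTE Tt0) /= => /eqP L0.
by apply: (bij_inj (bijM Oz)); rewrite LE L0 linear0.
Qed.

Lemma point_transformation_fibred : @convex_set R (base R) O ->
  point_transformation V fibred_map.
Proof.
move=> cO; split; first exact: smooth_fibred_map.
- move=> [z w] [z' w'] [/= Oz _] [/= Oz' _] /pair_equal_spec[e1 e2].
  have {e1}zE : z = z' := injective_phi cO Oz Oz' e1.
  rewrite -{}zE in Oz' e2 *; congr (_, _).
  by apply: (bij_inj (bijM Oz)); exact: addIr e2.
- move=> [z w] Vz; have Oz : O z by case: Vz.
  have sPhi1 : smooth_on V (fun p => phi p.1) by exact: smooth_base.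
  have dPhi : differentiable fibred_map (z, w) by exact: smooth_diff smooth_fibred_map Vz.
  set Tt := dd (fun y : base R => T y.1) (1, 0) z.
  set Xx := dd X (0, 1) z; set Xt := dd X (1, 0) z.
  have Tt0 : Tt != 0 := fibred_Tt F Oz; have Xx0 : Xx != 0 := fibred_Xx F Oz.
  have dE k : 'd fibred_map (z, w) k = ((Tt * k.1.1, Xt * k.1.1 + Xx * k.1.2),
      dd (fun y => M y w + h y) k.1 z + M z k.2).
    rewrite -deriveE// ddE /fibred_map dd_pair; last exact: smooth_diff smooth_G' Vz.
      congr (_, _); last first.
        have kE : k = (k.1, 0) + (0, k.2).
          by apply: base_pair_eq => /=; rewrite ?addr0 ?add0r.
        rewrite (ddD (smooth_diff smooth_G' Vz) kE) dd_G_base// dd_G_vert//.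
      have -> : dd (fun p : base R * W => (T p.1.1, X p.1)) k (z, w) = dd phi k.1 z.
        rewrite (dd_comp (f := fst) (g := phi)).
        - by congr (dd phi _ _); apply: dd_affine_line => s; exact: addrC.
        - exact: differentiable_fst.
        - exact: smooth_diff smooth_phi Oz.
      have kE : k.1 = k.1.1 *: ((1, 0) : base R) + k.1.2 *: (0, 1).
        by apply: base_eq; [exact: unit_arith1|exact: unit_arith2].
      rewrite dd_phi//; congr (_, _).
        rewrite (dd_linear2 (smooth_diff (fibred_T F) Oz) kE).
        rewrite [X in _ + _ *: X]dd_time// scaler0 addr0 scaleE mulrC//.
      rewrite (dd_linear2 (smooth_diff (fibred_X F) Oz) kE) !scaleE.
      by rewrite mulrC [_ * Xx]mulrC.
    exact: smooth_diff sPhi1 Vz.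
  have [K MK KM] := bijM Oz.
  (* Back substitution in the triangular differential: the t-component, then the x-component, then
     the fibre component through the inverse [K] of [M z]. *)
  pose inv (k : base R * W) : base R * W :=
    let b := (k.1.1 / Tt, (k.1.2 - Xt * (k.1.1 / Tt)) / Xx) in
    (b, K (k.2 - dd (fun y => M y w + h y) b z)).
  exists inv => k; rewrite ?dE.
    have bE : (Tt * k.1.1 / Tt, (Xt * k.1.1 + Xx * k.1.2 - Xt * (Tt * k.1.1 / Tt)) / Xx) = k.1.
      apply: base_eq => /=; first by rewrite mulrC mulKf.
      by rewrite (mulrC Tt) mulfK// addrAC subrr add0r mulrC mulKf.
    rewrite /inv /= bE addrAC subrr add0r MK; by case: (k).
  rewrite /inv /= KM; apply: base_pair_eq => /=.
  + by rewrite mulrC divfK.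
  + by rewrite [Xx * _]mulrC divfK// subrKC.
  + by rewrite subrKC.
Qed.

Lemma convex_cylinder : @convex_set R (base R) O -> @convex_set R (base R * W)%type V.
Proof.
move=> cO p q l; rewrite !inE => -[Op _] [Oq _]; split => //.
by have := cO p.1 q.1 l; rewrite !inE; apply.
Qed.

Lemma fst_cylinder : fst @` V = O.
Proof.
apply/seteqP; split => [_ [p [Op _] <-] //|z Oz].
by exists (z, 0).
Qed.
End transport.

(** * The two classes as evolution systems *)

Section systems.
Context {R : realType}.
Implicit Types L : arbitrary_elements R.

Definition fr_triple : frame (triple R) :=
  frame_prod (frame_prod (@frame_real R) (@frame_real R)) (@frame_real R).

Definition parabolic_rest L (z : base R) (w v : R) : R := - eB L z * v - eC L z * w.

Definition DE1_rest L (z : base R) (w v : triple R) : triple R :=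
  let A := eA L z in let Ax := dd (eA L) (0, 1) z in let At := dd (eA L) (1, 0) z in
  let B := eB L z in let Bx := dd (eB L) (0, 1) z in let Bt := dd (eB L) (1, 0) z in
  let C := eC L z in let Cx := dd (eC L) (0, 1) z in let Ct := dd (eC L) (1, 0) z in
  let k := 2 * v.1.1 - Ax / A * w.1.1 - At / A in
  (- B * v.1.1 + k * (w.1.1 + B) + Bx * w.1.1 + 2 * A * v.1.2 + Bt,
   - B * v.1.2 + k * (w.1.2 - C) - Cx * w.1.1 - Ct,
   - B * v.2 + k * w.2 - C * w.2).

Lemma parabolic_evol L f z : parabolic L f z <-> evol (eA L) (parabolic_rest L) f z.
Proof.
rewrite /parabolic /evol /parabolic_rest scaleE.
have -> : pdt f z - eA L z * pdx (pdx f) z - eB L z * pdx f z - eC L z * f z =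
  pdt f z - eA L z * pdx (pdx f) z + (- eB L z * pdx f z - eC L z * f z) by ring.
by [].
Qed.

Lemma triple_eq (p q : triple R) :
  p.1.1 = q.1.1 -> p.1.2 = q.1.2 -> p.2 = q.2 -> p = q.
Proof. by move: p q => [[? ?] ?] [[? ?] ?] /= -> -> ->. Qed.

Section components.
Variables (D : set (base R)) (f : base R -> triple R).
Hypotheses (oD : open D) (sf : smooth_on D f).

Lemma dd_comp11 v z : D z -> dd (fun y => (f y).1.1) v z = (dd f v z).1.1.
Proof.
move=> Dz; have df := smooth_diff sf Dz.
have df1 : differentiable (fun y => (f y).1) z.
  apply: (@differentiable_comp _ _ _ _ f fst) => //; exact: differentiable_fst.
by rewrite (dd_fst v df1) (dd_fst v df).
Qed.

Lemma dd_comp12 v z : D z -> dd (fun y => (f y).1.2) v z = (dd f v z).1.2.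
Proof.
move=> Dz; have df := smooth_diff sf Dz.
have df1 : differentiable (fun y => (f y).1) z.
  apply: (@differentiable_comp _ _ _ _ f fst) => //; exact: differentiable_fst.
by rewrite (dd_snd v df1) (dd_fst v df).
Qed.

Lemma dd_comp2 v z : D z -> dd (fun y => (f y).2) v z = (dd f v z).2.
Proof. by move=> Dz; rewrite dd_snd//; exact: smooth_diff sf Dz. Qed.
End components.

Section components2.
Variables (D : set (base R)) (f : base R -> triple R).
Hypotheses (oD : open D) (sf : smooth_on D f).

Lemma dd2_comp11 u v z : D z ->
  dd (dd (fun y => (f y).1.1) v) u z = (dd (dd f v) u z).1.1.
Proof.
move=> Dz; rewrite (dd_congr u oD Dz (fun y Dy => dd_comp11 sf v Dy)).
exact: (dd_comp11 (smooth_dd v sf)).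
Qed.

Lemma dd2_comp12 u v z : D z ->
  dd (dd (fun y => (f y).1.2) v) u z = (dd (dd f v) u z).1.2.
Proof.
move=> Dz; rewrite (dd_congr u oD Dz (fun y Dy => dd_comp12 sf v Dy)).
exact: (dd_comp12 (smooth_dd v sf)).
Qed.

Lemma dd2_comp2 u v z : D z ->
  dd (dd (fun y => (f y).2) v) u z = (dd (dd f v) u z).2.
Proof.
move=> Dz; rewrite (dd_congr u oD Dz (fun y Dy => dd_comp2 sf v Dy)).
exact: (dd_comp2 (smooth_dd v sf)).
Qed.
End components2.

Lemma DE1_arith1 (gt gx gxx k g A B Bx Bt g2x : R) :
  gt - A * gxx - B * gx + k * (g + B) + Bx * g + 2 * A * g2x + Bt =
  gt - A * gxx + (- B * gx + k * (g + B) + Bx * g + 2 * A * g2x + Bt).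
Proof. by ring. Qed.

Lemma DE1_arith2 (gt gx gxx k g A B C Cx Ct g1 : R) :
  gt - A * gxx - B * gx + k * (g - C) - Cx * g1 - Ct =
  gt - A * gxx + (- B * gx + k * (g - C) - Cx * g1 - Ct).
Proof. by ring. Qed.

Lemma DE1_arith3 (gt gx gxx k g A B C : R) :
  gt - A * gxx - B * gx + k * g - C * g =
  gt - A * gxx + (- B * gx + k * g - C * g).
Proof. by ring. Qed.

Lemma DE1_evol L f z : smooth_on setT f ->
  DE1 L f z <-> evol (eA L) (DE1_rest L) f z.
Proof.
move=> sf; rewrite evolE /DE1 /DE1_rest !pdxE !pdtE.
rewrite !(dd_comp11 sf)// !(dd_comp12 sf)// !(dd_comp2 sf)//.
rewrite !(dd2_comp11 openT sf)// !(dd2_comp12 openT sf)// !(dd2_comp2 openT sf)//.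
rewrite DE1_arith1 DE1_arith2 DE1_arith3.
split => [[e1 e2 e3]|e]; first by apply: triple_eq.
split.
- exact: (congr1 (fun p : triple R => p.1.1) e).
- exact: (congr1 (fun p : triple R => p.1.2) e).
- exact: (congr1 (fun p : triple R => p.2) e).
Qed.

Lemma parabolic_midpoint L z w b v :
  parabolic_rest L z w (b + v) + parabolic_rest L z w (b - v) =
  2 *: parabolic_rest L z w b.
Proof. by rewrite scaleE /parabolic_rest; ring. Qed.

Lemma DE1_mid1 (B b1 v1 r s w1 Bx A b2 v2 Bt : R) :
  - B * (b1 + v1) + (2 * (b1 + v1) - r * w1 - s) * (w1 + B) + Bx * w1
    + 2 * A * (b2 + v2) + Bt +
  (- B * (b1 - v1) + (2 * (b1 - v1) - r * w1 - s) * (w1 + B) + Bx * w1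
    + 2 * A * (b2 - v2) + Bt) =
  2 * (- B * b1 + (2 * b1 - r * w1 - s) * (w1 + B) + Bx * w1 + 2 * A * b2 + Bt).
Proof. by ring. Qed.

Lemma DE1_mid2 (B b1 v1 r s w1 w2 C Cx b2 v2 Ct : R) :
  - B * (b2 + v2) + (2 * (b1 + v1) - r * w1 - s) * (w2 - C) - Cx * w1 - Ct +
  (- B * (b2 - v2) + (2 * (b1 - v1) - r * w1 - s) * (w2 - C) - Cx * w1 - Ct) =
  2 * (- B * b2 + (2 * b1 - r * w1 - s) * (w2 - C) - Cx * w1 - Ct).
Proof. by ring. Qed.

Lemma DE1_mid3 (B b1 v1 r s w1 w3 C b3 v3 : R) :
  - B * (b3 + v3) + (2 * (b1 + v1) - r * w1 - s) * w3 - C * w3 +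
  (- B * (b3 - v3) + (2 * (b1 - v1) - r * w1 - s) * w3 - C * w3) =
  2 * (- B * b3 + (2 * b1 - r * w1 - s) * w3 - C * w3).
Proof. by ring. Qed.

Lemma DE1_midpoint L z (w b v : triple R) :
  DE1_rest L z w (b + v) + DE1_rest L z w (b - v) = 2 *: DE1_rest L z w b.
Proof.
apply: triple_eq.
- exact: DE1_mid1.
- exact: DE1_mid2.
- exact: DE1_mid3.
Qed.

(* The coefficients of a system solved for the time derivative are read off
   from its manifold with the test jets below. *)
Lemma evol_unique (W : normedModType R) (fw : frame W) (O : set (base R)) (w0 : W)
    (A A' : base R -> R) (N N' : base R -> W -> W -> W) : w0 != 0 ->
  (forall f z, smooth_on setT f -> O z -> (evol A N f z <-> evol A' N' f z)) ->
  forall z, O z -> A z = A' z /\ forall w q, N z w q = N' z w q.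
Proof.
move=> w00 NN z Oz.
have key w q c : A z *: c - N z w q = A' z *: c - N' z w q.
  pose p := A z *: c - N z w q.
  have := NN (quad z w p q 0 0 c) z (smooth_quad fw _ _ _ _ _ _ _ openT) Oz.
  rewrite !evolE !(dd_quad0 fw) (dd2_quad fw) (quad0 fw).
  rewrite !scale0r !scale1r !add0r !addr0 => -[/(_ _)].
  rewrite /p addrAC subrK subrr => /(_ erefl) E _.
  apply/eqP; rewrite -subr_eq0 opprB; apply/eqP; rewrite -[RHS]E.
  by rewrite -!addrA; congr (_ + _); congr (_ + _); rewrite addrC.
have N_eq w q : N z w q = N' z w q.
  by have := key w q 0; rewrite !scaler0 !sub0r => /oppr_inj.
split => //; have := key 0 0 w0; rewrite N_eq => /addIr/eqP.
by rewrite -subr_eq0 -scalerBl scaler_eq0 (negbTE w00) orbF subr_eq0 => /eqP.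
Qed.

Lemma parabolic_unique (O : set (base R)) L L' : same_pde O (parabolic L) (parabolic L') ->
  forall z, O z -> [/\ eA L z = eA L' z, eB L z = eB L' z & eC L z = eC L' z].
Proof.
move=> LL z Oz.
have [] := evol_unique (@frame_real R) (oner_neq0 R) (A := eA L) (A' := eA L')
  (N := parabolic_rest L) (N' := parabolic_rest L') (O := O) _ Oz.
  by move=> f y sf Oy; rewrite -!parabolic_evol; exact: LL.
move=> -> NN; have := NN 1 0; have := NN 0 1; rewrite /parabolic_rest.
rewrite !mulr0 !mulr1 !subr0 !sub0r => /oppr_inj -> /oppr_inj ->.
by [].
Qed.

Lemma DE1_unique_arith1 (B B' A A' r r' s s' x x' t t' : R) :
  - B * 1 + (2 * 1 - r * 0 - s) * (0 + B) + x * 0 + 2 * A * 0 + t =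
  - B' * 1 + (2 * 1 - r' * 0 - s') * (0 + B') + x' * 0 + 2 * A' * 0 + t' ->
  - B * 0 + (2 * 0 - r * 0 - s) * (0 + B) + x * 0 + 2 * A * 0 + t =
  - B' * 0 + (2 * 0 - r' * 0 - s') * (0 + B') + x' * 0 + 2 * A' * 0 + t' ->
  B = B'.
Proof.
move=> h1 h0; have := congr2 (fun a b : R => a - b) h1 h0.
rewrite (_ : _ - _ = B); last by ring.
by rewrite (_ : _ - _ = B'); last by ring.
Qed.

Lemma DE1_unique_arith2 (B B' C C' r r' s s' x x' t t' : R) :
  - B * 0 + (2 * 1 - r * 0 - s) * (0 - C) - x * 0 - t =
  - B' * 0 + (2 * 1 - r' * 0 - s') * (0 - C') - x' * 0 - t' ->
  - B * 0 + (2 * 0 - r * 0 - s) * (0 - C) - x * 0 - t =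
  - B' * 0 + (2 * 0 - r' * 0 - s') * (0 - C') - x' * 0 - t' ->
  C = C'.
Proof.
move=> h1 h0; have := congr2 (fun a b : R => a - b) h1 h0.
rewrite (_ : _ - _ = 2 * (- C)); last by ring.
rewrite (_ : _ - _ = 2 * (- C')); last by ring.
by move/(mulfI (lt0r_neq0 (ltr0Sn R 1)))/oppr_inj.
Qed.

(** At g = 0 the coefficient of g^1_x is B in the first equation and - 2 C in the second; A is the
    leading coefficient. *)
Lemma DE1_unique (O : set (base R)) L L' : same_pde O (DE1 L) (DE1 L') ->
  forall z, O z -> [/\ eA L z = eA L' z, eB L z = eB L' z & eC L z = eC L' z].
Proof.
move=> LL z Oz.
pose e1 : triple R := (1, 0, 0).
have e10 : e1 != 0 by apply/eqP => /(congr1 (fun p : triple R => p.1.1))/eqP; rewrite oner_eq0.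
have [] := evol_unique fr_triple e10 (A := eA L) (A' := eA L')
  (N := DE1_rest L) (N' := DE1_rest L') (O := O) _ Oz.
  by move=> f y sf Oy; rewrite -!DE1_evol//; exact: LL.
move=> -> NN; have N1 := NN 0 e1; have N0 := NN 0 0.
split => //.
- exact: DE1_unique_arith1 (congr1 (fun p : triple R => p.1.1) N1)
    (congr1 (fun p : triple R => p.1.1) N0).
- exact: DE1_unique_arith2 (congr1 (fun p : triple R => p.1.2) N1)
    (congr1 (fun p : triple R => p.1.2) N0).
Qed.

Lemma same_parabolic (O : set (base R)) L L' :
  (forall z, O z -> [/\ eA L z = eA L' z, eB L z = eB L' z & eC L z = eC L' z]) ->
  same_pde O (parabolic L) (parabolic L').
Proof. by move=> LL f z _ /LL[a b c]; rewrite /parabolic a b c. Qed.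

Lemma same_DE1 (O : set (base R)) L L' : open O ->
  (forall z, O z -> [/\ eA L z = eA L' z, eB L z = eB L' z & eC L z = eC L' z]) ->
  same_pde O (DE1 L) (DE1 L').
Proof.
move=> oO LL f z _ Oz; have [a b c] := LL z Oz.
have Ae y : O y -> eA L y = eA L' y by move=> /LL[].
have Be y : O y -> eB L y = eB L' y by move=> /LL[].
have Ce y : O y -> eC L y = eC L' y by move=> /LL[].
rewrite /DE1 a b c !pdxE !pdtE !(dd_congr _ oO Oz Ae) !(dd_congr _ oO Oz Be).
by rewrite !(dd_congr _ oO Oz Ce).
Qed.

Lemma maps_pde_same (W : normedModType R) (O O' : set (base R))
    (V : set (base R * W)) Phi (S S' S1 S1' : pde W) :
  (forall p, V p -> O p.1) -> (forall p, V p -> O' (Phi p).1) ->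
  same_pde O S S1 -> same_pde O' S' S1' ->
  maps_pde V Phi S S' -> maps_pde V Phi S1 S1'.
Proof.
move=> VO VO' SS SS' m f f' z sf sf' Vz pr.
have := m f f' z sf sf' Vz pr.
have /= := SS f z sf (VO _ Vz); have := SS' f' _ sf' (VO' _ Vz).
by move=> -> ->.
Qed.
End systems.

Section congruence.
Context {R : realType}.
Variables (W : normedModType R) (V : set (base R * W)).
Variables (Phi Psi : base R * W -> base R * W).
Hypotheses (oV : open V) (PP : forall p, V p -> Phi p = Psi p).

Lemma point_transformation_congr :
  point_transformation V Phi -> point_transformation V Psi.
Proof.
move=> [sPhi inj bij].
have sPsi : smooth_on V Psi by exact: smooth_congr sPhi.
split; [exact: sPsi| |] => [p q Vp Vq|p Vp].
  by rewrite -(PP Vp) -(PP Vq); exact: inj.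
have dE k : 'd Phi p k = 'd Psi p k.
  have e1 := deriveE k (smooth_diff sPhi Vp).
  have e2 := deriveE k (smooth_diff sPsi Vp).
  exact: etrans (esym e1) (etrans (D_congr k oV Vp PP) e2).
exact: eq_bij (bij p Vp) _ dE.
Qed.

Lemma maps_pde_congr S S' : maps_pde V Phi S S' -> maps_pde V Psi S S'.
Proof.
move=> m f f' z sf sf' Vz pr.
suff pr' : prolongs Phi f f' z by have := m f f' z sf sf' Vz pr'; rewrite (PP Vz).
have oE := open_graph oV sf.
have EE y : [set y | V (y, f y)] y -> Phi (y, f y) = Psi (y, f y) by exact: PP.
have c2 y : [set y | V (y, f y)] y -> (Phi (y, f y)).2 = (Psi (y, f y)).2.
  by move=> /EE ->.
have c1 y : [set y | V (y, f y)] y -> f' (Phi (y, f y)).1 = f' (Psi (y, f y)).1.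
  by move=> /EE ->.
move/same_2jetP: pr => [p0 p1 p2]; apply/same_2jetP; split.
- by rewrite c2// c1.
- by move=> v; rewrite (dd_congr v oE Vz c2) p1 (dd_congr v oE Vz c1).
- move=> v w.
  have d2 y : [set y | V (y, f y)] y -> dd (fun y => (Phi (y, f y)).2) w y =
      dd (fun y => (Psi (y, f y)).2) w y by move=> Ey; exact: dd_congr c2.
  have d1 y : [set y | V (y, f y)] y -> dd (fun y => f' (Phi (y, f y)).1) w y =
      dd (fun y => f' (Psi (y, f y)).1) w y by move=> Ey; exact: dd_congr c1.
  by rewrite (dd_congr v oE Vz d2) p2 (dd_congr v oE Vz d1).
Qed.
End congruence.

(** * Calculus of first derivatives of scalar functions *)

Section derivatives.
Context {R : realType}.
Variable O : set (base R).
Hypothesis oO : open O.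
Implicit Types f g : base R -> R.

(** A function together with its derivatives by x and by t, in this order. Derivatives of composite
    expressions are assembled by applying the closure lemmas and are compared with the wanted form
    by [ring]. *)
Definition has_d f fx ft := forall z, O z ->
  [/\ differentiable f z, dd f (0, 1) z = fx z & dd f (1, 0) z = ft z].

Lemma has_d_cst c : has_d (fun=> c) (fun=> 0) (fun=> 0).
Proof. by move=> z Oz; split; rewrite ?dd_cst//; exact: differentiable_cst. Qed.

Lemma has_d_add f fx ft g gx gt : has_d f fx ft -> has_d g gx gt ->
  has_d (fun z => f z + g z) (fun z => fx z + gx z) (fun z => ft z + gt z).
Proof.
move=> hf hg z Oz; have [df <- <-] := hf z Oz; have [dg <- <-] := hg z Oz.
by split; rewrite ?dd_add//; exact: differentiableD.
Qed.

Lemma has_d_opp f fx ft : has_d f fx ft ->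
  has_d (fun z => - f z) (fun z => - fx z) (fun z => - ft z).
Proof.
move=> hf z Oz; have [df <- <-] := hf z Oz.
by split; rewrite ?dd_opp//; exact: differentiableN.
Qed.

Lemma has_d_mul f fx ft g gx gt : has_d f fx ft -> has_d g gx gt ->
  has_d (fun z => f z * g z) (fun z => fx z * g z + f z * gx z)
    (fun z => ft z * g z + f z * gt z).
Proof.
move=> hf hg z Oz; have [df <- <-] := hf z Oz; have [dg <- <-] := hg z Oz.
by split; rewrite ?dd_mul//; exact: differentiableM.
Qed.

Lemma has_d_smooth f : smooth_on O f -> has_d f (dd f (0, 1)) (dd f (1, 0)).
Proof. by move=> sf z Oz; split => //; exact: smooth_diff sf Oz. Qed.

Lemma has_d_ext f fx ft g gx gt : has_d f fx ft ->
  (forall z, O z -> f z = g z) -> (forall z, O z -> fx z = gx z) ->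
  (forall z, O z -> ft z = gt z) -> has_d g gx gt.
Proof.
move=> hf fg fgx fgt z Oz; have [df fx' ft'] := hf z Oz.
by split; [exact: differentiable_congr fg df
  |rewrite -(dd_congr _ oO Oz fg) fx' fgx|rewrite -(dd_congr _ oO Oz fg) ft' fgt].
Qed.

(** Mixed derivatives are brought to the normal form with the x-derivative innermost, so that [ring]
    meets a single expression for both orders. *)
Lemma has_d_smooth_x f : smooth_on O f ->
  has_d (dd f (1, 0)) (dd (dd f (0, 1)) (1, 0)) (dd (dd f (1, 0)) (1, 0)).
Proof.
move=> sf z Oz; split => //; first exact: smooth_diff (smooth_dd _ sf) Oz.
exact: (dd_schwarz (@frame_real R) ((0, 1) : base R) ((1, 0) : base R) oO Oz sf).
Qed.

Lemma has_d2 f fx ft fxx fxt z : has_d f fx ft -> has_d fx fxx fxt -> O z ->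
  dd (dd f (0, 1)) (0, 1) z = fxx z.
Proof.
move=> hf hfx Oz; have [_ <- _] := hfx z Oz.
by apply: (dd_congr _ oO Oz) => y Oy; have [] := hf y Oy.
Qed.
End derivatives.

Section data.
Context {R : realType}.
Implicit Types (L : arbitrary_elements R) (P : functions_TXU R).

(** The rules for the arbitrary elements with T_t and the outer U^1 cleared from the denominators.
    For the equations, [tr_B], [tr_C] and [tr_U] are the coefficients of f'_x~, w and 1 in
    [transport_eq]; modulo [tr_C], [tr_U] says that U^0 / U^1 solves the source equation. *)
Record transforms (O O' : set (base R)) L L' P : Prop := Transforms {
  tr_T : smooth_on O (fun z => pT P z.1);
  tr_X : smooth_on O (pX P);
  tr_U1 : smooth_on O (pU1 P);
  tr_U0 : smooth_on O (pU0 P);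
  tr_Tt : forall z, O z -> dd (fun y : base R => pT P y.1) (1, 0) z != 0;
  tr_Xx : forall z, O z -> dd (pX P) (0, 1) z != 0;
  tr_U1_neq0 : forall z, O z -> pU1 P z != 0;
  tr_target : forall z, O z -> O' (pT P z.1, pX P z);
  tr_A : forall z, O z -> eA L z / dd (fun y : base R => pT P y.1) (1, 0) z =
    eA L' (pT P z.1, pX P z) * ((dd (pX P) (0, 1) z)^-1 * (dd (pX P) (0, 1) z)^-1);
  tr_B : forall z, O z ->
    dd (fun y : base R => pT P y.1) (1, 0) z * eB L' (pT P z.1, pX P z) =
    dd (pX P) (0, 1) z * (eB L z - 2 * (dd (pU1 P) (0, 1) z / pU1 P z) * eA L z)
    - dd (pX P) (1, 0) z + eA L z * dd (dd (pX P) (0, 1)) (0, 1) z;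
  tr_C : forall z, O z ->
    dd (fun y : base R => pT P y.1) (1, 0) z * eC L' (pT P z.1, pX P z) * pU1 P z =
    dd (pU1 P) (1, 0) z + eC L z * pU1 P z
    - eA L z * dd (dd (pU1 P) (0, 1)) (0, 1) z
    - (eB L z - 2 * (dd (pU1 P) (0, 1) z / pU1 P z) * eA L z) * dd (pU1 P) (0, 1) z;
  tr_U : forall z, O z ->
    dd (fun y : base R => pT P y.1) (1, 0) z * eC L' (pT P z.1, pX P z) * pU0 P z =
    dd (pU0 P) (1, 0) z
    - eA L z * dd (dd (pU0 P) (0, 1)) (0, 1) z
    - (eB L z - 2 * (dd (pU1 P) (0, 1) z / pU1 P z) * eA L z) * dd (pU0 P) (0, 1) z }.
End data.

Section arithmetic.
Context {R : fieldType}.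

Lemma log_derivative_arith (u a b at_ bx : R) : u != 0 ->
  u * b * a + u * at_ = u * a * b + u * bx -> at_ = bx.
Proof. by move=> u0; rewrite -!(mulrA u) (mulrC b) => /addrI/(mulfI u0). Qed.

Lemma A_target_arith (A i A' x : R) : x != 0 ->
  A * i = A' * (x^-1 * x^-1) -> A' = A * (x * x) * i.
Proof. by move=> x0 h; rewrite mulrAC h; field. Qed.

Lemma B_target_arith (t B' x B a A xt xxx : R) : t != 0 ->
  t * B' = x * (B - 2 * a * A) - xt + A * xxx ->
  B' = t^-1 * (x * (B - 2 * a * A) - xt + A * xxx).
Proof. by move=> t0 <-; rewrite mulKf. Qed.

Lemma C_target_arith (t C' u a b ax A B C : R) : t != 0 -> u != 0 ->
  t * C' * u = u * b + C * u - A * (u * a * a + u * ax) - (B - 2 * a * A) * (u * a) ->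
  C' = t^-1 * (b + C - A * ax + A * (a * a) - B * a).
Proof.
move=> t0 u0 h; apply: (mulfI t0); apply: (mulIf u0); rewrite h.
by field.
Qed.

Lemma solution_arith (t u a b ax A B C s sx sxx st : R) : t != 0 -> u != 0 ->
  t * (t^-1 * (b + C - A * ax + A * (a * a) - B * a)) * (u * s) =
  u * (st + s * b) - A * (u * a * (sx + s * a) + u * (sxx + (sx * a + s * ax)))
  - (B - 2 * a * A) * (u * (sx + s * a)) ->
  st = A * sxx + B * sx + C * s.
Proof.
move=> t0 u0 h; apply: (mulfI u0); apply/eqP; rewrite -subr_eq0; apply/eqP.
by rewrite -(subrr (t * (t^-1 * (b + C - A * ax + A * (a * a) - B * a)) * (u * s))) {1}h; field.
Qed.

(** The field D_t + w D_x is carried to T_t (D_t~ + g~^1 D_x~) with g~^1 = (X_x w + X_t) / T_t. This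
    handles at once every combination F_x g^1 + F_t in which derivatives of coefficients occur in
    DE_1. *)
Lemma chain_arith (x xt fx ft Fx Ft Tt w : R) : Tt != 0 ->
  fx = x * Fx -> ft = Tt * Ft + xt * Fx ->
  Fx * (x * Tt^-1 * w + xt * Tt^-1) + Ft = Tt^-1 * (fx * w + ft).
Proof. by move=> t0 -> ->; field. Qed.

(** The logarithmic derivative of A' = A X_x^2 / T_t along the transformed operator, by
    [chain_arith]; its three factors give the three kinds of terms, and 1 / T_t has no
    x-derivative. *)
Lemma k_arith (A Ax At x xx xxt xt i it Tt A' A'x A't e w : R) :
  A != 0 -> x != 0 -> Tt != 0 -> i = Tt^-1 -> A' = A * (x * x) * i ->
  (Ax * (x * x) + A * (xx * x + x * xx)) * i + A * (x * x) * 0 = x * A'x ->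
  (At * (x * x) + A * (xxt * x + x * xxt)) * i + A * (x * x) * it =
    Tt * A't + xt * A'x ->
  2 * e - A'x / A' * (x * i * w + xt * i) - A't / A' =
  2 * e - i * ((Ax / A + 2 * xx / x) * w + (At / A + 2 * xxt / x + it / i)).
Proof.
move=> A0 x0 t0 iE A'E hx ht.
have A'0 : A' != 0 by rewrite A'E iE !mulf_neq0// invr_neq0.
have -> : 2 * e - A'x / A' * (x * i * w + xt * i) - A't / A' =
  2 * e - (A'x * (x * i * w + xt * i) + A't) / A' by field.
rewrite iE (chain_arith w t0 hx ht) A'E iE; field.
by rewrite A0 x0 t0 oner_neq0.
Qed.
End arithmetic.

(** * Induced transformations of the associated systems *)

Section DE1_transport_arithmetic.
Context {R : fieldType}.
Variables (i it Xx Xt Xxx Xxt Xtt Xxxx Xxxt U a ax axx b bx bxx bt : R).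
Variables (s sx sxx sxxx st sxt sxxt stt A Ax At B Bx Bt C Cx Ct : R).
Variables (w1 w2 w3 q1 q2 q3 : R).
Hypotheses (i0 : i != 0) (Xx0 : Xx != 0) (A0 : A != 0).
Local Notation A' := (A * (Xx * Xx) * i).
Local Notation B' := (i * (Xx * (B - 2 * a * A) - Xt + A * Xxx)).
Local Notation B'x := (i * (Xxx * (B - 2 * a * A) + Xx * (Bx - 2 * (ax * A + a * Ax)) - Xxt + (Ax * Xxx + A * Xxxx))).
Local Notation B't := (it * (Xx * (B - 2 * a * A) - Xt + A * Xxx) +
  i * (Xxt * (B - 2 * a * A) + Xx * (Bt - 2 * (bx * A + a * At)) - Xtt + (At * Xxx + A * Xxxt))).
Local Notation C' := (i * (b + C - A * ax + A * (a * a) - B * a)).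
Local Notation C'x := (i * (bx + Cx - (Ax * ax + A * axx) + (Ax * (a * a) + A * (ax * a + a * ax)) - (Bx * a + B * ax))).
Local Notation C't := (it * (b + C - A * ax + A * (a * a) - B * a) +
  i * (bt + Ct - (At * ax + A * bxx) + (At * (a * a) + A * (bx * a + a * bx)) - (Bt * a + B * bx))).
Local Notation k := (2 * q1 - Ax / A * w1 - At / A).
Local Notation N1 := (- B * q1 + k * (w1 + B) + Bx * w1 + 2 * A * q2 + Bt).
Local Notation N2 := (- B * q2 + k * (w2 - C) - Cx * w1 - Ct).
Local Notation N3 := (- B * q3 + k * w3 - C * w3).
(* G1, G2, G3 are the images of w1, w2, w3, and Q1, Q2, Q3 those of q under the
   homogeneous part; e1, e2, e3 are the derivatives of the images by x~. *)
Local Notation G1 := (Xx * i * w1 + Xt * i).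
Local Notation G1x := (Xxx * i * w1 + Xxt * i).
Local Notation G1xx := (Xxxx * i * w1 + Xxxt * i).
Local Notation G1t := ((Xxt * i + Xx * it) * w1 + (Xtt * i + Xt * it)).
Local Notation G2 := (a * i * w1 + i * w2 + b * i).
Local Notation G2x := (ax * i * w1 + bx * i).
Local Notation G2xx := (axx * i * w1 + bxx * i).
Local Notation G2t := ((bx * i + a * it) * w1 + it * w2 + (bt * i + b * it)).
(** The third coefficient after the shift of u by s = U^0 / U^1: g^3 gains s_t + g^1 s_x - g^2 s.
    Scaling u by U^1 and dividing by T_t then gives g~^3. *)
Local Notation V3 := (sx * w1 - s * w2 + w3 + st).
Local Notation V3x := (sxx * w1 - sx * w2 + sxt).
Local Notation V3t := (sxt * w1 - st * w2 + stt).
Local Notation V3xx := (sxxx * w1 - sxx * w2 + sxxt).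
Local Notation G3 := (U * i * V3).
Local Notation G3x := (U * i * (a * V3 + V3x)).
Local Notation G3xx := (U * i * ((ax + a * a) * V3 + 2 * a * V3x + V3xx)).
Local Notation G3t := (U * i * (b * V3 + V3t) + U * it * V3).
Local Notation Q1 := (Xx * i * q1).
Local Notation Q1x := (Xxx * i * q1).
Local Notation Q2 := (a * i * q1 + i * q2).
Local Notation Q2x := (ax * i * q1).
Local Notation Q3 := (U * i * (sx * q1 - s * q2 + q3)).
Local Notation Q3x := (U * i * (a * (sx * q1 - s * q2 + q3) + (sxx * q1 - sx * q2))).
Local Notation e1 := (Xx^-1 * (G1x + Q1)).
Local Notation e2 := (Xx^-1 * (G2x + Q2)).
Local Notation e3 := (Xx^-1 * (G3x + Q3)).
Local Notation k' := (2 * e1 - i * ((Ax / A + 2 * Xxx / Xx) * w1 + (At / A + 2 * Xxt / Xx + it / i))).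
Let comp1 :
  i * (G1t - Xx * i * N1 - Xt * e1)
  - A' * (Xx^-1 * Xx^-1 * (G1xx + 2 * Q1x - Xxx * e1))
  + (- B' * e1 + k' * (G1 + B') + i * (B'x * w1 + B't) + 2 * A' * e2) = 0.
Proof.
field.
by rewrite ?i0 ?Xx0 ?A0.
Qed.
Let comp2 :
  i * (G2t - (a * i * N1 + i * N2) - Xt * e2)
  - A' * (Xx^-1 * Xx^-1 * (G2xx + 2 * Q2x - Xxx * e2))
  + (- B' * e2 + k' * (G2 - C') - i * (C'x * w1 + C't)) = 0.
Proof.
field.
by rewrite ?i0 ?Xx0 ?A0.
Qed.
Hypothesis stE : st = A * sxx + B * sx + C * s.
Hypothesis sxtE : sxt = Ax * sxx + A * sxxx + (Bx * sx + B * sxx) + (Cx * s + C * sx).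
Hypothesis sttE : stt = At * sxx + A * sxxt + (Bt * sx + B * sxt) + (Ct * s + C * st).
(** Unlike the first two components, this one closes only modulo the source equation for s,
    differentiated once by x and once by t, since the image of g^3 contains s_t. *)
Let comp3 :
  i * (G3t - (U * i * (sx * N1 - s * N2 + N3)) - Xt * e3)
  - A' * (Xx^-1 * Xx^-1 * (G3xx + 2 * Q3x - Xxx * e3))
  + (- B' * e3 + k' * G3 - C' * G3) = 0.
Proof.
(* [stt] goes first, because its expansion contains [st] and [sxt] again. *)
rewrite sttE stE sxtE.
field.
by rewrite ?i0 ?Xx0 ?A0.
Qed.

Variables (Tt FA FAx FAt FB FBx FBt FC FCx FCt : R).
Hypotheses (Tt0 : Tt != 0) (iE : i = Tt^-1).
Hypotheses (AE : FA = A') (BE : FB = B') (CE : FC = C').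
Hypotheses (Axe : (Ax * (Xx * Xx) + A * (Xxx * Xx + Xx * Xxx)) * i +
    A * (Xx * Xx) * 0 = Xx * FAx /\
  (At * (Xx * Xx) + A * (Xxt * Xx + Xx * Xxt)) * i + A * (Xx * Xx) * it =
    Tt * FAt + Xt * FAx).
Hypotheses (Bxe : B'x = Xx * FBx /\ B't = Tt * FBt + Xt * FBx).
Hypotheses (Cxe : C'x = Xx * FCx /\ C't = Tt * FCt + Xt * FCx).
Local Notation K := (2 * e1 - FAx / FA * G1 - FAt / FA).

Let KE : K = k'.
Proof. exact: k_arith A0 Xx0 Tt0 iE AE (proj1 Axe) (proj2 Axe). Qed.

Let chainB : FBx * G1 + FBt = i * (B'x * w1 + B't).
Proof. by have := chain_arith w1 Tt0 Bxe.1 Bxe.2; rewrite -iE. Qed.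

Let chainC : FCx * G1 + FCt = i * (C'x * w1 + C't).
Proof. by have := chain_arith w1 Tt0 Cxe.1 Cxe.2; rewrite -iE. Qed.

Lemma DE1_transport1 :
  Tt^-1 * (G1t - Xx * i * N1 - Xt * e1)
  - FA * (Xx^-1 * Xx^-1 * (G1xx + 2 * Q1x - Xxx * e1))
  + (- FB * e1 + K * (G1 + FB) + FBx * G1 + 2 * FA * e2 + FBt) = 0.
Proof.
rewrite KE -iE -[RHS]comp1 -chainB AE BE.
congr (_ + _); rewrite [X in _ = X + _]addrA; exact: addrAC.
Qed.

Lemma DE1_transport2 :
  Tt^-1 * (G2t - (a * i * N1 + i * N2) - Xt * e2)
  - FA * (Xx^-1 * Xx^-1 * (G2xx + 2 * Q2x - Xxx * e2))
  + (- FB * e2 + K * (G2 - FC) - FCx * G1 - FCt) = 0.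
Proof.
rewrite KE -iE -[RHS]comp2 -chainC AE BE CE.
congr (_ + _); rewrite opprD; exact/esym/addrA.
Qed.

Lemma DE1_transport3 :
  Tt^-1 * (G3t - (U * i * (sx * N1 - s * N2 + N3)) - Xt * e3)
  - FA * (Xx^-1 * Xx^-1 * (G3xx + 2 * Q3x - Xxx * e3))
  + (- FB * e3 + K * (U * i * (sx * w1 - s * w2 + w3) + U * i * st)
    - FC * (U * i * (sx * w1 - s * w2 + w3) + U * i * st)) = 0.
Proof. by rewrite -(mulrDr _ _ st) KE -iE -[RHS]comp3 AE BE CE. Qed.
End DE1_transport_arithmetic.

Section triples.
Context {R : realType}.
Variables (O : set (base R)) (g : base R -> triple R).
Variables (f1 f1x f1t f2 f2x f2t f3 f3x f3t : base R -> R).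
Hypotheses (oO : open O) (sg : smooth_on O g).
Hypotheses (h1 : has_d O (fun y => (g y).1.1) f1x f1t).
Hypotheses (h2 : has_d O (fun y => (g y).1.2) f2x f2t).
Hypotheses (h3 : has_d O (fun y => (g y).2) f3x f3t).

Lemma dd_triple z : O z -> dd g (0, 1) z = (f1x z, f2x z, f3x z) /\
  dd g (1, 0) z = (f1t z, f2t z, f3t z).
Proof.
move=> Oz; have [_ a1 b1] := h1 Oz; have [_ a2 b2] := h2 Oz; have [_ a3 b3] := h3 Oz.
split; apply: triple_eq; rewrite -?(dd_comp11 sg)// -?(dd_comp12 sg)// -?(dd_comp2 sg)//.
Qed.

Lemma dd2_triple f1xx f1xt f2xx f2xt f3xx f3xt z : has_d O f1x f1xx f1xt ->
  has_d O f2x f2xx f2xt -> has_d O f3x f3xx f3xt -> O z ->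
  dd (dd g (0, 1)) (0, 1) z = (f1xx z, f2xx z, f3xx z).
Proof.
move=> k1 k2 k3 Oz; apply: triple_eq.
- by rewrite -(dd2_comp11 oO sg)//; exact: (has_d2 oO h1 k1 Oz).
- by rewrite -(dd2_comp12 oO sg)//; exact: (has_d2 oO h2 k2 Oz).
- by rewrite -(dd2_comp2 oO sg)//; exact: (has_d2 oO h3 k3 Oz).
Qed.
End triples.

(** * Target coefficients composed with the change of independent variables *)

Section base_change.
Context {R : realType}.
Variables (O O' : set (base R)) (T : R -> R) (X : base R -> R).
Hypotheses (oO : open O) (sT : smooth_on O (fun z => T z.1)) (sX : smooth_on O X).
Hypothesis Tt0 : forall z, O z -> dd (fun y : base R => T y.1) (1, 0) z != 0.
Hypothesis target : forall z, O z -> O' (T z.1, X z).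
Local Notation e := ((0, 1) : base R).
Local Notation t := ((1, 0) : base R).
Let Tt := dd (fun y : base R => T y.1) t.
Let i z := (Tt z)^-1.
Let phi (z : base R) : base R := (T z.1, X z).

Lemma has_d_time : has_d O i (fun=> 0) (dd i t).
Proof.
have si : smooth_on O i by apply: smooth_inv => //; exact: smooth_dd.
move=> z Oz; split => //; first exact: smooth_diff si Oz.
rewrite (_ : i = fun y : base R => (derive1 T y.1)^-1).
  exact: (dd_time (fun r => (derive1 T r)^-1)).
by apply/funext => y; rewrite /i /Tt dd_time1.
Qed.

Lemma has_d_composite (f fx ft : base R -> R) (g : base R -> R) z : O z ->
  analytic_on O' g -> has_d O f fx ft -> (forall z, O z -> g (phi z) = f z) ->
  fx z = dd X e z * dd g e (phi z) /\
  ft z = Tt z * dd g t (phi z) + dd X t z * dd g e (phi z).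
Proof.
move=> Oz ag hf gf.
have dg : differentiable g (phi z) by apply: analytic_differentiable; exact/ag/target.
have dphi : differentiable phi z.
  by apply: differentiable_pair; [exact: smooth_diff sT Oz|exact: smooth_diff sX Oz].
have dphiE v : dd phi v z = (dd (fun y : base R => T y.1) v z, dd X v z).
  by apply: dd_pair; [exact: smooth_diff sT Oz|exact: smooth_diff sX Oz].
have [_ <- <-] := hf z Oz.
rewrite -!(dd_congr _ oO Oz gf) !(dd_comp _ dphi dg) !dphiE dd_time//; split.
  by apply: ddZ => //; apply: base_eq; apply/esym; [exact: mulr0|exact: mulr1].
by apply: dd_linear2 => //; apply: base_eq; [exact: unit_arith1|exact: unit_arith2].
Qed.

Lemma has_d_target_A (A A' : base R -> R) z : O z -> analytic_on O A -> analytic_on O' A' ->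
  (forall z, O z -> A' (phi z) = A z * (dd X e z * dd X e z) * i z) ->
  ((dd A e z * (dd X e z * dd X e z) + A z * (dd (dd X e) e z * dd X e z +
      dd X e z * dd (dd X e) e z)) * i z + A z * (dd X e z * dd X e z) * 0 =
    dd X e z * dd A' e (phi z)) /\
  ((dd A t z * (dd X e z * dd X e z) + A z * (dd (dd X e) t z * dd X e z +
      dd X e z * dd (dd X e) t z)) * i z + A z * (dd X e z * dd X e z) * dd i t z =
    Tt z * dd A' t (phi z) + dd X t z * dd A' e (phi z)).
Proof.
move=> Oz aA aA' A'E; have hA : has_d O A (dd A e) (dd A t).
  by move=> y Oy; split => //; apply: analytic_differentiable; exact: aA.
have hXx := has_d_smooth (smooth_dd e sX).
exact: (has_d_composite Oz aA' (has_d_mul (has_d_mul hA (has_d_mul hXx hXx)) has_d_time) A'E).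
Qed.
End base_change.

Section DE1_transformation.
Context {R : realType}.
Variables (O O' : set (base R)) (L L' : arbitrary_elements R) (P : functions_TXU R).
Hypotheses (oO : open O) (tr : transforms O O' L L' P).
Hypotheses (eL : elements_on O L) (eL' : elements_on O' L').

Local Notation T := (pT P).
Local Notation X := (pX P).
Local Notation U := (pU1 P).
Local Notation U0 := (pU0 P).
Local Notation e := ((0, 1) : base R).
Local Notation t := ((1, 0) : base R).
(* With i, a, b and s all formulas are polynomial in the remaining data. *)
Let Tt := dd (fun y : base R => T y.1) t.
Let i z := (Tt z)^-1.
Let it := dd i t.
Let a z := dd U e z * (U z)^-1.
Let b z := dd U t z * (U z)^-1.
Let s z := U0 z * (U z)^-1.
Local Notation Xx := (dd X e).
Local Notation Xt := (dd X t).
Local Notation Xxx := (dd (dd X e) e).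
Local Notation Xxt := (dd (dd X e) t).
Local Notation Xtt := (dd (dd X t) t).
Local Notation Xxxx := (dd (dd (dd X e) e) e).
Local Notation Xxxt := (dd (dd (dd X e) e) t).
Local Notation ax := (dd a e).
Local Notation axx := (dd (dd a e) e).
Local Notation bx := (dd b e).
Local Notation bt := (dd b t).
Local Notation bxx := (dd (dd b e) e).
Local Notation sx := (dd s e).
Local Notation st := (dd s t).
Local Notation sxx := (dd (dd s e) e).
Local Notation sxt := (dd (dd s e) t).
Local Notation stt := (dd (dd s t) t).
Local Notation sxxx := (dd (dd (dd s e) e) e).
Local Notation sxxt := (dd (dd (dd s e) e) t).

Let sT := tr_T tr. Let sX := tr_X tr. Let sU := tr_U1 tr. Let sU0 := tr_U0 tr.
Let Tt0 := tr_Tt tr. Let Xx0 := tr_Xx tr. Let Un0 := tr_U1_neq0 tr.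

Let si : smooth_on O i.
Proof. by apply: smooth_inv => //; exact: smooth_dd. Qed.
Let sUV : smooth_on O (fun z => (U z)^-1).
Proof. exact: smooth_inv. Qed.
Let sa : smooth_on O a.
Proof. by apply: smooth_mul => //; exact: smooth_dd. Qed.
Let sb : smooth_on O b.
Proof. by apply: smooth_mul => //; exact: smooth_dd. Qed.
Let ss : smooth_on O s.
Proof. exact: smooth_mul. Qed.

Let i0 z : O z -> i z != 0. Proof. by move=> Oz; rewrite invr_neq0// Tt0. Qed.

Let hi : has_d O i (fun=> 0) it := has_d_time oO sT Tt0.

Let hXx : has_d O Xx Xxx Xxt := has_d_smooth (smooth_dd e sX).
Let hXt : has_d O Xt Xxt Xtt := has_d_smooth_x oO sX.
Let hXxx : has_d O Xxx Xxxx Xxxt := has_d_smooth (smooth_dd e (smooth_dd e sX)).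
Let hXxt : has_d O Xxt Xxxt (dd Xxt t) := has_d_smooth_x oO (smooth_dd e sX).

Let hU : has_d O U (fun z => U z * a z) (fun z => U z * b z).
Proof.
apply: (has_d_ext oO (has_d_smooth sU)) => // z Oz.
  by rewrite /a mulrCA mulfV ?mulr1// Un0.
by rewrite /b mulrCA mulfV ?mulr1// Un0.
Qed.

(** Both sides are the mixed second derivative of log U^1; they are compared through the two
    expressions U a and U b for the first derivatives of U^1. *)
Let bx_at z : O z -> dd a t z = bx z.
Proof.
move=> Oz; have ha := has_d_smooth sa; have hb := has_d_smooth sb.
have h1 := has_d_ext oO (has_d_smooth (smooth_dd e sU)) (g := fun z => U z * a z).
have Ue y : O y -> dd U e y = U y * a y by move=> Oy; have [] := hU Oy.
have Ut y : O y -> dd U t y = U y * b y by move=> Oy; have [] := hU Oy.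
have := dd_schwarz (@frame_real R) e t oO Oz sU.
rewrite (dd_congr _ oO Oz Ue) (dd_congr _ oO Oz Ut).
have [_ _ ->] := has_d_mul hU ha Oz.
have [_ -> _] := has_d_mul hU hb Oz.
by move=> /esym; exact: log_derivative_arith (Un0 Oz).
Qed.

Let ha : has_d O a ax bx.
Proof. by apply: (has_d_ext oO (has_d_smooth sa)) => //; exact: bx_at. Qed.

Let hax : has_d O ax axx bxx.
Proof.
apply: (has_d_ext oO (has_d_smooth (smooth_dd e sa))) => // z Oz.
rewrite (dd_schwarz (@frame_real R) _ _ oO Oz sa).
exact: (dd_congr _ oO Oz (fun y (Oy : O y) => bx_at Oy)).
Qed.

Let hb : has_d O b bx bt := has_d_smooth sb.
Let hbx : has_d O bx bxx (dd bx t) := has_d_smooth (smooth_dd e sb).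

Let hs : has_d O s sx st := has_d_smooth ss.
Let hsx : has_d O sx sxx sxt := has_d_smooth (smooth_dd e ss).
Let hsxx : has_d O sxx sxxx sxxt := has_d_smooth (smooth_dd e (smooth_dd e ss)).
Let hst : has_d O st sxt stt := has_d_smooth_x oO ss.
Let hsxt : has_d O sxt sxxt (dd sxt t) := has_d_smooth_x oO (smooth_dd e ss).

Let hU0 : has_d O U0 (fun z => U z * (sx z + s z * a z)) (fun z => U z * (st z + s z * b z)).
Proof.
apply: (has_d_ext oO (has_d_mul hs hU)) => z Oz.
- by rewrite /s divfK// Un0.
- by ring.
- by ring.
Qed.

Local Notation A := (eA L).
Local Notation B := (eB L).
Local Notation C := (eC L).

Let hL : [/\ has_d O A (dd A e) (dd A t), has_d O B (dd B e) (dd B t)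
  & has_d O C (dd C e) (dd C t)].
Proof.
by have [hA hB hC _] := eL; split => z Oz; split => //;
  apply: analytic_differentiable; [exact: hA|exact: hB|exact: hC].
Qed.

Let phi (z : base R) : base R := (T z.1, X z).

Let composite := has_d_composite oO sT sX (tr_target tr).

Let A'E z : O z -> eA L' (phi z) = A z * (Xx z * Xx z) * i z.
Proof.
move=> Oz; have := tr_A tr Oz; rewrite -/(phi z) -/(Tt z) -/(i z).
exact: A_target_arith (Xx0 Oz).
Qed.

Let B'E z : O z -> eB L' (phi z) =
  i z * (Xx z * (B z - 2 * a z * A z) - Xt z + A z * Xxx z).
Proof.
move=> Oz; have := tr_B tr Oz; rewrite -/(phi z) -/(Tt z) -/(a z).
exact: B_target_arith (Tt0 Oz).
Qed.

Let C'E z : O z -> eC L' (phi z) =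
  i z * (b z + C z - A z * ax z + A z * (a z * a z) - B z * a z).
Proof.
move=> Oz; have := tr_C tr Oz; rewrite -/(phi z) -/(Tt z) -/(a z).
rewrite (has_d2 oO hU (has_d_mul hU ha) Oz).
have [_ -> ->] := hU Oz.
exact: C_target_arith (Tt0 Oz) (Un0 Oz).
Qed.

(** [tr_U] with U^0 = U^1 s, from which [tr_C] removes the terms proportional to s coming from the
    derivatives of U^1. *)
Let stE z : O z -> st z = A z * sxx z + B z * sx z + C z * s z.
Proof.
move=> Oz; have := tr_U tr Oz; rewrite -/(phi z) -/(Tt z) -/(a z) C'E//.
rewrite (has_d2 oO hU0 (has_d_mul hU (has_d_add hsx (has_d_mul hs ha))) Oz).
have [_ -> ->] := hU0 Oz.
have -> : U0 z = U z * s z by rewrite /s mulrCA mulfV ?mulr1// Un0.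
exact: solution_arith (Tt0 Oz) (Un0 Oz).
Qed.

(** Linear part of the displayed transformation, in terms of [i], [a] and [s]; in the third row
    U^1_x drops out because s_x U^1 = U^0_x - s U^1_x. *)
Let DM (z : base R) (w : triple R) : triple R := (Xx z * i z * w.1.1,
  a z * i z * w.1.1 + i z * w.1.2,
  U z * i z * (sx z * w.1.1 - s z * w.1.2 + w.2)).
Let Dh (z : base R) : triple R := (Xt z * i z, b z * i z, U z * i z * st z).

Let hDA z : O z ->
  ((dd A e z * (Xx z * Xx z) + A z * (Xxx z * Xx z + Xx z * Xxx z)) * i z +
    A z * (Xx z * Xx z) * 0 = Xx z * dd (eA L') e (phi z)) /\
  ((dd A t z * (Xx z * Xx z) + A z * (Xxt z * Xx z + Xx z * Xxt z)) * i z +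
    A z * (Xx z * Xx z) * it z = Tt z * dd (eA L') t (phi z) + Xt z * dd (eA L') e (phi z)).
Proof.
move=> Oz; have [aA _ _ _] := eL; have [aA' _ _ _] := eL'.
exact: (has_d_target_A oO sT sX Tt0 (tr_target tr) Oz aA aA' A'E).
Qed.

Let hDB z : O z ->
  (i z * (Xxx z * (B z - 2 * a z * A z) + Xx z * (dd B e z - 2 * (ax z * A z + a z * dd A e z))
    - Xxt z + (dd A e z * Xxx z + A z * Xxxx z)) = Xx z * dd (eB L') e (phi z)) /\
  (it z * (Xx z * (B z - 2 * a z * A z) - Xt z + A z * Xxx z) +
   i z * (Xxt z * (B z - 2 * a z * A z) + Xx z * (dd B t z - 2 * (bx z * A z + a z * dd A t z))
    - Xtt z + (dd A t z * Xxx z + A z * Xxxt z)) =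
   Tt z * dd (eB L') t (phi z) + Xt z * dd (eB L') e (phi z)).
Proof.
move=> Oz; have [hA hB _] := hL; have [_ aB' _ _] := eL'.
have hV := has_d_mul hi (has_d_add (has_d_add (has_d_mul hXx (has_d_add hB
  (has_d_opp (has_d_mul (has_d_mul (has_d_cst (O := O) 2) ha) hA)))) (has_d_opp hXt))
  (has_d_mul hA hXxx)).
have [<- <-] := composite Oz aB' hV B'E.
by split; ring.
Qed.

Let hDC z : O z ->
  (i z * (bx z + dd C e z - (dd A e z * ax z + A z * axx z) +
    (dd A e z * (a z * a z) + A z * (ax z * a z + a z * ax z)) -
    (dd B e z * a z + B z * ax z)) = Xx z * dd (eC L') e (phi z)) /\
  (it z * (b z + C z - A z * ax z + A z * (a z * a z) - B z * a z) +
   i z * (bt z + dd C t z - (dd A t z * ax z + A z * bxx z) +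
    (dd A t z * (a z * a z) + A z * (bx z * a z + a z * bx z)) -
    (dd B t z * a z + B z * bx z)) =
   Tt z * dd (eC L') t (phi z) + Xt z * dd (eC L') e (phi z)).
Proof.
move=> Oz; have [hA hB hC] := hL; have [_ _ aC' _] := eL'.
have hV := has_d_mul hi (has_d_add (has_d_add (has_d_add (has_d_add hb hC)
  (has_d_opp (has_d_mul hA hax))) (has_d_mul hA (has_d_mul ha ha)))
  (has_d_opp (has_d_mul hB ha))).
have [<- <-] := composite Oz aC' hV C'E.
by split; ring.
Qed.

Let sxtE z : O z -> (sxt z = dd A e z * sxx z + A z * sxxx z +
    (dd B e z * sx z + B z * sxx z) + (dd C e z * s z + C z * sx z)) /\
  (stt z = dd A t z * sxx z + A z * sxxt z +
    (dd B t z * sx z + B z * sxt z) + (dd C t z * s z + C z * st z)).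
Proof.
move=> Oz; have [hA hB hC] := hL.
have hV := has_d_add (has_d_add (has_d_mul hA hsxx) (has_d_mul hB hsx)) (has_d_mul hC hs).
have [_ <- <-] := hV z Oz; have [_ <- <-] := hst Oz.
by split; apply: (dd_congr _ oO Oz stE).
Qed.

Let sXx : smooth_on O Xx := smooth_dd e sX.
Let sXt : smooth_on O Xt := smooth_dd t sX.

Let sDM w : smooth_on O (fun z => DM z w).
Proof.
have sc (c : R) : smooth_on O (fun=> c) by exact: smooth_cst.
have sse : smooth_on O sx := smooth_dd e ss.
apply: smooth_pair => //; first apply: smooth_pair => //.
- by do 2 (apply: smooth_mul => //).
- by apply: smooth_add => //; do 2?(apply: smooth_mul => //).
- apply: smooth_mul => //; first exact: smooth_mul.
  apply: smooth_add => //; apply: smooth_add => //; first exact: smooth_mul.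
  by apply: smooth_opp => //; exact: smooth_mul.
Qed.

Let sDh : smooth_on O Dh.
Proof.
have sst : smooth_on O st := smooth_dd t ss.
apply: smooth_pair => //; first apply: smooth_pair => //.
- exact: smooth_mul.
- exact: smooth_mul.
- by apply: smooth_mul => //; exact: smooth_mul.
Qed.

Let fibredD : fibred O T X DM Dh.
Proof.
split => // z c d u v Oz; apply: triple_eq; rewrite /DM /= !scaleE.
- by ring.
- by ring.
- by ring.
Qed.

Let bijD z : O z -> bijective (DM z).
Proof.
move=> Oz; have i1 := i0 Oz; have x1 := Xx0 Oz; have u1 := Un0 Oz.
exists (fun m : triple R =>
  let w1 := m.1.1 / (Xx z * i z) in
  let w2 := (m.1.2 - a z * i z * w1) / i z in
  (w1, w2, m.2 / (U z * i z) - sx z * w1 + s z * w2)) => m; apply: triple_eq; rewrite /DM /=.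
all: by field; rewrite ?i1 ?x1 ?u1.
Qed.

(** Used where only the x-derivative is wanted in closed form; the t-derivative stays
    unevaluated. *)
Let has_dx f fx ft gx : has_d O f fx ft -> (forall z, O z -> fx z = gx z) ->
  has_d O f gx (dd f t).
Proof. by move=> hf fg z Oz; have [df fe _] := hf z Oz; split => //; rewrite fe fg. Qed.

Section transport.
Variables w q : triple R.
Let V3 z := sx z * w.1.1 - s z * w.1.2 + w.2 + st z.
Let V3x z := sxx z * w.1.1 - sx z * w.1.2 + sxt z.
Let V3t z := sxt z * w.1.1 - st z * w.1.2 + stt z.
Let V3xx z := sxxx z * w.1.1 - sxx z * w.1.2 + sxxt z.

Let hc (c : R) : has_d O (fun=> c) (fun=> 0) (fun=> 0) := has_d_cst (O := O) c.

Let hV3 : has_d O V3 V3x V3t.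
Proof.
apply: (has_d_ext oO (has_d_add (has_d_add (has_d_add (has_d_mul hsx (hc w.1.1))
  (has_d_opp (has_d_mul hs (hc w.1.2)))) (hc w.2)) hst)) => // z Oz.
- by rewrite /V3x; ring.
- by rewrite /V3t; ring.
Qed.

Let hV3x : has_d O V3x V3xx (dd V3x t).
Proof.
apply: (has_dx (has_d_add (has_d_add (has_d_mul hsxx (hc w.1.1))
  (has_d_opp (has_d_mul hsx (hc w.1.2)))) hsxt)) => // z Oz.
by rewrite /V3xx; ring.
Qed.

Let g z := DM z w + Dh z.

Let g1x z := Xxx z * i z * w.1.1 + Xxt z * i z.
Let g2x z := ax z * i z * w.1.1 + bx z * i z.
Let g3x z := U z * i z * (a z * V3 z + V3x z).

Let h1 : has_d O (fun y => (g y).1.1) g1x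
  (fun z => (Xxt z * i z + Xx z * it z) * w.1.1 + (Xtt z * i z + Xt z * it z)).
Proof.
apply: (has_d_ext oO (has_d_add (has_d_mul (has_d_mul hXx hi) (hc w.1.1)) (has_d_mul hXt hi))) => // z Oz.
- by rewrite /g1x; ring.
- by ring.
Qed.

Let h2 : has_d O (fun y => (g y).1.2) g2x
  (fun z => (bx z * i z + a z * it z) * w.1.1 + it z * w.1.2 + (bt z * i z + b z * it z)).
Proof.
apply: (has_d_ext oO (has_d_add (has_d_add (has_d_mul (has_d_mul ha hi) (hc w.1.1))
  (has_d_mul hi (hc w.1.2))) (has_d_mul hb hi))) => // z Oz.
- by rewrite /g2x; ring.
- by ring.
Qed.

Let h3 : has_d O (fun y => (g y).2) g3x
  (fun z => U z * i z * (b z * V3 z + V3t z) + U z * it z * V3 z).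
Proof.
apply: (has_d_ext oO (has_d_mul (has_d_mul hU hi) hV3)) => z Oz.
- by rewrite /V3 mulrDr.
- by rewrite /g3x; ring.
- by ring.
Qed.

Let h1x : has_d O g1x (fun z => Xxxx z * i z * w.1.1 + Xxxt z * i z) (dd g1x t).
Proof.
apply: (has_dx (has_d_add (has_d_mul (has_d_mul hXxx hi) (hc w.1.1)) (has_d_mul hXxt hi))) => z Oz.
by ring.
Qed.

Let h2x : has_d O g2x (fun z => axx z * i z * w.1.1 + bxx z * i z) (dd g2x t).
Proof.
apply: (has_dx (has_d_add (has_d_mul (has_d_mul hax hi) (hc w.1.1)) (has_d_mul hbx hi))) => z Oz.
by ring.
Qed.

Let h3x : has_d O g3x (fun z => U z * i z * ((ax z + a z * a z) * V3 z + 2 * a z * V3x z + V3xx z)) (dd g3x t).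
Proof.
apply: (has_dx (has_d_mul (has_d_mul hU hi) (has_d_add (has_d_mul ha hV3) hV3x))) => z Oz.
by ring.
Qed.

Let q1 : has_d O (fun y => (DM y q).1.1) (fun z => Xxx z * i z * q.1.1) (dd (fun y => (DM y q).1.1) t).
Proof.
apply: (has_dx (has_d_mul (has_d_mul hXx hi) (hc q.1.1))) => z Oz.
by ring.
Qed.

Let q2 : has_d O (fun y => (DM y q).1.2) (fun z => ax z * i z * q.1.1) (dd (fun y => (DM y q).1.2) t).
Proof.
apply: (has_dx (has_d_add (has_d_mul (has_d_mul ha hi) (hc q.1.1)) (has_d_mul hi (hc q.1.2)))) => z Oz.
by ring.
Qed.

Let q3 : has_d O (fun y => (DM y q).2) (fun z => U z * i z * (a z * (sx z * q.1.1 - s z * q.1.2 + q.2) +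
   (sxx z * q.1.1 - sx z * q.1.2))) (dd (fun y => (DM y q).2) t).
Proof.
apply: (has_dx (has_d_mul (has_d_mul hU hi) (has_d_add (has_d_add (has_d_mul hsx (hc q.1.1))
  (has_d_opp (has_d_mul hs (hc q.1.2)))) (hc q.2)))) => z Oz.
by ring.
Qed.

Lemma DE1_transport z : O z -> transport_eq (eA L') (DE1_rest L) (DE1_rest L') T X DM Dh z w q.
Proof.
move=> Oz; have sg : smooth_on O g by exact: smooth_add.
have [gx gt] := dd_triple sg h1 h2 h3 Oz.
have gxx := dd2_triple oO sg h1 h2 h3 h1x h2x h3x Oz.
have [qx _] := dd_triple (sDM q) q1 q2 q3 Oz.
rewrite /transport_eq gx gt gxx qx.
have A0 : A z != 0 by have [_ _ _] := eL; exact.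
have iE : i z = (Tt z)^-1 by [].
have [sxt1 stt1] := sxtE Oz.
apply: triple_eq.
- exact: (DE1_transport1 w.1.1 q.1.1 q.1.2 (i0 Oz) (Xx0 Oz) A0 (Tt0 Oz) iE (A'E Oz) (B'E Oz) (hDA Oz) (hDB Oz)).
- exact: (DE1_transport2 w.1.1 w.1.2 q.1.1 q.1.2 (i0 Oz) (Xx0 Oz) A0 (Tt0 Oz) iE (A'E Oz) (B'E Oz) (C'E Oz) (hDA Oz) (hDC Oz)).
- exact: (DE1_transport3 (U z) w.1.1 w.1.2 w.2 q.1.1 q.1.2 q.2 (i0 Oz) (Xx0 Oz) A0 (stE Oz) sxt1 stt1 (Tt0 Oz) iE (A'E Oz) (B'E Oz) (C'E Oz) (hDA Oz)).
Qed.
End transport.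

Let transfDE1_map p : O p.1 -> fibred_map T X DM Dh p = transfDE1 P p.
Proof.
move=> Oz; have [_ Ux Ut] := hU Oz; have [_ sx0 st0] := hU0 Oz.
have u0 := Un0 Oz; have t0 := Tt0 Oz.
rewrite /transfDE1 pdxE !pdtE !pdxE -dd_time1 Ux Ut sx0 st0.
have sE : U0 p.1 = U p.1 * s p.1 by rewrite /s mulrCA mulfV ?mulr1.
congr (_, _); apply: triple_eq; rewrite /DM /Dh /= /i -/(Tt p.1) ?sE.
- by rewrite mulrAC.
- by field; rewrite u0 t0.
- by field; rewrite u0 t0.
Qed.

Lemma transforms_DE1 : @convex_set R (base R) O ->
  admissible (@class_DE1 R) O O' (O `*` setT)
    (Transformation (DE1 L) (DE1 L') (transfDE1 P)).
Proof.
move=> cO; have oV := open_cylinder (W := triple R) oO.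
have mapE p : (O `*` setT) p -> fibred_map T X DM Dh p = transfDE1 P p.
  by move=> [Op _]; exact: transfDE1_map.
split => //=.
- by exists L.
- by exists L'.
- split => //; first exact: convex_cylinder.
    exact: fst_cylinder.
  by move=> p [Op _]; exact: (tr_target tr Op).
- exact: point_transformation_congr oV mapE (point_transformation_fibred fr_triple oO fibredD bijD cO).
apply: (maps_pde_congr oV mapE).
have m := maps_fibred fr_triple oO fibredD bijD (tr_A tr) (fun z w q => @DE1_transport w q z).
move=> f f' z sf sf' Vz pr.
exact: iff_trans (DE1_evol L z sf) (iff_trans (m f f' z sf sf' Vz pr)
  (iff_sym (DE1_evol L' _ sf'))).
Qed.

(** Exports the linear and inhomogeneous parts abstractly, for comparison with those extracted from
    an arbitrary admissible transformation of the systems. *)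
Lemma transfDE1_fibred : exists M h, [/\ fibred O T X M h,
    forall p, O p.1 -> fibred_map T X M h p = transfDE1 P p &
    forall z w q, O z ->
      transport_eq (eA L') (DE1_rest L) (DE1_rest L') T X M h z w q].
Proof.
exists DM, Dh; split; [exact: fibredD|exact: transfDE1_map|].
by move=> z w q; exact: DE1_transport.
Qed.
End DE1_transformation.

(** * Transformations of the equations *)

Section parabolic_arithmetic.
Context {R : fieldType}.
Variables (Tt Xx Xt Xxx u ux ut uxx v vx vt vxx A A' B B' C C' : R).
Hypotheses (t0 : Tt != 0) (x0 : Xx != 0) (u0 : u != 0).
Hypothesis AE : A / Tt = A' * (Xx^-1 * Xx^-1).
Local Notation be w q := (Xx^-1 * (ux * w + vx + u * q)).
Local Notation a := (ux / u).
Local Notation E w q := (Tt^-1 * (ut * w + vt - u * (- B * q - C * w) - Xt * be w q)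
  - A' * (Xx^-1 * Xx^-1 * (uxx * w + vxx + 2 * (ux * q) - Xxx * be w q))
  + (- B' * be w q - C' * (u * w + v))).
Local Notation SB := (Tt * B' - (Xx * (B - 2 * a * A) - Xt + A * Xxx)).
Local Notation SC := (Tt * C' * u - (ut + C * u - A * uxx - (B - 2 * a * A) * ux)).
Local Notation SV := (Tt * C' * v - (vt - A * vxx - (B - 2 * a * A) * vx)).

(** The equation splits along [be], [w] and 1, which vary independently with [q] and [w]; the three
    coefficients are the defects of the rules for B, C and U^0. *)
Let EE w q : Tt * E w q = - SB * be w q - SC * w - SV.
Proof.
set b := be w q.
have pE : Xx * b = ux * w + vx + u * q by rewrite /b mulrA mulfV// mul1r.
set D := uxx * w + vxx + 2 * (ux * q) - Xxx * b.
transitivity (ut * w + vt - u * (- B * q - C * w) - Xt * b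
   - Tt * (A' * (Xx^-1 * Xx^-1)) * D - Tt * B' * b - Tt * C' * u * w - Tt * C' * v).
  by field; rewrite t0 x0.
rewrite -AE.
transitivity (- (Tt * B' + Xt - A * Xxx) * b + (B - 2 * a * A) * (ux * w + vx + u * q)
   - SC * w - SV).
  by rewrite /D; field; rewrite t0 u0.
by rewrite -pE; ring.
Qed.

Lemma parabolic_transport_arith w q : SB = 0 -> SC = 0 -> SV = 0 -> E w q = 0.
Proof.
move=> BE CE VE; apply: (mulfI t0); rewrite mulr0 EE BE CE VE.
by ring.
Qed.

(** Changing [q] at fixed [w] varies [be] alone and gives [SB = 0]; then two values of [w] separate
    [SC] from [SV]. *)
Lemma parabolic_transport_inv w w' : w != w' ->
  E w 0 = 0 -> E w 1 = 0 -> E w' 0 = 0 -> [/\ SB = 0, SC = 0 & SV = 0].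
Proof.
move=> ww' /(congr1 ( *%R Tt)) + /(congr1 ( *%R Tt)) + /(congr1 ( *%R Tt)).
rewrite !EE !(mulr0 Tt) => E0 E1 E2.
have SB0 : SB = 0.
  have : SB * (Xx^-1 * u) = 0.
    transitivity ((- SB * be w 0 - SC * w - SV) - (- SB * be w 1 - SC * w - SV)).
      by ring.
    by rewrite E0 E1 subr0.
  move=> /eqP; rewrite !mulf_eq0 invr_eq0 (negbTE x0) (negbTE u0) !orbF.
  by move=> /eqP.
move: E0 E2; rewrite SB0 oppr0 !mul0r !sub0r => E0 E2.
have SC0 : SC = 0.
  have : SC * (w' - w) = 0.
    transitivity ((- (SC * w) - SV) - (- (SC * w') - SV)); first by ring.
    by rewrite E0 E2 subr0.
  by move=> /eqP; rewrite mulf_eq0 => /orP[/eqP //|]; rewrite subr_eq0 eq_sym (negbTE ww').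
by split=> //; move/eqP: E0; rewrite SC0 mul0r oppr0 sub0r oppr_eq0 => /eqP.
Qed.
End parabolic_arithmetic.

(** Over the line M is multiplication by [U]; all derivatives of M w + h are spelled out, so that
    [parabolic_transport_arith] and its converse apply. *)
Lemma parabolic_transportE (R : realType) (O : set (base R)) (L L' : arbitrary_elements R)
    (T : R -> R) (X : base R -> R) (M : base R -> R -> R) (U h : base R -> R)
    (z : base R) (w q : R) :
  open O -> smooth_on O U -> smooth_on O h -> (forall y v, O y -> M y v = U y * v) -> O z ->
  let be := (dd X (0, 1) z)^-1 * (dd U (0, 1) z * w + dd h (0, 1) z + U z * q) in
  transport_eq (eA L') (parabolic_rest L) (parabolic_rest L') T X M h z w q <->
  (dd (fun y : base R => T y.1) (1, 0) z)^-1 *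
    (dd U (1, 0) z * w + dd h (1, 0) z - U z * (- eB L z * q - eC L z * w) - dd X (1, 0) z * be)
  - eA L' (T z.1, X z) * ((dd X (0, 1) z)^-1 * (dd X (0, 1) z)^-1 *
      (dd (dd U (0, 1)) (0, 1) z * w + dd (dd h (0, 1)) (0, 1) z + 2 * (dd U (0, 1) z * q)
        - dd (dd X (0, 1)) (0, 1) z * be))
  + (- eB L' (T z.1, X z) * be - eC L' (T z.1, X z) * (U z * w + h z)) = 0.
Proof.
move=> oO sU sh ME Oz; cbv zeta; have hc (c : R) := has_d_cst (O := O) c.
have hU := has_d_smooth sU; have hh := has_d_smooth sh.
have hUx := has_d_smooth (smooth_dd ((0, 1) : base R) sU).
have hhx := has_d_smooth (smooth_dd ((0, 1) : base R) sh).
have hg : has_d O (fun y => M y w + h y) (fun y => dd U (0, 1) y * w + dd h (0, 1) y)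
    (fun y => dd U (1, 0) y * w + dd h (1, 0) y).
  apply: (has_d_ext oO (has_d_add (has_d_mul hU (hc w)) hh)) => y Oy.
  - by rewrite ME.
  - by ring.
  - by ring.
have [_ gx gt] := hg z Oz.
have gxx : dd (dd (fun y => M y w + h y) (0, 1)) (0, 1) z =
    dd (dd U (0, 1)) (0, 1) z * w + dd (dd h (0, 1)) (0, 1) z.
  rewrite (has_d2 oO hg (has_d_add (has_d_mul hUx (hc w)) hhx) Oz).
  by ring.
have qx : dd (fun y => M y q) (0, 1) z = dd U (0, 1) z * q.
  rewrite (dd_congr _ oO Oz (fun y Oy => ME y q Oy)).
  by have [_ -> _] := has_d_mul hU (hc q) Oz; ring.
by rewrite /transport_eq gx gt gxx qx /parabolic_rest !scaleE !(ME z _ Oz).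
Qed.

Section parabolic_transformation.
Context {R : realType}.
Variables (O O' : set (base R)) (L L' : arbitrary_elements R) (P : functions_TXU R).
Hypotheses (oO : open O) (tr : transforms O O' L L' P).
Hypotheses (eL : elements_on O L) (eL' : elements_on O' L').

Local Notation T := (pT P).
Local Notation X := (pX P).
Local Notation U := (pU1 P).
Local Notation U0 := (pU0 P).
Local Notation e := ((0, 1) : base R).
Local Notation t := ((1, 0) : base R).
Let M (z : base R) (w : R) : R := U z * w.
Let sU := tr_U1 tr. Let sU0 := tr_U0 tr.

Let sM w : smooth_on O (fun z => M z w).
Proof. by apply: smooth_mul => //; exact: smooth_cst. Qed.

Let F : fibred O T X M U0.
Proof.
split => //; [exact: tr_T tr|exact: tr_X tr| |exact: tr_Tt tr|exact: tr_Xx tr].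
by move=> z c d u v Oz; rewrite /M !scaleE; ring.
Qed.

Let bijM z : O z -> bijective (M z).
Proof.
move=> Oz; have u0 := tr_U1_neq0 tr Oz.
by exists (fun w => w / U z) => w; rewrite /M; field.
Qed.

Lemma parabolic_transport z w q : O z ->
  transport_eq (eA L') (parabolic_rest L) (parabolic_rest L') T X M U0 z w q.
Proof.
move=> Oz; apply: (parabolic_transportE L L' T X w q oO sU sU0 (fun _ _ _ => erefl) Oz).2.
apply: (parabolic_transport_arith (tr_Tt tr Oz) (tr_Xx tr Oz) (tr_U1_neq0 tr Oz)
  (tr_A tr Oz)); apply/eqP; rewrite subr_eq0; apply/eqP.
- exact: (tr_B tr Oz).
- exact: (tr_C tr Oz).
- exact: (tr_U tr Oz).
Qed.

Lemma transforms_parabolic : @convex_set R (base R) O ->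
  admissible (@class_L R) O O' (O `*` setT)
    (Transformation (parabolic L) (parabolic L') (transfL P)).
Proof.
move=> cO; have oV := open_cylinder (W := R) oO.
have mapE p : (O `*` setT) p -> fibred_map T X M U0 p = transfL P p by [].
split => //=.
- by exists L.
- by exists L'.
- split => //; first exact: convex_cylinder.
    exact: fst_cylinder.
  by move=> p [Op _]; exact: (tr_target tr Op).
- exact: point_transformation_congr oV mapE
    (point_transformation_fibred (@frame_real R) oO F bijM cO).
apply: (maps_pde_congr oV mapE).
have m := maps_fibred (@frame_real R) oO F bijM (tr_A tr) parabolic_transport.
move=> f f' z sf sf' Vz pr.
exact: iff_trans (parabolic_evol L f z) (iff_trans (m f f' z sf sf' Vz pr)
  (iff_sym (parabolic_evol L' f' _))).
Qed.
End parabolic_transformation.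

(** Fibres of the domain may be small. Coefficients of expressions polynomial in w are therefore
    read off from two points of a fibre differing by a small nonzero multiple of a prescribed
    vector. *)
Lemma open_fibre (R : realType) (V W : normedModType R) (D : set (V * W)) z w m :
  open D -> D (z, w) -> exists2 c : R, c != 0 & D (z, w + c *: m).
Proof.
move=> oD Dz.
have cont : {for 0, continuous (fun c : R => (z, w + c *: m))}.
  apply: cvg_pair; first exact: cvg_cst.
  by apply: cvgD; [exact: cvg_cst|apply: cvgZr_tmp; exact: cvg_id].
have nD : nbhs ((z, w + 0 *: m) : V * W) D by apply: open_nbhs_nbhs; split; rewrite ?scale0r ?addr0.
have := cont _ nD; rewrite /= => n0.
have : \forall c \near (0 : R)^', c != 0 /\ D (z, w + c *: m).
  near=> c; split; first by near: c; exact: nbhs_dnbhs_neq.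
  by near: c; exact: nbhs_dnbhs n0.
by move=> /filter_ex[c [c0 Dc]]; exists c.
Unshelve. all: by end_near. Qed.

Section from_parabolic.
Context {R : realType}.
Variables (O O' : set (base R)) (V : set (base R * R)) (a : transformation R).
Variables (L L' : arbitrary_elements R).
Hypotheses (oO : open O) (adm : admissible (@class_L R) O O' V a).
Hypotheses (eL : elements_on O L) (eL' : elements_on O' L').
Hypotheses (SL : same_pde O (source a) (parabolic L)).
Hypotheses (SL' : same_pde O' (target a) (parabolic L')).
Local Notation e := ((0, 1) : base R).
Local Notation t := ((1, 0) : base R).

(** In the fibre form U^1 is [M z 1] and U^0 is [h]; two values of w in each fibre turn
    [transport_eq] into the three rules. *)
Lemma transforms_of_parabolic : exists2 P, transforms O O' L L' P &
  forall p, V p -> tmap a p = transfL P p.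
Proof.
have [_ _ [oV cV OV VO'] [sPhi _ bij] maps] := adm.
have VO p : V p -> O p.1 by move=> Vp; rewrite -OV; exists p.
have ne p : V p -> eA L p.1 != 0 by move=> /VO; have [_ _ _] := eL; exact.
have ne' p : V p -> eA L' (tmap a p).1 != 0 by move=> /VO'; have [_ _ _] := eL'; exact.
have maps1 : maps_pde V (tmap a) (evol (eA L) (parabolic_rest L)) (evol (eA L') (parabolic_rest L')).
  have m := maps_pde_same VO VO' SL SL' maps.
  move=> f f' z sf sf' Vz pr.
  exact: iff_trans (iff_sym (parabolic_evol L f z)) (iff_trans (m f f' z sf sf' Vz pr)
    (parabolic_evol L' f' _)).
have [T [X [M [h [F mapE Minj AE trE]]]]] := fibre_form (@frame_real R) (oner_neq0 R) oV sPhi bij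
  maps1 ne ne' (parabolic_midpoint L) (parabolic_midpoint L') cV OV.
pose U z := M z 1.
have ME z w : O z -> M z w = U z * w.
  move=> Oz; have := fibred_lin F w 0 1 0 Oz.
  by rewrite scaler0 addr0 scaleE mulr1 => ->; rewrite scale0r addr0 scaleE mulrC.
have U0 z : O z -> U z != 0.
  by move=> Oz; apply/eqP => /(Minj z 1 Oz)/eqP; rewrite oner_eq0.
have formulas z : O z -> [/\
    dd (fun y : base R => T y.1) t z * eB L' (T z.1, X z) -
    (dd X e z * (eB L z - 2 * (dd U e z / U z) * eA L z) - dd X t z + eA L z * dd (dd X e) e z) = 0,
    dd (fun y : base R => T y.1) t z * eC L' (T z.1, X z) * U z -
    (dd U t z + eC L z * U z - eA L z * dd (dd U e) e z
      - (eB L z - 2 * (dd U e z / U z) * eA L z) * dd U e z) = 0 &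
    dd (fun y : base R => T y.1) t z * eC L' (T z.1, X z) * h z -
    (dd h t z - eA L z * dd (dd h e) e z
      - (eB L z - 2 * (dd U e z / U z) * eA L z) * dd h e z) = 0].
  move=> Oz; have [w Vw] : exists w, V (z, w).
    by move: Oz; rewrite -OV => -[[y w] Vy /= <-]; exists w.
  have [c c0 Vc] := open_fibre (1 : R^o) oV Vw.
  have sU : smooth_on O U := fibred_M F 1.
  have key v q (Vv : V (z, v)) :=
    (parabolic_transportE L L' T X v q oO sU (fibred_h F) ME Oz).1 (trE z v q Vv).
  have ww' : w != w + c *: (1 : R^o) by rewrite eq_sym addrC -subr_eq0 addrK scaler_eq0 (negbTE c0) oner_eq0.
  apply: (parabolic_transport_inv (fibred_Tt F Oz) (fibred_Xx F Oz) (U0 z Oz) (AE z Oz) ww').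
  - exact: key.
  - exact: key.
  - exact: key.
exists (FunctionsTXU T X U h); last first.
  by move=> [z w] Vz; rewrite mapE// (ME z w (VO _ Vz)).
split=> //=; [exact: fibred_T F|exact: fibred_X F|exact: fibred_M F 1|exact: fibred_h F
  |exact: fibred_Tt F|exact: fibred_Xx F| |move=> z Oz|move=> z Oz|move=> z Oz].
- move=> z; rewrite -OV => -[[y w] Vy /= <-].
  by have := VO' _ Vy; rewrite mapE.
all: have [f1 f2 f3] := formulas z Oz; apply/eqP; rewrite -subr_eq0; apply/eqP; assumption.
Qed.
End from_parabolic.

(** * Transformations of the associated systems *)

Section gradient_part.
Context {R : realType}.
Implicit Types L : arbitrary_elements R.

(** The part of N linear in f_x and free of f. What else depends on f_x is the term 2 g^1_x g, of
    the same form in all three rows. *)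
Definition DE1_slope L (z : base R) (q : triple R) : triple R :=
  (eB L z * q.1.1 + 2 * eA L z * q.1.2, - eB L z * q.1.2 - 2 * eC L z * q.1.1,
   - eB L z * q.2).

Lemma slope_arith1 (B b q r w s x A b2 q2 t : R) :
  - B * (b + q) + (2 * (b + q) - r * w - s) * (w + B) + x * w + 2 * A * (b2 + q2) + t =
  - B * b + (2 * b - r * w - s) * (w + B) + x * w + 2 * A * b2 + t
    + (B * q + 2 * A * q2) + 2 * q * w.
Proof. by ring. Qed.

Lemma slope_arith2 (B b q r w s x C b2 q2 t w2 : R) :
  - B * (b2 + q2) + (2 * (b + q) - r * w - s) * (w2 - C) - x * w - t =
  - B * b2 + (2 * b - r * w - s) * (w2 - C) - x * w - t
    + (- B * q2 - 2 * C * q) + 2 * q * w2.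
Proof. by ring. Qed.

Lemma slope_arith3 (B b q r w s C b3 q3 w3 : R) :
  - B * (b3 + q3) + (2 * (b + q) - r * w - s) * w3 - C * w3 =
  - B * b3 + (2 * b - r * w - s) * w3 - C * w3 + (- B * q3) + 2 * q * w3.
Proof. by ring. Qed.

Lemma DE1_restD L z w b q : DE1_rest L z w (b + q) =
  DE1_rest L z w b + DE1_slope L z q + (2 * q.1.1) *: w.
Proof.
apply: triple_eq.
- exact: slope_arith1.
- exact: slope_arith2.
- exact: slope_arith3.
Qed.

Lemma gradient_part_arith (i gt n0 mp c mw Xt xi gx mq A' S gxx mxq Xxx n' p' c' hh : R) :
  i * (gt + - (n0 + mp + c * mw) + - (Xt * (xi * (gx + mq)))) +
    - (A' * (S * (gxx + 2 * mxq + - (Xxx * (xi * (gx + mq)))))) +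
    (n' + p' + c' * (mw + hh)) = 0 ->
  i * (gt + - n0 + - (Xt * (xi * (gx + 0)))) +
    - (A' * (S * (gxx + 2 * 0 + - (Xxx * (xi * (gx + 0)))))) + n' = 0 ->
  - (i * mp) + - ((i * Xt) * (xi * mq)) + - ((2 * (A' * S)) * mxq)
    + ((A' * S) * Xxx) * (xi * mq) + p' + (c' - i * c) * mw + c' * hh = 0.
Proof. by move=> E1 E0; rewrite -[RHS](subrr 0) -{1}E1 -E0; ring. Qed.

Lemma summand_eq0 (U : zmodType) (a b c d : U) : a + b + d = 0 -> a + (b + c) + d = 0 -> c = 0.
Proof. by move=> E0; rewrite addrA (addrAC _ c) E0 add0r. Qed.

Lemma second_row_arith (i x A A' m B B' d p r s c h : R) :
  i != 0 -> x != 0 -> A != 0 -> A * i = A' * (x^-1 * x^-1) ->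
  - (i * (x * i * (B * 0 + 2 * A * d))) - p * (x^-1 * (x * i * 0)) - r * (c * i * 0)
    + s * (x^-1 * (x * i * 0)) + (B' * (x^-1 * (x * i * 0)) + 2 * A' * (x^-1 * m))
    + 2 * (x^-1 * (x * i * 0)) * h = 0 -> m = i * d.
Proof.
move=> i0 x0 A0 AE E.
have : 2 * A * i * x * (m - i * d) = 0.
  have -> : 2 * A * i * x * (m - i * d) = 2 * (A * i) * x * m - 2 * A * i * x * (i * d) by ring.
  rewrite AE -[RHS]E; field.
  by rewrite x0.
by move=> /eqP; rewrite !mulf_eq0 pnatr_eq0 (negbTE i0) (negbTE x0) (negbTE A0) /= subr_eq0 => /eqP.
Qed.

Lemma tr_B_arith (t i x xt xxx u ux A B B' C m31 m32 h : R) :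
  t != 0 -> i = t^-1 -> x != 0 -> u != 0 ->
  - (i * ((B * 0 + 2 * A * 0) * m31 + ((- B * 0 - 2 * C * 0) * m32 + (- B * 1) * (i * u))))
    - (i * xt) * (x^-1 * (i * u)) - (2 * (A * i)) * (i * ux)
    + (A * i * xxx) * (x^-1 * (i * u)) + (- B' * (x^-1 * (i * u)))
    + (2 * (x^-1 * (x * i * 0))) * h = 0 ->
  t * B' = x * (B - 2 * (ux / u) * A) - xt + A * xxx.
Proof.
move=> t0 -> x0 u0 E; apply/eqP; rewrite eq_sym -subr_eq0; apply/eqP.
transitivity (t * t * x / u * 0); last by rewrite mulr0.
by rewrite -[X in _ = _ * X]E; field; rewrite t0 x0 u0.
Qed.

Lemma M21_arith (t i x xt xxx u ux A B B' C C' m21 h : R) :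
  t != 0 -> i = t^-1 -> x != 0 -> u != 0 -> A != 0 ->
  t * B' = x * (B - 2 * (ux / u) * A) - xt + A * xxx ->
  - (i * ((B * 0 + 2 * A * 1) * m21 + ((- B * 1 - 2 * C * 0) * i + (- B * 0) * 0)))
    - (i * xt) * (x^-1 * i) - (2 * (A * i)) * 0 + (A * i * xxx) * (x^-1 * i)
    + (- B' * (x^-1 * i) - 2 * C' * (x^-1 * (x * i * 0)))
    + (2 * (x^-1 * (x * i * 0))) * h = 0 ->
  m21 = ux / u * i.
Proof.
move=> t0 -> x0 u0 A0 /(B_target_arith t0) -> E.
apply/eqP; rewrite eq_sym -subr_eq0; apply/eqP.
transitivity (t / (2 * A) * 0); last by rewrite mulr0.
by rewrite -[X in _ = _ * X]E; field; rewrite t0 x0 u0 A0.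
Qed.

Lemma M31_arith (t i x xt xxx u ux v vx A B B' C m31 h : R) :
  t != 0 -> i = t^-1 -> x != 0 -> u != 0 -> A != 0 ->
  t * B' = x * (B - 2 * (ux / u) * A) - xt + A * xxx ->
  - (i * ((B * 0 + 2 * A * 1) * m31 + ((- B * 1 - 2 * C * 0) * (- (i * v)) + (- B * 0) * (i * u))))
    - (i * xt) * (x^-1 * (- (i * v))) - (2 * (A * i)) * (- (i * vx))
    + (A * i * xxx) * (x^-1 * (- (i * v))) + (- B' * (x^-1 * (- (i * v))))
    + (2 * (x^-1 * (x * i * 0))) * h = 0 ->
  m31 = i * (vx - ux / u * v).
Proof.
move=> t0 -> x0 u0 A0 /(B_target_arith t0) -> E.
apply/eqP; rewrite eq_sym -subr_eq0; apply/eqP.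
transitivity (t / (2 * A) * 0); last by rewrite mulr0.
by rewrite -[X in _ = _ * X]E; field; rewrite t0 x0 u0 A0.
Qed.

Lemma h1_arith (t i x xt xxx u ux A A' B B' h : R) :
  t != 0 -> i = t^-1 -> x != 0 -> u != 0 -> A' = A * (x * x) * i ->
  t * B' = x * (B - 2 * (ux / u) * A) - xt + A * xxx ->
  - (i * (x * i * (B * 1 + 2 * A * 0))) - (i * xt) * (x^-1 * (x * i * 1))
    - (2 * (A * i)) * (xxx * i * 1) + (A * i * xxx) * (x^-1 * (x * i * 1))
    + (B' * (x^-1 * (x * i * 1)) + 2 * A' * (x^-1 * (ux / u * i)))
    + (2 * (x^-1 * (x * i * 1))) * h = 0 ->
  h = xt * i.
Proof.
move=> t0 -> x0 u0 -> /(B_target_arith t0) -> E.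
apply/eqP; rewrite -subr_eq0; apply/eqP.
transitivity (t / 2 * 0); last by rewrite mulr0.
by rewrite -[X in _ = _ * X]E; field; rewrite t0 x0 u0.
Qed.

Lemma fibre_difference_arith (i gt mt n d m xt xi gx mx A' S gxx mxx xxx B' K g C' c z2 z0 : R) :
  c != 0 -> z0 = 0 -> z2 = 0 ->
  i * (gt + c * mt - (n + c * d * m) - xt * (xi * (gx + c * mx + z0)))
    - A' * (S * (gxx + c * mxx + 2 * z2 - xxx * (xi * (gx + c * mx + z0))))
    + (- B' * (xi * (gx + c * mx + z0)) + K * (g + c * m) - C' * (g + c * m)) = 0 ->
  i * (gt - n - xt * (xi * (gx + z0)))
    - A' * (S * (gxx + 2 * z2 - xxx * (xi * (gx + z0))))
    + (- B' * (xi * (gx + z0)) + K * g - C' * g) = 0 ->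
  i * (mt - d * m - xt * (xi * mx)) - A' * (S * (mxx - xxx * (xi * mx)))
    - B' * (xi * mx) + K * m - C' * m = 0.
Proof.
move=> c0 -> -> E1 E0; apply: (mulfI c0); rewrite mulr0.
by rewrite -[RHS](etrans (congr2 (fun a b : R => a - b) E1 E0) (subrr 0)) /=; ring.
Qed.

Lemma tr_C_arith (t i it x xt xxx a A A' B B' C' k ga y yx yt yxx : R) :
  t != 0 -> i = t^-1 -> x != 0 -> A * i = A' * (x^-1 * x^-1) ->
  t * B' = x * (B - 2 * a * A) - xt + A * xxx ->
  i * (it * y + i * yt - (k - ga) * (i * y) - xt * (x^-1 * (i * yx)))
    - A' * (x^-1 * x^-1 * (i * yxx - xxx * (x^-1 * (i * yx))))
    - B' * (x^-1 * (i * yx)) + (i * k - it) * (i * y) - C' * (i * y) = 0 ->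
  t * C' * y = yt + ga * y - A * yxx - (B - 2 * a * A) * yx.
Proof.
move=> t0 iE x0 AE /(B_target_arith t0) -> E; rewrite [A' * (_ * _ * _)]mulrA -AE iE in E.
apply/eqP; rewrite eq_sym -subr_eq0; apply/eqP.
transitivity (t * t * 0); last by rewrite mulr0.
by rewrite -[X in _ = _ * X]E; field; rewrite t0 x0.
Qed.

(** The X_x^2 part of the logarithmic derivative of A' cancels against 2 g~^1_x; the factor 1 / T_t
    leaves the extra term [- it]. *)
Lemma k_value_arith (i it x xt xx xxt A Ax At A' A'x A't t w : R) :
  A != 0 -> x != 0 -> t != 0 -> i = t^-1 -> A' = A * (x * x) * i ->
  (Ax * (x * x) + A * (xx * x + x * xx)) * i + A * (x * x) * 0 = x * A'x /\
  (At * (x * x) + A * (xxt * x + x * xxt)) * i + A * (x * x) * it =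
    t * A't + xt * A'x ->
  2 * (x^-1 * (xx * i * w + xxt * i + 0)) - A'x / A' * (x * i * w + xt * i) - A't / A' =
  i * (2 * 0 - Ax / A * w - At / A) - it.
Proof.
move=> A0 x0 t0 iE A'E [hx ht]; rewrite (k_arith _ _ A0 x0 t0 iE A'E hx ht) iE; field.
by rewrite A0 x0 t0.
Qed.

(** At f_x = 0 and fixed g^1 the system is diagonal in g^2 and g^3, with multipliers k and k - C,
    where k is the common factor of DE_1. *)
Lemma rest_difference_arith (A B Bx Bt C Cx Ct r s w1 w2 w3 c d2 d3 m1 m2 m3 : R) :
  (- B * 0 + (2 * 0 - r * (w1 + c * 0) - s) * (w1 + c * 0 + B) + Bx * (w1 + c * 0)
      + 2 * A * 0 + Bt) * m1
  + ((- B * 0 + (2 * 0 - r * (w1 + c * 0) - s) * (w2 + c * d2 - C) - Cx * (w1 + c * 0) - Ct) * m2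
    + (- B * 0 + (2 * 0 - r * (w1 + c * 0) - s) * (w3 + c * d3) - C * (w3 + c * d3)) * m3) =
  (- B * 0 + (2 * 0 - r * w1 - s) * (w1 + B) + Bx * w1 + 2 * A * 0 + Bt) * m1
  + ((- B * 0 + (2 * 0 - r * w1 - s) * (w2 - C) - Cx * w1 - Ct) * m2
    + (- B * 0 + (2 * 0 - r * w1 - s) * w3 - C * w3) * m3)
  + (c * (2 * 0 - r * w1 - s - C) * (d3 * m3) + c * (2 * 0 - r * w1 - s - 0) * (d2 * m2)).
Proof. by ring. Qed.

Lemma tr_U_arith (t C' y yt A yxx q yx : R) :
  t * C' * (- y) = - yt + 0 * (- y) - A * (- yxx) - q * (- yx) ->
  t * C' * y = yt - A * yxx - q * yx.
Proof. by move=> E; apply: oppr_inj; rewrite -mulrN E; ring. Qed.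

Section fibred_DE1.
Variables (L L' : arbitrary_elements R) (O O' : set (base R)) (V : set (base R * triple R)).
Variables (T : R -> R) (X : base R -> R).
Variables (M : base R -> triple R -> triple R) (h : base R -> triple R).
Hypotheses (oO : open O) (oV : open V) (OV : fst @` V = O) (F : fibred O T X M h).
Hypothesis Minj : forall z m, O z -> M z m = 0 -> m = 0.
Hypothesis AE : forall z, O z -> eA L z / dd (fun y : base R => T y.1) (1, 0) z =
        eA L' (T z.1, X z) * ((dd X (0, 1) z)^-1 * (dd X (0, 1) z)^-1).
Hypothesis trE : forall z w q, V (z, w) ->
  transport_eq (eA L') (DE1_rest L) (DE1_rest L') T X M h z w q.

Local Notation e := ((0, 1) : base R).
Local Notation t := ((1, 0) : base R).
Let Tt := dd (fun y : base R => T y.1) t.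
Let i z := (Tt z)^-1.
Local Notation Xx := (dd X e).
Local Notation Xt := (dd X t).
Local Notation Xxx := (dd (dd X e) e).
Let phi (z : base R) : base R := (T z.1, X z).
Let bt z q := (Xx z)^-1 *: M z q.

Let sectionP z : O z -> exists w, V (z, w).
Proof. by rewrite -OV => -[[y w] Vy /= <-]; exists w. Qed.

Let VO z w : V (z, w) -> O z. Proof. by move=> Vz; rewrite -OV; exists (z, w). Qed.

Let M0 z : O z -> M z 0 = 0.
Proof. by move=> Oz; have := fibred_lin F 0 0 0 0 Oz; rewrite !scale0r addr0. Qed.

Let MD z u v : O z -> M z (u + v) = M z u + M z v.
Proof. by move=> Oz; have := fibred_lin F 1 1 u v Oz; rewrite !scale1r. Qed.

Let MZ z s u : O z -> M z (s *: u) = s *: M z u.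
Proof. by move=> Oz; have := fibred_lin F s 0 u 0 Oz; rewrite scale0r !addr0 scale0r addr0. Qed.

(** The transport equation at f_x = [q] minus the same equation at f_x = 0. The point w survives
    only in a scalar multiple of [M z w]. *)
Let gradient_part z w q : V (z, w) ->
  - (i z *: M z (DE1_slope L z q)) - (i z * Xt z) *: bt z q
  - (2 * (eA L z * i z)) *: dd (fun y => M y q) e z
  + (eA L z * i z * Xxx z) *: bt z q + DE1_slope L' (phi z) (bt z q)
  + (2 * (bt z q).1.1 - i z * (2 * q.1.1)) *: M z w + (2 * (bt z q).1.1) *: h z = 0.
Proof.
move=> Vz; have Oz := VO Vz.
have Mx0 : dd (fun y => M y 0) e z = 0 by rewrite (dd_congr _ oO Oz M0) dd_cst.
have nE : DE1_rest L z w q = DE1_rest L z w 0 + DE1_slope L z q + (2 * q.1.1) *: w.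
  by rewrite -DE1_restD add0r.
have mE : M z (DE1_rest L z w q) = M z (DE1_rest L z w 0) + M z (DE1_slope L z q)
    + (2 * q.1.1) *: M z w by rewrite nE !(MD _ _ Oz) (MZ _ _ Oz).
have := trE 0 Vz; have := trE q Vz; rewrite /transport_eq; cbv zeta; rewrite Mx0 (M0 Oz) mE.
set gx := dd (fun y => M y w + h y) e z.
have bE : (Xx z)^-1 *: (gx + M z q) = (Xx z)^-1 *: (gx + 0) + bt z q.
  by rewrite scalerDr addr0.
rewrite [X in DE1_rest L' _ _ X]bE (DE1_restD L') -/(phi z) -/(Tt z) -/(i z) => E1 E0.
have -> : eA L z * i z = eA L' (phi z) * ((Xx z)^-1 * (Xx z)^-1) := AE Oz.
apply: (fr_ext fr_triple) => l; move: (congr1 l E1) (congr1 l E0).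
rewrite !(linD l, linZ l, linN l) !(lin0 l).
exact: gradient_part_arith.
Qed.

Hypotheses (eL : elements_on O L) (eL' : elements_on O' L').
Hypothesis tgt : forall z, O z -> O' (phi z).

Let A0 z : O z -> eA L z != 0. Proof. by have [_ _ _] := eL; exact. Qed.
Let i0 z : O z -> i z != 0. Proof. by move=> Oz; rewrite invr_neq0// (fibred_Tt F Oz). Qed.
Let x0 z : O z -> Xx z != 0. Proof. exact: (fibred_Xx F). Qed.
Let hi : has_d O i (fun=> 0) (dd i t) := has_d_time oO (fibred_T F) (fibred_Tt F).
Let hc (c : R) : has_d O (fun=> c) (fun=> 0) (fun=> 0) := has_d_cst (O := O) c.

Let E1 : triple R := (1, 0, 0).
Let E2 : triple R := (0, 1, 0).
Let E3 : triple R := (0, 0, 1).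

(** Moving w by a multiple of [E1] in [gradient_part] isolates the scalar in front of [M z w]; it
    annihilates [M z E1], which is nonzero. *)
Lemma bt11 z q : O z -> (bt z q).1.1 = i z * q.1.1.
Proof.
move=> Oz; have [w Vw] := sectionP Oz; have [c c0 Vc] := open_fibre E1 oV Vw.
have := gradient_part q Vc; have := gradient_part q Vw.
rewrite (MD _ _ Oz) (MZ _ _ Oz) => g0 g1.
set k := 2 * (bt z q).1.1 - _ in g0 g1.
have : (k * c) *: M z E1 = 0.
  have kE : k *: (M z w + c *: M z E1) = k *: M z w + (k * c) *: M z E1.
    by rewrite scalerDr scalerA.
  by move: g1; rewrite kE; exact: (summand_eq0 g0).
move/eqP; rewrite scaler_eq0 mulf_eq0 (negbTE c0) orbF => /orP[/eqP k0|/eqP/(Minj Oz)].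
  apply: (@mulfI _ 2); first by rewrite pnatr_eq0.
  by apply/eqP; rewrite -subr_eq0 -k0 /k; apply/eqP; congr (_ - _); exact: mulrCA.
move=> /(congr1 (fun p : triple R => p.1.1))/eqP.
by rewrite oner_eq0.
Qed.

(** By [bt11] the term with w disappears. The remainder involves only M and h, and [h] solely
    through the first component of [bt z q]. *)
Lemma linear_part z q : O z ->
  - (i z *: M z (DE1_slope L z q)) - (i z * Xt z) *: bt z q
  - (2 * (eA L z * i z)) *: dd (fun y => M y q) e z
  + (eA L z * i z * Xxx z) *: bt z q + DE1_slope L' (phi z) (bt z q)
  + (2 * (bt z q).1.1) *: h z = 0.
Proof.
move=> Oz; have [w Vw] := sectionP Oz; have := gradient_part q Vw.
have -> : 2 * (bt z q).1.1 - i z * (2 * q.1.1) = 0.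
  by rewrite (bt11 _ Oz) mulrCA subrr.
by rewrite scale0r addr0.
Qed.

Let M11 z q : O z -> (M z q).1.1 = Xx z * i z * q.1.1.
Proof.
move=> Oz; have := bt11 q Oz; rewrite -mulrA => <-.
by rewrite mulrA mulfV ?mul1r// x0.
Qed.

Let M_expand z q : O z -> M z q = q.1.1 *: M z E1 + (q.1.2 *: M z E2 + q.2 *: M z E3).
Proof.
move=> Oz; rewrite -!(MZ _ _ Oz) -!(MD _ _ Oz); congr (M z _).
apply: triple_eq; rewrite /= !scaleE.
- by rewrite mulr1 !mulr0 !addr0.
- by rewrite mulr1 !mulr0 addr0 add0r.
- by rewrite mulr1 !mulr0 !add0r.
Qed.

Let D11 z q : O z -> (dd (fun y => M y q) e z).1.1 = Xxx z * i z * q.1.1.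
Proof.
move=> Oz; rewrite -(dd_comp11 (fibred_M F q))// (dd_congr _ oO Oz (fun y Oy => M11 q Oy)).
have hXx := has_d_smooth (smooth_dd e (fibred_X F)).
by have [_ -> _] := has_d_mul (has_d_mul hXx hi) (hc q.1.1) Oz; ring.
Qed.

Let row1 z q : O z ->
  - (i z * (M z (DE1_slope L z q)).1.1) - (i z * Xt z) * ((Xx z)^-1 * (M z q).1.1)
  - (2 * (eA L z * i z)) * (dd (fun y => M y q) e z).1.1
  + (eA L z * i z * Xxx z) * ((Xx z)^-1 * (M z q).1.1)
  + (eB L' (phi z) * ((Xx z)^-1 * (M z q).1.1) + 2 * eA L' (phi z) * ((Xx z)^-1 * (M z q).1.2))
  + (2 * ((Xx z)^-1 * (M z q).1.1)) * (h z).1.1 = 0.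
Proof. by move=> Oz; exact: (congr1 (fun p : triple R => p.1.1) (linear_part q Oz)). Qed.

Let row2 z q : O z ->
  - (i z * (M z (DE1_slope L z q)).1.2) - (i z * Xt z) * ((Xx z)^-1 * (M z q).1.2)
  - (2 * (eA L z * i z)) * (dd (fun y => M y q) e z).1.2
  + (eA L z * i z * Xxx z) * ((Xx z)^-1 * (M z q).1.2)
  + (- eB L' (phi z) * ((Xx z)^-1 * (M z q).1.2) - 2 * eC L' (phi z) * ((Xx z)^-1 * (M z q).1.1))
  + (2 * ((Xx z)^-1 * (M z q).1.1)) * (h z).1.2 = 0.
Proof. by move=> Oz; exact: (congr1 (fun p : triple R => p.1.2) (linear_part q Oz)). Qed.

Let row3 z q : O z ->
  - (i z * (M z (DE1_slope L z q)).2) - (i z * Xt z) * ((Xx z)^-1 * (M z q).2)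
  - (2 * (eA L z * i z)) * (dd (fun y => M y q) e z).2
  + (eA L z * i z * Xxx z) * ((Xx z)^-1 * (M z q).2)
  + (- eB L' (phi z) * ((Xx z)^-1 * (M z q).2))
  + (2 * ((Xx z)^-1 * (M z q).1.1)) * (h z).2 = 0.
Proof. by move=> Oz; exact: (congr1 (fun p : triple R => p.2) (linear_part q Oz)). Qed.

Let AiE z : O z -> eA L z * i z = eA L' (phi z) * ((Xx z)^-1 * (Xx z)^-1).
Proof. exact: AE. Qed.

(** The first row couples g^1 to g^2_x by the coefficient 2 A; comparing it with 2 A' on the target
    side fixes the second row of M on directions without g^1. *)
Let M22 z : O z -> (M z E2).1.2 = i z.
Proof.
move=> Oz; have := row1 E2 Oz; rewrite !(M11 _ Oz) D11//.
by move=> /(second_row_arith (i0 Oz) (x0 Oz) (A0 Oz) (AiE Oz)) ->; rewrite mulr1.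
Qed.

Let M23 z : O z -> (M z E3).1.2 = 0.
Proof.
move=> Oz; have := row1 E3 Oz; rewrite !(M11 _ Oz) D11//.
by move=> /(second_row_arith (i0 Oz) (x0 Oz) (A0 Oz) (AiE Oz)) ->; rewrite mulr0.
Qed.

Let U z := Tt z * (M z E3).2.
Let U0 z := - (Tt z * (M z E2).2).
Let Tt0 z : O z -> Tt z != 0. Proof. exact: (fibred_Tt F). Qed.
Let iE z : i z = (Tt z)^-1. Proof. by []. Qed.

Let sTt : smooth_on O Tt. Proof. exact: (smooth_dd _ (fibred_T F)). Qed.

Let smooth_comp2 q : smooth_on O (fun z => (M z q).2).
Proof.
apply: (@smooth_post _ _ _ _ O (fun z => M z q) (snd_lin (R * R)%type R)) => //.
  by move=> x; exact: cvg_snd.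
exact: fibred_M F q.
Qed.

Let sU : smooth_on O U. Proof. exact: smooth_mul. Qed.
Let sU0 : smooth_on O U0. Proof. by apply: smooth_opp => //; exact: smooth_mul. Qed.
Let hU := has_d_smooth sU.
Let hU0 := has_d_smooth sU0.

Let M33 z : O z -> (M z E3).2 = i z * U z.
Proof. by move=> Oz; rewrite /U /i mulKf// Tt0. Qed.

Let M32 z : O z -> (M z E2).2 = - (i z * U0 z).
Proof. by move=> Oz; rewrite /U0 /i mulrN opprK mulKf// Tt0. Qed.

Let h33 : has_d O (fun z => (M z E3).2) (fun z => i z * dd U e z)
  (fun z => dd i t z * U z + i z * dd U t z).
Proof.
apply: (has_d_ext oO (has_d_mul hi hU)) => // z Oz; first by rewrite M33.
by rewrite mul0r add0r.
Qed.

Let h32 : has_d O (fun z => (M z E2).2) (fun z => - (i z * dd U0 e z))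
  (fun z => - (dd i t z * U0 z + i z * dd U0 t z)).
Proof.
apply: (has_d_ext oO (has_d_opp (has_d_mul hi hU0))) => // z Oz; first by rewrite M32.
by rewrite mul0r add0r.
Qed.

(** The first two entries of [M z E3] vanish, so its third entry cannot vanish for injective M. *)
Let Un0 z : O z -> U z != 0.
Proof.
move=> Oz; rewrite mulf_neq0 ?Tt0//; apply/eqP => m0.
have : E3 = 0.
  apply: (Minj Oz); apply: triple_eq => //; last exact: M23.
  by rewrite M11//= mulr0.
by move=> /(congr1 snd)/eqP; rewrite oner_eq0.
Qed.

Let D2 q z : O z -> (dd (fun y => M y q) e z).2 = dd (fun y => (M y q).2) e z.
Proof. by move=> Oz; rewrite (dd_comp2 (fibred_M F q)). Qed.

(** Third row in the direction [E3], where the source slope is - B [E3]. *)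
Let trB z : O z -> Tt z * eB L' (phi z) =
  Xx z * (eB L z - 2 * (dd U e z / U z) * eA L z) - Xt z + eA L z * Xxx z.
Proof.
move=> Oz; have := row3 E3 Oz; have [_ d33 _] := h33 Oz.
rewrite !(M11 _ Oz) D2// d33 (M_expand (DE1_slope _ _ _) Oz) [(_ *: _ + _).2]/= !(M33 Oz).
exact: (tr_B_arith (Tt0 Oz) (iE z) (x0 Oz) (Un0 Oz)).
Qed.

(** Second row in the direction [E2]: the source slope contains 2 A [E1], which brings in this
    entry, and [trB] eliminates the target B. *)
Let M21 z : O z -> (M z E1).1.2 = dd U e z / U z * i z.
Proof.
move=> Oz; have := row2 E2 Oz.
have d2 : (dd (fun y => M y E2) e z).1.2 = 0.
  rewrite -(dd_comp12 (fibred_M F E2))// (dd_congr _ oO Oz M22).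
  by have [_ -> _] := hi Oz.
rewrite !(M11 _ Oz) d2 (M_expand (DE1_slope _ _ _) Oz) [(_ *: _ + _).1.2]/= !(M22 Oz) (M23 Oz).
exact: (M21_arith (Tt0 Oz) (iE z) (x0 Oz) (Un0 Oz) (A0 Oz) (trB Oz)).
Qed.

(** The same argument as for [M21], in the third row. *)
Let M31 z : O z -> (M z E1).2 = i z * (dd U0 e z - dd U e z / U z * U0 z).
Proof.
move=> Oz; have := row3 E2 Oz; have [_ d32 _] := h32 Oz.
rewrite !(M11 _ Oz) D2// d32 (M_expand (DE1_slope _ _ _) Oz) [(_ *: _ + _).2]/= !(M32 Oz) !(M33 Oz).
exact: (M31_arith (Tt0 Oz) (iE z) (x0 Oz) (Un0 Oz) (A0 Oz) (trB Oz)).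
Qed.

Let A'E z : O z -> eA L' (phi z) = eA L z * (Xx z * Xx z) * i z.
Proof. by move=> Oz; apply: (A_target_arith (x0 Oz)); exact: AiE. Qed.

(** First row in the direction [E1], the one in which [h] enters; everything else in it is already
    known. *)
Let h1 z : O z -> (h z).1.1 = Xt z * i z.
Proof.
move=> Oz; have := row1 E1 Oz; rewrite !(M11 _ Oz) D11// (M21 Oz).
exact: (h1_arith (Tt0 Oz) (iE z) (x0 Oz) (Un0 Oz) (A'E Oz) (trB Oz)).
Qed.

Let g w z := M z w + h z.
Let sg w : smooth_on O (g w).
Proof. by apply: smooth_add => //; [exact: fibred_M F w|exact: fibred_h F]. Qed.

Let gx11 z w : O z -> (dd (g w) e z).1.1 = Xxx z * i z * w.1.1 + dd (dd X e) t z * i z.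
Proof.
move=> Oz; have g11 y : O y -> (g w y).1.1 = Xx y * i y * w.1.1 + Xt y * i y.
  by move=> Oy; transitivity ((M y w).1.1 + (h y).1.1) => //; rewrite M11// h1.
rewrite -(dd_comp11 (sg w))// (dd_congr _ oO Oz g11).
have hXx := has_d_smooth (smooth_dd e (fibred_X F)).
have hXt := has_d_smooth_x oO (fibred_X F).
by have [_ -> _] := has_d_add (has_d_mul (has_d_mul hXx hi) (hc w.1.1)) (has_d_mul hXt hi) Oz; ring.
Qed.

Let K z w := 2 * ((Xx z)^-1 * ((dd (g w) e z).1.1 + 0)) -
  dd (eA L') e (phi z) / eA L' (phi z) * (g w z).1.1 - dd (eA L') t (phi z) / eA L' (phi z).
Let k z (w : triple R) := 2 * 0 - dd (eA L) e z / eA L z * w.1.1 - dd (eA L) t z / eA L z.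

(** The factor [K] involves the transformed first component only, which [M11] and [h1] determine
    completely. *)
Let KE z w : O z -> K z w = i z * k z w - dd i t z.
Proof.
move=> Oz; have g11 : (g w z).1.1 = Xx z * i z * w.1.1 + Xt z * i z.
  by transitivity ((M z w).1.1 + (h z).1.1) => //; rewrite M11// h1.
have [aA _ _ _] := eL; have [aA' _ _ _] := eL'.
have hA' := has_d_target_A oO (fibred_T F) (fibred_X F) (fibred_Tt F) tgt Oz aA aA' A'E.
rewrite /K gx11// g11.
exact: k_value_arith (A0 Oz) (x0 Oz) (Tt0 Oz) (iE z) (A'E Oz) hA'.
Qed.

Let dd_gD v z w c m : O z -> dd (g (w + c *: m)) v z = dd (g w) v z + c *: dd (fun y => M y m) v z.
Proof.
move=> Oz; have gE y : O y -> g (w + c *: m) y = g w y + c *: M y m.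
  by move=> Oy; rewrite /g (MD _ _ Oy) (MZ _ _ Oy) addrAC.
have dm := smooth_diff (fibred_M F m) Oz.
rewrite (dd_congr _ oO Oz gE) dd_add; last exact: differentiableZ.
  by rewrite dd_scale.
exact: smooth_diff (sg w) Oz.
Qed.

Let dd2_gD z w c m : O z -> dd (dd (g (w + c *: m)) e) e z =
  dd (dd (g w) e) e z + c *: dd (dd (fun y => M y m) e) e z.
Proof.
move=> Oz; have gE y : O y -> dd (g (w + c *: m)) e y = dd (g w) e y + c *: dd (fun y => M y m) e y.
  exact: dd_gD.
have dm := smooth_diff (smooth_dd e (fibred_M F m)) Oz.
rewrite (dd_congr _ oO Oz gE) dd_add; last exact: differentiableZ.
  by rewrite dd_scale.
exact: smooth_diff (smooth_dd e (sg w)) Oz.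
Qed.

Let row3_at0 z w : V (z, w) ->
  i z * ((dd (g w) t z).2 - (M z (DE1_rest L z w 0)).2
      - Xt z * ((Xx z)^-1 * ((dd (g w) e z).2 + (M z 0).2)))
    - eA L' (phi z) * ((Xx z)^-1 * (Xx z)^-1 * ((dd (dd (g w) e) e z).2
        + 2 * (dd (fun y => M y 0) e z).2
        - Xxx z * ((Xx z)^-1 * ((dd (g w) e z).2 + (M z 0).2))))
    + (- eB L' (phi z) * ((Xx z)^-1 * ((dd (g w) e z).2 + (M z 0).2)) + K z w * (g w z).2
        - eC L' (phi z) * (g w z).2) = 0.
Proof.
move=> Vz; have Oz := VO Vz.
have -> : K z w = 2 * ((Xx z)^-1 * ((dd (g w) e z).1.1 + (M z 0).1.1)) -
    dd (eA L') e (phi z) / eA L' (phi z) * (g w z).1.1 - dd (eA L') t (phi z) / eA L' (phi z).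
  by rewrite /K (M0 Oz).
exact: (congr1 snd (trE 0 Vz)).
Qed.

(** Moving w along [m], which has no g^1-component, leaves [K] unchanged. The difference of the
    third component of [transport_eq] at f_x = 0 is then a linear equation for one entry of the
    third row of M; in it [k - ga] is the source multiplier of that direction, and [k] cancels by
    [KE]. *)
Let fibre_difference z w m ga y yx yt yxx : O z -> m.1.1 = 0 ->
  (M z m).2 = i z * y -> (dd (fun y => M y m) e z).2 = i z * yx ->
  (dd (dd (fun y => M y m) e) e z).2 = i z * yxx ->
  (dd (fun y => M y m) t z).2 = dd i t z * y + i z * yt ->
  V (z, w) ->
  (forall c, (M z (DE1_rest L z (w + c *: m) 0)).2 =
    (M z (DE1_rest L z w 0)).2 + c * (k z w - ga) * (i z * y)) ->
  Tt z * eC L' (phi z) * y = yt + ga * y - eA L z * yxx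
    - (eB L z - 2 * (dd U e z / U z) * eA L z) * yx.
Proof.
move=> Oz m0 my mx mxx mt Vw NE; have [c c0 Vc] := open_fibre m oV Vw.
have E1' := row3_at0 Vc; have E0' := row3_at0 Vw.
have M02 : (M z 0).2 = 0 by rewrite M0.
have D02 : (dd (fun y => M y 0) e z).2 = 0 by rewrite (dd_congr _ oO Oz M0) dd_cst.
have KK : K z (w + c *: m) = K z w.
  by rewrite !KE// /k; do 5 congr (_ - _) || congr (_ * _); transitivity (w.1.1 + c * m.1.1) => //; rewrite m0 mulr0 addr0.
have gE : (g (w + c *: m) z).2 = (g w z).2 + c * (i z * y).
  rewrite -my; transitivity ((M z w + c *: M z m + h z).2); first by rewrite /g (MD _ _ Oz) (MZ _ _ Oz).
  exact: addrAC.
have gtE : (dd (g (w + c *: m)) t z).2 = (dd (g w) t z).2 + c * (dd i t z * y + i z * yt).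
  by rewrite -mt dd_gD.
have gxE : (dd (g (w + c *: m)) e z).2 = (dd (g w) e z).2 + c * (i z * yx).
  by rewrite -mx dd_gD.
have gxxE : (dd (dd (g (w + c *: m)) e) e z).2 = (dd (dd (g w) e) e z).2 + c * (i z * yxx).
  by rewrite -mxx dd2_gD.
rewrite KK gE gtE gxE gxxE NE in E1'.
have := fibre_difference_arith c0 M02 D02 E1' E0'; rewrite (KE _ Oz).
exact: (tr_C_arith (Tt0 Oz) (iE z) (x0 Oz) (AiE Oz) (trB Oz)).
Qed.

Let hUx : has_d O (dd U e) (dd (dd U e) e) (dd (dd U e) t) := has_d_smooth (smooth_dd e sU).
Let hU0x : has_d O (dd U0 e) (dd (dd U0 e) e) (dd (dd U0 e) t) := has_d_smooth (smooth_dd e sU0).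

Let trC z : O z -> Tt z * eC L' (phi z) * U z = dd U t z + eC L z * U z
  - eA L z * dd (dd U e) e z - (eB L z - 2 * (dd U e z / U z) * eA L z) * dd U e z.
Proof.
move=> Oz; have [w Vw] := sectionP Oz; have [_ d33 t33] := h33 Oz.
(* The multiplier of g^3 is k - C, hence [ga] is C. *)
apply: (@fibre_difference z w E3 (eC L z) (U z) (dd U e z) (dd U t z) (dd (dd U e) e z) Oz) => //.
- exact: M33.
- by rewrite D2.
- rewrite -(dd2_comp2 oO (fibred_M F E3))// (has_d2 oO h33 (has_d_mul hi hUx) Oz).
  by rewrite mul0r add0r.
- by rewrite -(dd_comp2 (fibred_M F E3)).
- move=> c; rewrite !(M_expand (DE1_rest _ _ _ _) Oz) -M33//.
  apply: etrans (rest_difference_arith _ _ _ _ _ _ _ _ _ _ _ _ _ _ _ _ _ _) _.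
  by rewrite mul0r mulr0 addr0 mul1r.
Qed.

Let trU z : O z -> Tt z * eC L' (phi z) * U0 z = dd U0 t z
  - eA L z * dd (dd U0 e) e z - (eB L z - 2 * (dd U e z / U z) * eA L z) * dd U0 e z.
Proof.
move=> Oz; have [w Vw] := sectionP Oz; have [_ d32 t32] := h32 Oz.
have m32 : (M z E2).2 = i z * (- U0 z) by exact: etrans (M32 Oz) (esym (mulrN _ _)).
apply: tr_U_arith.
(* The multiplier of g^2 is k itself, hence [ga] is 0; the signs come from the minus in U^0 = - T_t
   M_32. *)
apply: (@fibre_difference z w E2 0 (- U0 z) (- dd U0 e z) (- dd U0 t z) (- dd (dd U0 e) e z) Oz) => //.
- by rewrite D2// d32; ring.
- rewrite -(dd2_comp2 oO (fibred_M F E2))// (has_d2 oO h32 (has_d_opp (has_d_mul hi hU0x)) Oz).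
  by ring.
- by rewrite -(dd_comp2 (fibred_M F E2))// t32; ring.
- move=> c; rewrite !(M_expand (DE1_rest _ _ _ _) Oz) -m32.
  apply: etrans (rest_difference_arith _ _ _ _ _ _ _ _ _ _ _ _ _ _ _ _ _ _) _.
  by rewrite mul0r mulr0 add0r mul1r.
Qed.

(** Only the linear part of the transformation is identified here, as the difference of the images
    of w and 0; [h] is left to a later comparison. *)
Lemma transforms_of_fibred : exists P, [/\ transforms O O' L L' P, pT P = T, pX P = X &
  forall z w, O z -> M z w = (transfDE1 P (z, w)).2 - (transfDE1 P (z, 0)).2].
Proof.
exists (FunctionsTXU T X U U0); split => //.
  split=> //=; [exact: fibred_T F|exact: fibred_X F].
move=> z w Oz; have t0 := Tt0 Oz; have u0 := Un0 Oz.
rewrite /transfDE1 pdxE !pdtE !pdxE -dd_time1 -/(Tt z) /= (M_expand w Oz).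
apply: triple_eq.
- transitivity (w.1.1 * (M z E1).1.1 + (w.1.2 * (M z E2).1.1 + w.2 * (M z E3).1.1)) => //.
  rewrite !(M11 _ Oz) /=.
  transitivity (Xx z / Tt z * w.1.1 + Xt z / Tt z - (Xx z / Tt z * 0 + Xt z / Tt z)) => //.
  by rewrite iE; ring.
- transitivity (w.1.1 * (M z E1).1.2 + (w.1.2 * (M z E2).1.2 + w.2 * (M z E3).1.2)) => //.
  rewrite (M21 Oz) (M22 Oz) (M23 Oz).
  transitivity ((w.1.2 / Tt z + dd U e z / (Tt z * U z) * w.1.1 + dd U t z / (Tt z * U z)) -
    (0 / Tt z + dd U e z / (Tt z * U z) * 0 + dd U t z / (Tt z * U z))) => //.
  by rewrite iE; field; rewrite t0 u0.
- transitivity (w.1.1 * (M z E1).2 + (w.1.2 * (M z E2).2 + w.2 * (M z E3).2)) => //.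
  rewrite (M31 Oz) (M32 Oz) (M33 Oz).
  transitivity ((U z / Tt z * w.2 - U0 z / Tt z * w.1.2
    + (dd U0 e z * U z - U0 z * dd U e z) / (Tt z * U z) * w.1.1
    + (dd U0 t z * U z - U0 z * dd U t z) / (Tt z * U z)) -
   (U z / Tt z * 0 - U0 z / Tt z * 0
    + (dd U0 e z * U z - U0 z * dd U e z) / (Tt z * U z) * 0
    + (dd U0 t z * U z - U0 z * dd U t z) / (Tt z * U z))) => //.
  by rewrite iE; field; rewrite t0 u0.
Qed.
End fibred_DE1.
End gradient_part.

Section from_DE1.
Context {R : realType}.
Variables (O O' : set (base R)) (V : set (base R * triple R)).
Variables (b : transformation (triple R)) (L L' : arbitrary_elements R).
Hypotheses (oO : open O) (adm : admissible (@class_DE1 R) O O' V b).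
Hypotheses (eL : elements_on O L) (eL' : elements_on O' L').
Hypotheses (SL : same_pde O (source b) (DE1 L)).
Hypotheses (SL' : same_pde O' (target b) (DE1 L')).

Lemma transforms_of_DE1 : exists2 P, transforms O O' L L' P &
  forall p, V p -> tmap b p = transfDE1 P p.
Proof.
have [_ _ [oV cV OV VO'] [sPhi _ bij] maps] := adm.
have VO p : V p -> O p.1 by move=> Vp; rewrite -OV; exists p.
have ne p : V p -> eA L p.1 != 0 by move=> /VO; have [_ _ _] := eL; exact.
have ne' p : V p -> eA L' (tmap b p).1 != 0 by move=> /VO'; have [_ _ _] := eL'; exact.
have maps1 : maps_pde V (tmap b) (evol (eA L) (DE1_rest L)) (evol (eA L') (DE1_rest L')).
  have m := maps_pde_same VO VO' SL SL' maps.
  move=> f f' z sf sf' Vz pr.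
  exact: iff_trans (iff_sym (DE1_evol L z sf)) (iff_trans (m f f' z sf sf' Vz pr)
    (DE1_evol L' _ sf')).
pose e1 : triple R := (1, 0, 0).
have e10 : e1 != 0 by apply/eqP => /(congr1 (fun p : triple R => p.1.1))/eqP; rewrite oner_eq0.
have [T [X [M [h [F mapE Minj AE trE]]]]] := fibre_form fr_triple e10 oV sPhi bij
  maps1 ne ne' (DE1_midpoint L) (DE1_midpoint L') cV OV.
have tgt z : O z -> O' (T z.1, X z).
  by rewrite -OV => -[[y w] Vy /= <-]; have := VO' _ Vy; rewrite mapE.
have [P [tr PT PX PM]] := transforms_of_fibred oO oV OV F Minj AE trE eL eL' tgt.
have [M' [h' [F' mapE' trE']]] := transfDE1_fibred oO tr eL eL'.
rewrite PT PX in F' mapE' trE'.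
have MM z w : O z -> M z w = M' z w.
  move=> Oz; rewrite PM// -!mapE'// /fibred_map /=.
  have M'0 : M' z 0 = 0.
    by have := fibred_lin F' 0 0 0 0 Oz; rewrite !scale0r addr0.
  by rewrite M'0 add0r addrK.
have Minj' z m : O z -> M' z m = 0 -> m = 0 by move=> Oz; rewrite -MM//; exact: Minj.
have trE'V z w q : (O `*` setT) (z, w) ->
    transport_eq (eA L') (DE1_rest L) (DE1_rest L') T X M' h' z w q.
  by move=> [Oz _]; exact: trE'.
(* The given map and the one built from [P] have the same M and both satisfy [linear_part]; in the
   direction [e1] the inhomogeneous part has the factor 2 / T_t, which is nonzero. *)
have hh z : O z -> h z = h' z.
  move=> Oz; have := linear_part oO oV OV F Minj AE trE e1 Oz.
  have := linear_part oO (open_cylinder oO) (fst_cylinder _ O) F' Minj' AE trE'V e1 Oz.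
  rewrite -!(MM _ _ Oz) -(dd_congr _ oO Oz (fun y Oy => MM y e1 Oy)).
  move=> <- /addrI; rewrite (bt11 oO oV OV F Minj AE trE e1 Oz) /= mulr1.
  apply: scalerI; rewrite mulf_neq0 ?pnatr_eq0// invr_neq0//.
  exact: (fibred_Tt F Oz).
exists P => // -[z w] Vz; have Oz := VO _ Vz.
by rewrite mapE// -(mapE' (z, w))// /fibred_map /= MM// hh.
Qed.
End from_DE1.

(** * Recovering T, X, U^1 and U^0 from a transformation *)

Section agreement.
Context {R : realType}.
Variables (O : set (base R)) (P P2 : functions_TXU R).
Hypothesis oO : open O.

(** The functions are total, but a transformation fixes their values over [O] only. *)
Definition agree := forall z, O z -> [/\ pT P z.1 = pT P2 z.1, pX P z = pX P2 z,
  pU1 P z = pU1 P2 z & pU0 P z = pU0 P2 z].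

Lemma derive1_congr_time z : O z -> (forall z, O z -> pT P z.1 = pT P2 z.1) ->
  derive1 (pT P) z.1 = derive1 (pT P2) z.1.
Proof. by move=> Oz TT; rewrite -!dd_time1; exact: (dd_congr _ oO Oz TT). Qed.

Lemma transfL_agree p : agree -> O p.1 -> transfL P p = transfL P2 p.
Proof. by move=> PP /PP[a b c d]; rewrite /transfL a b c d. Qed.

Lemma transfDE1_agree p : agree -> O p.1 -> transfDE1 P p = transfDE1 P2 p.
Proof.
move=> PP Op; have TT y : O y -> pT P y.1 = pT P2 y.1 by move=> /PP[].
have XX y : O y -> pX P y = pX P2 y by move=> /PP[].
have UU y : O y -> pU1 P y = pU1 P2 y by move=> /PP[].
have VV y : O y -> pU0 P y = pU0 P2 y by move=> /PP[].
rewrite /transfDE1 pdxE !pdtE !pdxE (derive1_congr_time Op TT).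
rewrite !(dd_congr _ oO Op XX) !(dd_congr _ oO Op UU) !(dd_congr _ oO Op VV).
by rewrite (TT _ Op) (XX _ Op) (UU _ Op) (VV _ Op).
Qed.

Lemma affine_arith (u v u' v' w c : R) : c != 0 ->
  u * w + v = u' * w + v' -> u * (w + c * 1) + v = u' * (w + c * 1) + v' -> u = u' /\ v = v'.
Proof.
move=> c0 E0 E1; have uu : u = u'.
  apply: (mulIf c0); transitivity (u * (w + c * 1) + v - (u * w + v)); first by ring.
  by rewrite E0 E1; ring.
by split=> //; apply: (addrI (u * w)); rewrite E0 uu.
Qed.

Lemma slope3_arith (al be ga de al' be' ga' de' w1 w2 w3 c : R) : c != 0 ->
  al * w3 - be * w2 + ga * w1 + de = al' * w3 - be' * w2 + ga' * w1 + de' ->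
  al * (w3 + c * 1) - be * (w2 + c * 0) + ga * (w1 + c * 0) + de =
  al' * (w3 + c * 1) - be' * (w2 + c * 0) + ga' * (w1 + c * 0) + de' -> al = al'.
Proof.
move=> c0 E0 E1; apply: (mulIf c0).
transitivity (al * (w3 + c * 1) - be * (w2 + c * 0) + ga * (w1 + c * 0) + de -
  (al * w3 - be * w2 + ga * w1 + de)); first by ring.
by rewrite E0 E1; ring.
Qed.

Lemma slope2_arith (al be ga de al' be' ga' de' w1 w2 w3 c : R) : c != 0 ->
  al * w3 - be * w2 + ga * w1 + de = al' * w3 - be' * w2 + ga' * w1 + de' ->
  al * (w3 + c * 0) - be * (w2 + c * 1) + ga * (w1 + c * 0) + de =
  al' * (w3 + c * 0) - be' * (w2 + c * 1) + ga' * (w1 + c * 0) + de' -> be = be'.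
Proof.
move=> c0 E0 E1; apply: (mulIf c0).
transitivity ((al * w3 - be * w2 + ga * w1 + de) -
  (al * (w3 + c * 0) - be * (w2 + c * 1) + ga * (w1 + c * 0) + de)); first by ring.
by rewrite E0 E1; ring.
Qed.

Lemma agree_transfL (V : set (base R * R)) : open V -> fst @` V = O ->
  (forall p, V p -> transfL P p = transfL P2 p) -> agree.
Proof.
move=> oV OV PP z; rewrite -OV => -[[y w] Vy /= <-].
have [c c0 Vc] := open_fibre (1 : R^o) oV Vy.
have [Te Xe E0] := PP _ Vy; have [_ _ E1] := PP _ Vc.
by have [] := affine_arith c0 E0 E1.
Qed.

(** U^1 / T_t and - U^0 / T_t are the coefficients of g^3 and g^2 in the third component, so U^1 is
    determined itself and not merely up to a constant factor, as from its logarithmic derivatives in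
    g~^2. *)
Lemma agree_transfDE1 (V : set (base R * triple R)) : open V -> fst @` V = O ->
  (forall z, O z -> dd (fun y : base R => pT P y.1) (1, 0) z != 0) ->
  (forall p, V p -> transfDE1 P p = transfDE1 P2 p) -> agree.
Proof.
move=> oV OV Tt0 PP.
have TX z : O z -> pT P z.1 = pT P2 z.1 /\ pX P z = pX P2 z.
  by rewrite -OV => -[[y w] Vy /= <-]; have := congr1 fst (PP _ Vy) => -[].
have TT z : O z -> pT P z.1 = pT P2 z.1 by move=> /TX[].
move=> z Oz; have [Te Xe] := TX z Oz; have [w Vw] : exists w, V (z, w).
  by move: Oz; rewrite -OV => -[[y w] Vy /= <-]; exists w.
have t0 : derive1 (pT P) z.1 != 0 by rewrite -dd_time1; exact: Tt0.
have tt := derive1_congr_time Oz TT.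
have [c c0 Vc] := open_fibre ((0, 0, 1) : triple R) oV Vw.
have [d d0 Vd] := open_fibre ((0, 1, 0) : triple R) oV Vw.
have E0 := congr1 (fun p : base R * triple R => p.2.2) (PP _ Vw).
split => //.
- have := slope3_arith c0 E0 (congr1 (fun p : base R * triple R => p.2.2) (PP _ Vc)).
  by rewrite -tt; apply: mulIf; rewrite invr_neq0.
- have := slope2_arith d0 E0 (congr1 (fun p : base R * triple R => p.2.2) (PP _ Vd)).
  by rewrite -tt; apply: mulIf; rewrite invr_neq0.
Qed.
End agreement.

Lemma admissible_congr (R : realType) (W : normedModType R)
    (cls : set (base R) -> pde W -> Prop) (O O' : set (base R)) (V : set (base R * W))
    S S' Phi Psi : (forall p, V p -> Phi p = Psi p) ->
  admissible cls O O' V (Transformation S S' Phi) ->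
  admissible cls O O' V (Transformation S S' Psi).
Proof.
move=> PP [cS cS' [oV cV OV VO'] pt m]; split.
- exact: cS.
- exact: cS'.
- split; [exact: oV|exact: cV|exact: OV|].
  move=> p Vp; have := VO' p Vp; rewrite [tmap _ p](PP p Vp).
  exact.
- exact: (point_transformation_congr oV PP pt).
- exact: (maps_pde_congr oV PP m).
Qed.

(** * Independence of the arbitrary elements that represent a system *)

Section comparison.
Context {R : realType}.
Variable O : set (base R).

Lemma same_pde_refl (W : normedModType R) (D : set (base R)) (S : pde W) : same_pde D S S.
Proof. by move=> f z. Qed.

Lemma same_pde_sym (W : normedModType R) (D : set (base R)) (S S' : pde W) :
  same_pde D S S' -> same_pde D S' S.
Proof. by move=> SS f z sf Dz; apply: iff_sym; exact: SS. Qed.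

Lemma same_pde_trans (W : normedModType R) (D : set (base R)) (S1 S2 S3 : pde W) :
  same_pde D S1 S2 -> same_pde D S2 S3 -> same_pde D S1 S3.
Proof. by move=> S12 S23 f z sf Dz; apply: (iff_trans (S12 f z sf Dz)); exact: S23. Qed.

(** An equation determines its arbitrary elements over [D], hence its associated system; so
    [induces] does not depend on the representatives. *)
Lemma same_DE1_of_parabolic (D : set (base R)) (S : pde R) (Q : pde (triple R)) L L2 :
  open D -> same_pde D S (parabolic L) -> same_pde D S (parabolic L2) ->
  same_pde D Q (DE1 L2) -> same_pde D Q (DE1 L).
Proof.
move=> oD SL SL2 QL2; apply: (same_pde_trans QL2); apply: same_DE1 => //.
exact: parabolic_unique (same_pde_trans (same_pde_sym SL2) SL).
Qed.

Lemma same_parabolic_of_DE1 (D : set (base R)) (S : pde R) (Q : pde (triple R)) L L2 :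
  same_pde D Q (DE1 L) -> same_pde D Q (DE1 L2) ->
  same_pde D S (parabolic L2) -> same_pde D S (parabolic L).
Proof.
move=> QL QL2 SL2; apply: (same_pde_trans SL2); apply: same_parabolic.
exact: DE1_unique (same_pde_trans (same_pde_sym QL2) QL).
Qed.

Lemma over_base (W : normedModType R) (V : set (base R * W)) p :
  fst @` V = O -> V p -> O p.1.
Proof. by move=> <- Vp; exists p. Qed.
End comparison.

Theorem theorem4 (R : realType) (O O' : set (base R))
    (openO : open O) (convexO : @convex_set R (base R) O) (openO' : open O') :
  [/\ (* a transformation of the displayed form between equations induces the
         displayed transformation between the associated systems *)
      forall (L L' : arbitrary_elements R) (P : functions_TXU R)
             (V : set (base R * R)),
        elements_on O L -> elements_on O' L' ->
        admissible (@class_L R) O O' V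
          (Transformation (parabolic L) (parabolic L') (transfL P)) ->
        admissible (@class_DE1 R) O O' (O `*` setT)
          (Transformation (DE1 L) (DE1 L') (transfDE1 P)),
      (* every admissible transformation of the class of equations induces
         exactly one of the class of systems, up to restriction in the fibres *)
      forall (V : set (base R * R)) (a : transformation R),
        admissible (@class_L R) O O' V a ->
        exists b : transformation (triple R),
          [/\ admissible (@class_DE1 R) O O' (O `*` setT) b,
              induces O O' V (O `*` setT) a b
            & forall (V' : set (base R * triple R))
                     (b' : transformation (triple R)),
                admissible (@class_DE1 R) O O' V' b' ->
                induces O O' V V' a b' -> restriction_of O O' V' b' b]
    & (* every admissible transformation of the class of systems is induced by
         exactly one of the class of equations, up to restriction *)
      forall (V : set (base R * triple R)) (b : transformation (triple R)),
        admissible (@class_DE1 R) O O' V b ->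
        exists a : transformation R,
          [/\ admissible (@class_L R) O O' (O `*` setT) a,
              induces O O' (O `*` setT) V a b
            & forall (V' : set (base R * R)) (a' : transformation R),
                admissible (@class_L R) O O' V' a' ->
                induces O O' V' V a' b -> restriction_of O O' V' a' a]].
Proof.
split.
- move=> L L' P V eL eL' adm; have [_ _ [oV _ OV _] _ _] := adm.
  have [P2 tr PP] := transforms_of_parabolic openO adm eL eL'
    (@same_pde_refl _ _ _ _) (@same_pde_refl _ _ _ _).
  (* The functions of [P] are a priori arbitrary; over [O] they agree with those of [P2], for which
     smoothness and the transformation rules have been derived. *)
  have ag := agree_transfL oV OV (fun p Vp => esym (PP p Vp)).
  apply: (admissible_congr _ (transforms_DE1 openO tr eL eL' convexO)).
  by move=> p [Op _]; exact: (transfDE1_agree openO ag Op).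
- move=> V a adm; have [[L eL SL] [L' eL' SL'] [oV _ OV _] _ _] := adm.
  have [P tr PP] := transforms_of_parabolic openO adm eL eL' SL SL'.
  exists (Transformation (DE1 L) (DE1 L') (transfDE1 P)); split.
  + exact: (transforms_DE1 openO tr eL eL' convexO).
  + by exists L, L', P; split.
  + move=> V' b' [_ _ [_ _ OV' _] _ _] [L2 [L2' [P2 [[_ _] [SL2 SL2'] [QL QL'] aP bP]]]].
    split.
    * exact: (same_DE1_of_parabolic openO SL SL2 QL).
    * exact: (same_DE1_of_parabolic openO' SL' SL2' QL').
    * have ag : agree O P2 P by apply: (agree_transfL oV OV) => q Vq; rewrite -aP// PP.
      by move=> p Vp; rewrite bP// (transfDE1_agree openO ag (over_base OV' Vp)).
- move=> V b adm; have [[L eL SL] [L' eL' SL'] [oV _ OV _] _ _] := adm.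
  have [P tr PP] := transforms_of_DE1 openO adm eL eL' SL SL'.
  exists (Transformation (parabolic L) (parabolic L') (transfL P)); split.
  + exact: (transforms_parabolic openO tr eL eL' convexO).
  + by exists L, L', P; split.
  + move=> V' a' [_ _ [_ _ OV' _] _ _] [L2 [L2' [P2 [[_ _] [SL2 SL2'] [QL QL'] aP bP]]]].
    split.
    * exact: (same_parabolic_of_DE1 SL QL SL2).
    * exact: (same_parabolic_of_DE1 SL' QL' SL2').
    * have ag : agree O P P2.
        by apply: (agree_transfDE1 openO oV OV (tr_Tt tr)) => q Vq; rewrite -bP// PP.
      move=> p Vp; rewrite aP//.
      exact: (esym (transfL_agree ag (over_base OV' Vp))).
Qed.
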